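(* Let $N\ge3$, $m>1$, and let $f$ satisfy the combustion Assumption (A) stated in the context. Let $u$ be a transition solution of $u_t=\Delta u^m+f(u)$ in $\mathbb R^N\times(0,\infty)$ with initial datum in $\mathscr X$ which converges uniformly in $\mathbb R^N$, as $t\to\infty$, to some $U\in\mathcal S$, and let $b(t)$ be its free-boundary radius. Then there exist constants $c_U,C_U,T>0$ such that \[ c_U\,t^{\beta_N}\le b(t)\le C_U\,t^{\beta_N}\qquad(t\ge T), \] where $\beta_N=\dfrac{m}{N(m-1)+2}$.
   Context: Assumption (A) for $N\ge3$: there is $\theta\in(0,1)$ such that (F1) $f$ is locally Lipschitz on $[0,\infty)$, $f\in C^1([\theta,\infty))\cap C^2((\theta,\infty))$, $f=0$ on $[0,\theta]$, $f>0$ on $(\theta,1)$, $f(1)=0$, $f<0$ on $(1,\infty)$, $f'_+(\theta)\ge0$ (right derivative), $f'(1)<0$; (F2) there is $\delta_\theta>0$ such that $f$ is nondecreasing on $[\theta,\theta+\delta_\theta]$; (F3) for each $q\in(\theta,1)$ the solution $W_q$ of $W_q''+\frac{N-1}{r}W_q'+f(W_q^{1/m})=0$, $W_q(0)=q^m$, $W_q'(0)=0$, reaches $\theta^m$ at a finite first radius $R(q)$, and with $\alpha(q)=-W_q'(R(q))$ one has $R(q)\alpha(q)\to0$ as $q\downarrow\theta$. $\mathscr X$ is the set of $\phi\in C([0,\infty))$ for which there is $r_0>0$ with $\phi^{m-1}\in C^1([0,r_0])$, $\phi(r)>0$ for $r\in[0,r_0)$, $\phi(r)=0$ for $r\ge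 r_0$, and $(\phi^{m-1})'(r_0)<0$; $\phi$ is identified with the radial function $x\mapsto\phi(|x|)$. ''Solution'' means the unique bounded nonnegative (radial) weak solution of the Cauchy problem. Its free-boundary radius $b(t)$ is defined by $\{u(\cdot,t)>0\}=B_{b(t)}$. A transition solution is such a solution which, as $t\to\infty$, neither vanishes (converges to $0$) nor spreads (converges locally uniformly to $1$). $\mathcal S$ (ground states) is the set of positive radial stationary solutions $U=U(r)$ on $\mathbb R^N$ with $\Delta U^m+f(U)=0$, $U_r<0$ (for $r>0$), $U(0)\in(\theta,1)$, and $U(r)\to0$ as $r\to\infty$. *)

(* Defs.v *)
From HB Require Import structures.
From mathcomp Require Import all_boot all_order all_algebra.
From mathcomp Require Import all_classical all_reals all_analysis.

Set Implicit Arguments.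
Unset Strict Implicit.
Unset Printing Implicit Defensive.

Import Order.TTheory GRing.Theory Num.Theory.
Import numFieldNormedType.Exports.

Local Open Scope classical_set_scope.
Local Open Scope ring_scope.

Section OneVariable.
Context {R : realType}.
Implicit Types (A : set R) (h : R -> R).

(* Derivative of [h] at [x] relative to [A]: it is one-sided at an endpoint of
   an interval [A] and two-sided in its interior. *)
Definition has_deriv_within A h (x l : R) : Prop :=
  (h y - h x) / (y - x) @[y --> within A x^'] --> l.

Definition C1_with A h (h' : R -> R) : Prop :=
  {within A, continuous h'} /\ forall x, A x -> has_deriv_within A h x (h' x).

Definition C1_on A h : Prop := exists h', C1_with A h h'.

Definition C2_on A h : Prop :=
  exists h' h'', C1_with A h h' /\ C1_with A h' h''.

End OneVariable.

Section Nonlinearity.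
Context {R : realType}.
Variables (N : nat) (m : R) (f : R -> R).

(* [W], with derivative [W'], solves
     W'' + (N-1)/r W' + f(W^(1/m)) = 0,  W(0) = q^m,  W'(0) = 0
   on [0, rho], and [rho] is the first radius at which W = theta^m. *)
Definition shooting_solution (theta q : R) (W W' : R -> R) (rho : R) : Prop :=
  [/\ 0 < rho,
      C1_with `[0, rho] W W',
      W 0 = q `^ m /\ W' 0 = 0,
      forall r, 0 < r <= rho -> exists W'' : R,
        has_deriv_within `[0, rho] W' r W'' /\
        W'' + (N%:R - 1) / r * W' r + f (W r `^ m^-1) = 0 &
      W rho = theta `^ m /\ forall r, 0 <= r < rho -> W r <> theta `^ m].

Definition assumptionF1 (theta : R) : Prop :=
  [/\ forall M : R, [lipschitz f x | x in `[0, M]],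
      exists f', [/\ C1_with `[theta, +oo[ f f', 0 <= f' theta & f' 1 < 0],
      C2_on `]theta, +oo[ f,
      forall s, 0 <= s <= theta -> f s = 0 &
      [/\ forall s, theta < s < 1 -> 0 < f s,
          f 1 = 0 &
          forall s, 1 < s -> f s < 0]].

Definition assumptionF2 (theta : R) : Prop :=
  exists2 delta : R, 0 < delta &
    {in `[theta, theta + delta] &, {homo f : s1 s2 / s1 <= s2}}.

Definition assumptionF3 (theta : R) : Prop :=
  exists rad alpha : R -> R,
    (forall q, theta < q < 1 -> exists W W' : R -> R,
       shooting_solution theta q W W' (rad q) /\ alpha q = - W' (rad q)) /\
    rad q * alpha q @[q --> theta^'+] --> (0 : R).

Definition assumptionA (theta : R) : Prop :=
  [/\ 0 < theta < 1, assumptionF1 theta, assumptionF2 theta &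
      assumptionF3 theta].

End Nonlinearity.

Definition classX {R : realType} (m : R) (phi : R -> R) : Prop :=
  {within `[0, +oo[, continuous phi} /\
  exists r0 : R, [/\ 0 < r0,
    forall r, 0 <= r < r0 -> 0 < phi r,
    forall r, r0 <= r -> phi r = 0 &
    exists g, C1_with `[0, r0] (fun r => phi r `^ (m - 1)) g /\ g r0 < 0].

Section Space.
Context {R : realType}.

(* Euclidean norm; the library norm on ['rV[R]_N] is the sup norm. *)
Definition enorm N (x : 'rV[R]_N) : R := Num.sqrt (\sum_i x ord0 i ^+ 2).

Definition partial N (i : 'I_N) (g : 'rV[R]_N -> R) (x : 'rV[R]_N) : R :=
  'D_(delta_mx ord0 i) g x.

Definition laplacian N (g : 'rV[R]_N -> R) (x : 'rV[R]_N) : R :=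
  \sum_i partial i (partial i g) x.

Definition C2_space N (g : 'rV[R]_N -> R) : Prop :=
  [/\ continuous g,
      forall i : 'I_N, (forall x, derivable g x (delta_mx ord0 i)) /\
        continuous (partial i g) &
      forall i j : 'I_N,
        (forall x, derivable (partial i g) x (delta_mx ord0 j)) /\
        continuous (partial j (partial i g))].

(* Iterated Lebesgue integral over R^N.  It is only applied to continuous
   compactly supported integrands, for which, by Fubini, it is the integral
   against the N-dimensional Lebesgue measure. *)
Fixpoint integral_space N : ('rV[R]_N -> R) -> R :=
  match N with
  | 0%N => fun g => g 0
  | N'.+1 => fun g =>
      \int[@lebesgue_measure R]_s
        integral_space (fun y : 'rV[R]_N' =>
          g (row_mx (const_mx s : 'rV[R]_1) y))
  end.

(* C^{2,1} functions with compact support in R^N x R; they need not vanish at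
   time 0. *)
Definition test_function N (phi : 'rV[R]_N -> R -> R) : Prop :=
  [/\ continuous (fun p : 'rV[R]_N * R => phi p.1 p.2),
      (forall x t, derivable (phi x) t 1) /\
        continuous (fun p : 'rV[R]_N * R => derive1 (phi p.1) p.2),
      forall i : 'I_N,
        (forall x t, derivable (phi^~ t) x (delta_mx ord0 i)) /\
        continuous (fun p : 'rV[R]_N * R => partial i (phi^~ p.2) p.1),
      forall i j : 'I_N,
        (forall x t,
           derivable (partial i (phi^~ t)) x (delta_mx ord0 j)) /\
        continuous (fun p : 'rV[R]_N * R =>
                      partial j (partial i (phi^~ p.2)) p.1) &
      exists rho : R, forall x t,
        rho < enorm x \/ rho < `|t| -> phi x t = 0].

Definition radial N (g : 'rV[R]_N -> R) : Prop :=
  forall x y, enorm x = enorm y -> g x = g y.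

(* Bounded nonnegative radial (continuous) weak solution [u x t] on
   R^N x [0, +oo) of u_t = Delta u^m + f(u), with u(x,0) = u0(|x|). *)
Definition weak_solution N (m : R) (f u0 : R -> R)
    (u : 'rV[R]_N -> R -> R) : Prop :=
  [/\ {within [set p : 'rV[R]_N * R | 0 <= p.2],
         continuous (fun p => u p.1 p.2)},
      exists M : R, forall x t, 0 <= t -> 0 <= u x t <= M,
      forall t, 0 <= t -> radial (u^~ t),
      forall x, u x 0 = u0 (enorm x) &
      forall phi, test_function phi ->
        \int[@lebesgue_measure R]_(t in `[0, +oo[)
          integral_space (fun x : 'rV[R]_N =>
            u x t * derive1 (phi x) t + u x t `^ m * laplacian (phi^~ t) x
            + f (u x t) * phi x t)
        + integral_space (fun x : 'rV[R]_N => u0 (enorm x) * phi x 0) = 0].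

Definition vanishing N (u : 'rV[R]_N -> R -> R) : Prop :=
  {uniform, (fun t x => u x t) @ +oo --> (fun=> 0 : R)}.

Definition spreading N (u : 'rV[R]_N -> R -> R) : Prop :=
  {family compact, (fun t x => u x t) @ +oo --> (fun=> 1 : R)}.

Definition transition_solution N (m : R) (f u0 : R -> R)
    (u : 'rV[R]_N -> R -> R) : Prop :=
  [/\ weak_solution m f u0 u, ~ vanishing u & ~ spreading u].

Definition free_boundary_radius N (u : 'rV[R]_N -> R -> R) (b : R -> R) : Prop :=
  forall t, 0 < t -> [set x | 0 < u x t] = [set x | enorm x < b t].

Definition ground_state (N : nat) (m : R) (f : R -> R) (theta : R)
    (U : R -> R) : Prop :=
  [/\ forall r, 0 <= r -> 0 < U r,
      C2_space (fun x : 'rV[R]_N => U (enorm x) `^ m) /\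
        (forall x : 'rV[R]_N,
           laplacian (fun y : 'rV[R]_N => U (enorm y) `^ m) x
           + f (U (enorm x)) = 0),
      forall r, 0 < r -> derivable U r 1 /\ derive1 U r < 0,
      theta < U 0 < 1 &
      U r @[r --> +oo] --> (0 : R)].

End Space.

(* Main.v *)
(* For large times [u] is at most theta outside a fixed ball, so there it solves
   the porous medium equation.  With [v] the profile of [u] in [q = |x|^2], the
   operator [L p = 4 q p'' + 2 N p'] is the radial Laplacian, and the potential
   [P(q,t) = int_T0^t v^m] satisfies [P_t = (L P)^m] classically for [q >= q0].
   This removes the degeneracy: [P] is compared with explicit functions by the
   maximum principle.  [P(.,t)] vanishes outside the support of [u(.,t)], [u(.,t)]
   vanishes where [P(.,2t)] does, and [P(q0,t)] grows linearly in [t] because [u]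
   converges to a positive state.
   Upper bound: [P <= t (q/q0)^(1-N/2)], then a travelling front with
   that height dies out at [q ~ t^(2 beta)].  Lower bound: the subsolution
   [A t q^(1-N/2) (1 - sqrt q / (eps t^beta))_+^2]. *)
Require Import Defs.
From HB Require Import structures.
From mathcomp Require Import all_boot all_order all_algebra.
From mathcomp Require Import all_classical all_reals all_analysis.
From mathcomp Require Import ring lra.

Import Order.TTheory GRing.Theory Num.Theory.
Import numFieldNormedType.Exports.

Local Open Scope classical_set_scope.
Local Open Scope ring_scope.

Set Implicit Arguments.
Unset Strict Implicit.
Unset Printing Implicit Defensive.

(** [u] is only a continuous weak solution, so comparison cannot be run on it directly. One
    integration in time removes the time derivative from the weak formulation, and a Weyl lemma then
    gives the potential enough spatial regularity for pointwise arguments. The exponent comes from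
    one balance. A front of height [t q^(1-N/2)] and width [q] has [P_t] of order [q^(1-N/2)] and
    [(L P)^m] of order [(t q^(-N/2))^m]; they agree when [t^m = q^(1+N(m-1)/2)], that is,
    [q = t^(2 beta)]. The delicate point is at infinity. Where [v(.,t)] vanishes, [L P = 0] leaves
    room for a tail [c + k q^(1-N/2)]. It is excluded because [P] decays like [q^(-N)], faster than
    either term. Since [P] grows in time, its vanishing far out at one time holds at all earlier
    times, which supplies the outer boundary of every comparison. Working in [q = |x|^2] avoids
    polar coordinates: fixing one coordinate [s] replaces [q] by [s^2 + q], and the coefficients of
    [L] are polynomial. *)

Section Calculus.
Context {R : realType}.
Implicit Types (h H : R -> R) (x y t q : R).
Notation mu := (@lebesgue_measure R).

(** * One-variable calculus and a parabolic maximum principle *)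

Lemma is_derive_continuous h (x d : R) : is_derive x 1 h d -> {for x, continuous h}.
Proof. by move=> [hd _]; apply: differentiable_continuous; apply/derivable1_diffP. Qed.

Lemma FTC_Rintegral h H (a b : R) : a <= b -> continuous h ->
  (forall x, is_derive x 1 H (h x)) ->
  \int[mu]_(x in `[a, b]) h x = H b - H a.
Proof.
move=> ab ch dH; move: ab; rewrite le_eqVlt => /predU1P[->|ab].
  by rewrite set_itv1 Rintegral_set1 subrr.
have cH : continuous H by move=> x; exact: is_derive_continuous (dH x).
rewrite /Rintegral (@continuous_FTC2 _ _ H)//.
- exact: continuous_subspaceT.
- split => [x _||]; first by have [] := dH x.
    exact/cvg_at_right_filter/cH.
  exact/cvg_at_left_filter/cH.
- by move=> x _; rewrite derive1E; have [_ ->] := dH x.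
Qed.

Lemma continuous_integrable_itv h (a b : R) : continuous h ->
  mu.-integrable `[a, b] (EFin \o h).
Proof.
move=> ch; apply: continuous_compact_integrable; first exact: segment_compact.
exact: continuous_subspaceT.
Qed.

Lemma antiderivative_exists h (c : R) : continuous h ->
  exists2 H, forall x, is_derive x 1 H (h x) & H c = 0.
Proof.
move=> ch.
pose I a x := \int[mu]_(t in `[a, x]) h t.
have dI a x : a < x -> is_derive x 1 (I a) (h x).
  move=> ax; have [||||d1 d2] := @continuous_FTC1_closed R h a x (x + 1).
  - by rewrite ltrDl.
  - exact: continuous_integrable_itv.
  - by [].
  - exact: ch.
  - by split; [exact: d1 | rewrite -derive1E].
have addI a b x : a <= b -> b <= x -> I a x = I a b + I b x.
  move=> ab bx; apply/eqP; rewrite addrC -subr_eq; apply/eqP.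
  rewrite /I (@Rintegral_itvB _ _ (BLeft a) (BRight x) b)//=.
  - rewrite Rintegral_itv_obnd_cbnd//; apply: integrableS (continuous_integrable_itv b x ch) => //.
    by apply: subset_itvr; rewrite bnd_simp.
  - exact: continuous_integrable_itv.
(* An integral over an empty interval is [0], so this difference is the oriented integral from [c]
   to [x]. Around [x] it agrees with [I a - I a c] for a base point [a] to the left of both [x] and
   [c], where [dI] applies. *)
exists (fun x => I c x - I x c); last by rewrite subrr.
move=> x; pose a := Num.min x c - 1.
have ax : a < x by rewrite /a ltrBlDr (@le_lt_trans _ _ x)// ?ltrDl// ge_min lexx.
have ac : a <= c by rewrite /a lerBlDr (@le_trans _ _ c)// ?lerDl// ge_min lexx orbT.
apply: (@near_eq_is_derive _ _ _ (fun y => I a y - I a c)) => //; last first.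
  by rewrite -[X in is_derive _ _ _ X]subr0; apply: is_deriveB; exact: dI.
near=> y.
have ay : a <= y by apply/ltW; near: y; exact: lt_nbhsr.
have I0 u v : v <= u -> I u v = 0.
  rewrite le_eqVlt => /predU1P[->|vu]; first by rewrite /I set_itv1 Rintegral_set1.
  by rewrite /I set_itv_ge ?Rintegral_set0// -leNgt bnd_simp.
have [cy|yc] := leP c y.
  by rewrite (addI a c y)// (I0 y c)// addrAC subrr add0r subr0.
rewrite (addI a y c)// ?(ltW yc)// (I0 c y (ltW yc)); lra.
Unshelve. all: end_near. Qed.

Lemma MVT_is_derive h (dh : R -> R) (a b : R) : a <= b ->
  (forall x, a <= x <= b -> is_derive x 1 h (dh x)) ->
  exists2 c, a <= c <= b & h b - h a = dh c * (b - a).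
Proof.
move=> ab dH; have [||c] := @MVT_segment R h dh a b ab.
- by move=> x; rewrite in_itv/= => /andP[/ltW ? /ltW ?]; apply: dH; apply/andP.
- apply: continuous_in_subspaceT => x; rewrite inE/= in_itv/= => xab.
  exact: is_derive_continuous (dH _ xab).
- by rewrite in_itv/= => ? ?; exists c.
Qed.

Lemma is_derive_ge0_le h (dh : R -> R) (a b : R) : a <= b ->
  (forall x, a <= x <= b -> is_derive x 1 h (dh x)) ->
  (forall x, a <= x <= b -> 0 <= dh x) -> h a <= h b.
Proof.
move=> ab dH h0; have [c cab e] := MVT_is_derive ab dH.
by rewrite -subr_ge0 e mulr_ge0 ?subr_ge0// h0.
Qed.

Lemma is_derive_gt0_lt h (dh : R -> R) (a b : R) : a < b ->
  (forall x, a <= x <= b -> is_derive x 1 h (dh x)) ->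
  (forall x, a <= x <= b -> 0 < dh x) -> h a < h b.
Proof.
move=> ab dH h0; have [c cab e] := MVT_is_derive (ltW ab) dH.
by rewrite -subr_gt0 e mulr_gt0 ?subr_gt0// h0.
Qed.

Lemma is_derive0_eq h (a b : R) : a <= b ->
  (forall x, a <= x <= b -> is_derive x 1 h 0) -> h a = h b.
Proof.
move=> ab dH; have [c cab] := MVT_is_derive ab dH.
by rewrite mul0r => /eqP; rewrite subr_eq0 eq_sym => /eqP.
Qed.

(** Tube lemma: compactness of the segment, in near-covering form, makes the continuity at the
    points [(q, t0)] uniform in [q]. *)
Lemma continuous_uniform_segment (F : R -> R -> R) (a b t0 e : R) :
  (forall q, a <= q <= b -> {for (q, t0), continuous (fun p : R * R => F p.1 p.2)}) ->
  0 < e ->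
  \forall t \near t0, forall q, a <= q <= b -> `|F q t - F q t0| < e.
Proof.
move=> cF e0.
have := @segment_compact R a b; rewrite compact_near_coveringP.
move=> /(_ _ (nbhs t0) (fun t q => `|F q t - F q t0| < e)) H.
have {}H : \forall x \near nbhs t0, `[a, b]%classic `<=` (fun q => `|F q x - F q t0| < e).
  apply: H => q; rewrite /= in_itv/= => qab.
  have /cvgrPdist_lt/(_ (e / 2)) c1 := cF q qab.
  have /c1[/= [U V] [/= hU hV] UV] : 0 < e / 2 by rewrite divr_gt0.
  exists (U, V) => // -[q' t'] /= [Uq Vt].
  have := UV (q', t') (conj Uq Vt); have := UV (q', t0) (conj Uq (nbhs_singleton hV)).
  rewrite /= => A B; rewrite (splitr e).
  have -> : F q' t' - F q' t0 = (F q t0 - F q' t0) - (F q t0 - F q' t') by lra.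
  by rewrite (le_lt_trans (ler_normB _ _))// ltrD.
near=> t => q qab; suff : `[a, b]%classic q by apply: (near H t).
by rewrite /= in_itv.
Unshelve. all: end_near. Qed.

Lemma is_derive_expansion h x (d e : R) : is_derive x 1 h d -> 0 < e ->
  \forall y \near x, `|h y - h x - d * (y - x)| <= e * `|y - x|.
Proof.
move=> [dh <-] e0; move: (dh); rewrite /derivable => /cvg_ex[/= l hl].
have -> : 'D_1 h x = l by exact: cvg_lim hl.
move/cvgrPdist_lt/(_ _ e0): hl; rewrite /dnbhs /within /=.
move=> /nbhs_ballP[r /= r0 B]; apply/nbhs_ballP; exists r => //= y.
rewrite /ball/= => xy; have [->|yx] := eqVneq y x.
  by rewrite !subrr mulr0 subr0 normr0 mulr0.
have := B (y - x); rewrite /ball/= sub0r normrN distrC => /(_ xy).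
rewrite subr_eq0 => /(_ yx) /ltW; rewrite [_%:A]mulr1 subrK => H.
have -> : h y - h x - l * (y - x) = ((y - x)^-1 *: (h y - h x) - l) * (y - x).
  by rewrite mulrBl /GRing.scale/= mulrAC mulVf ?mul1r// subr_eq0.
by rewrite normrM distrC ler_wpM2r// distrC.
Qed.

Lemma is_derive_intro h x (d : R) :
  (forall e, 0 < e -> \forall y \near x, `|h y - h x - d * (y - x)| <= e * `|y - x|) ->
  is_derive x 1 h d.
Proof.
move=> H; have hl : h0^-1 *: (h (h0 *: 1 + x) - h x) @[h0 --> (0 : R)^'] --> d.
  apply/cvgrPdist_le => e e0; have := H _ e0 => /nbhs_ballP[r /= r0 B].
  rewrite /dnbhs /within /=; apply/nbhs_ballP; exists r => //= y.
  rewrite /ball/= sub0r normrN => yr y0.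
  have := B (y + x); rewrite /ball/= opprD addrCA subrr addr0 normrN => /(_ yr).
  rewrite addrK [_%:A]mulr1 => {}B.
  rewrite -(@ler_pM2r _ `|y|) ?normr_gt0//.
  rewrite -[X in X <= _]normrM mulrBl -normrN opprB (le_trans _ B)//.
  by rewrite /GRing.scale/= mulrAC mulVf// mul1r.
by split; [apply/cvg_ex; exists d | exact: cvg_lim hl].
Qed.

(* The same proposition as [is_derive], but not a type class, so that the rules
   below leave their premises as goals instead of triggering instance search. *)
Definition has_derivative (f : R -> R) x (d : R) : Prop := is_derive x 1 f d.

Section DeriveRules.
Variables (f g : R -> R) (x df dg : R).
Hypotheses (hf : has_derivative f x df) (hg : has_derivative g x dg).

Lemma has_derivative_eq d : df = d -> is_derive x 1 f d.
Proof. by move=> <-. Qed.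

Lemma has_derivativeD : has_derivative (fun t => f t + g t) x (df + dg).
Proof. exact: is_deriveD. Qed.

Lemma has_derivativeN : has_derivative (fun t => - f t) x (- df).
Proof. exact: is_deriveN. Qed.

Lemma has_derivativeM : has_derivative (fun t => f t * g t) x (df * g x + f x * dg).
Proof.
have -> : df * g x + f x * dg = f x *: dg + g x *: df by rewrite /GRing.scale/=; ring.
exact: is_deriveM.
Qed.

Lemma has_derivative_comp (F : R -> R) (dF : R) :
  has_derivative F (f x) dF -> has_derivative (fun t => F (f t)) x (dF * df).
Proof. by move=> h; exact: (@is_derive1_comp _ F f x _ _ h hf). Qed.

Lemma has_derivativeX n : has_derivative (fun t => f t ^+ n) x (n%:R * f x ^+ n.-1 * df).
Proof.
apply: (@has_derivative_comp (fun t => t ^+ n)).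
by split; [exact: exprn_derivable|rewrite exp_derive /GRing.scale/= mulr1].
Qed.

Lemma has_derivativeV : f x != 0 -> has_derivative (fun t => (f t)^-1) x (- df / f x ^+ 2).
Proof.
move=> fx; have [h1 <-] := hf; split; first exact: derivableV.
by rewrite deriveV// /GRing.scale/=; field.
Qed.

Lemma has_derivative_powR (a : R) : 0 < f x ->
  has_derivative (fun t => f t `^ a) x (a * f x `^ (a - 1) * df).
Proof.
move=> fx; apply: (@has_derivative_comp (fun t => t `^ a)).
exact: is_derive1_powR.
Qed.

Lemma has_derivative_sqrt : 0 < f x ->
  has_derivative (fun t => Num.sqrt (f t)) x ((2 * Num.sqrt (f x))^-1 * df).
Proof.
move=> fx; apply: (@has_derivative_comp Num.sqrt).
exact: is_derive1_sqrt.
Qed.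

End DeriveRules.

Lemma has_derivative_id x : has_derivative (fun t => t) x 1.
Proof. exact: is_derive_id. Qed.

Lemma has_derivative_cst (a : R) x : has_derivative (fun=> a) x 0.
Proof. exact: is_derive_cst. Qed.

(** If [d2 > 0], then [dh] is positive just to the right of its zero [x], and [h] would exceed its
    maximum there. *)
Lemma second_derivative_test h (dh : R -> R) (x d2 : R) :
  (\forall y \near x, is_derive (y : R) 1 h (dh y)) -> is_derive x 1 dh d2 ->
  (\forall y \near x, h y <= h x) -> dh x = 0 /\ d2 <= 0.
Proof.
move=> dh1 dh2 hmax.
have := dh1 => /nbhs_ballP[e1 /= e10 B1].
have := hmax => /nbhs_ballP[e2 /= e20 B2].
pose e := Num.min e1 e2 / 2.
have e0 : 0 < e by rewrite divr_gt0// lt_min e10.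
have ee : e < Num.min e1 e2 by rewrite ltr_pdivrMr// ltr_pMr ?lt_min ?e10// ltr1n.
move: ee; rewrite lt_min => /andP[ee1 ee2].
have bx y : x - e <= y <= x + e -> `|x - y| <= e by rewrite ler_norml; lra.
have D y : x - e <= y <= x + e -> is_derive y 1 h (dh y).
  by move=> /bx yb; apply: B1; rewrite /ball/= (le_lt_trans yb).
have M y : x - e <= y <= x + e -> h y <= h x.
  by move=> /bx yb; apply: B2; rewrite /ball/= (le_lt_trans yb).
have dx0 : dh x = 0.
  suff xD : is_derive x 1 h 0.
    by have [|_ <-] := D x; [lra|case: xD].
  apply: (@derive1_at_max R h (x - e) (x + e)); [lra| | |].
  - by move=> t; rewrite in_itv/= => /andP[/ltW t1 /ltW t2]; have [] := D t; rewrite ?t1.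
  - by rewrite in_itv/=; lra.
  - by move=> t; rewrite in_itv/= => /andP[/ltW t1 /ltW t2]; apply: M; rewrite t1.
split=> //; rewrite leNgt; apply/negP => d20.
have d22 : 0 < d2 / 2 by rewrite divr_gt0.
have := is_derive_expansion dh2 d22 => /nbhs_ballP[e3 /= e30 B3].
pose z := x + Num.min e (e3 / 2).
have xz : x < z by rewrite ltrDl lt_min e0 divr_gt0.
have ze : z <= x + e by rewrite lerD2l ge_min lexx.
have ze3 : z - x < e3.
  rewrite addrAC subrr add0r (@le_lt_trans _ _ (e3 / 2))// ?ge_min ?lexx ?orbT//.
  by rewrite ltr_pdivrMr// ltr_pMr// ltr1n.
have : h x < h z; last by rewrite ltNge M// ze andbT; lra.
(* [dh] vanishes at [x], so strict growth is extracted only on [[w, z]]; on [[x, w]] monotonicity is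
   enough. *)
pose w := (x + z) / 2.
have hw : h w < h z.
  apply: (@is_derive_gt0_lt h dh); [rewrite /w; lra| |].
    by move=> y yy; apply: D; move: yy; rewrite /w; lra.
  move=> y yy; have : `|dh y - dh x - d2 * (y - x)| <= d2 / 2 * `|y - x|.
    by apply: B3; rewrite /ball/= ltr_norml; move: yy; rewrite /w; lra.
  have yx : x < y by move: yy; rewrite /w; lra.
  rewrite (gtr0_norm (_ : 0 < y - x)) ?subr_gt0// dx0 subr0 ler_norml => /andP[+ _].
  have : 0 < d2 / 2 * (y - x) by rewrite mulr_gt0 ?subr_gt0.
  lra.
rewrite (le_lt_trans _ hw)//; apply: (@is_derive_ge0_le h dh); [rewrite /w; lra| |].
  by move=> y yy; apply: D; move: yy; rewrite /w; lra.
move=> y yy; have : `|dh y - dh x - d2 * (y - x)| <= d2 / 2 * `|y - x|.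
  by apply: B3; rewrite /ball/= ltr_norml; move: yy; rewrite /w; lra.
have yx : x <= y by move: yy; lra.
rewrite (ger0_norm (_ : 0 <= y - x)) ?subr_ge0// dx0 subr0 ler_norml => /andP[+ _].
have : 0 <= d2 / 2 * (y - x) by rewrite mulr_ge0 ?subr_ge0// ltW.
lra.
Qed.

(** Subtracting [del * (t - t1)] makes the time derivative of [D] at least [del] at the maximum of
    the penalised function, against [d <= 0]. The sign condition is asked only at positive spatial
    maxima, where the first and second derivatives in [q] are controlled. *)
Lemma max_principle (D : R -> R -> R) (q1 q2 t1 t2 : R) :
  (forall q t, q1 <= q <= q2 -> t1 <= t <= t2 ->
     {for (q, t), continuous (fun p : R * R => D p.1 p.2)}) ->
  (forall t, t1 <= t <= t2 -> D q1 t <= 0) ->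
  (forall t, t1 <= t <= t2 -> D q2 t <= 0) ->
  (forall q, q1 <= q <= q2 -> D q t1 <= 0) ->
  (forall q t, q1 < q < q2 -> t1 < t <= t2 -> 0 < D q t ->
     (\forall z \near q, D z t <= D q t) ->
     exists2 d, is_derive t 1 (D q) d & d <= 0) ->
  forall q t, q1 <= q <= q2 -> t1 <= t <= t2 -> D q t <= 0.
Proof.
move=> cD D1 D2 D0 Dmax q t qq tt; rewrite leNgt; apply/negP => Dpos.
(* The penalty costs at most [D q t / 2] over the whole time interval, so [D] is still positive at
   the maximum of [F]; this keeps the maximum off the parabolic boundary. *)
pose del := D q t / (t2 - t1 + 1) / 2.
have t21 : 0 < t2 - t1 + 1 by move: tt; lra.
have del0 : 0 < del by rewrite !divr_gt0.
have delE : del * (t2 - t1 + 1) * 2 = D q t.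
  by rewrite /del; field; lra.
pose F (p : R * R) := D p.1 p.2 - del * (p.2 - t1).
pose A := `[q1, q2]%classic `*` `[t1, t2]%classic.
have [||| [qm tm] /= cA Fmax] := @compact_EVT_max _ R F A.
- by exists (q, t); split; rewrite /= in_itv.
- by apply: compact_setX; exact: segment_compact.
- apply: continuous_in_subspaceT => -[x s]; rewrite inE => -[/=]; rewrite !in_itv/= => xq st.
  apply: (@cvgB _ _ _ _ _ (fun p : R * R => D p.1 p.2)); first exact: cD.
  apply: (@cvgMr R _ _ _ _ del); apply: cvgB; [exact: cvg_snd|exact: cvg_cst].
move: cA; rewrite inE => -[/=]; rewrite !in_itv/= => qmA tmA.
have Fm x s : q1 <= x <= q2 -> t1 <= s <= t2 -> F (x, s) <= F (qm, tm).
  by move=> xq st; apply: Fmax; rewrite inE; split; rewrite /= in_itv.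
have Dm : 0 < D qm tm.
  have := Fm _ _ qq tt; rewrite /F/=.
  have : del * (t - t1) <= del * (t2 - t1 + 1) by rewrite ler_pM2l//; lra.
  have : 0 <= del * (tm - t1) by rewrite mulr_ge0 ?(ltW del0)//; move: tmA; lra.
  lra.
have qm1 : q1 < qm < q2.
  move: qmA; rewrite !le_eqVlt => /andP[/predU1P[q1E|->] /predU1P[q2E|->]]//.
  - by move: (D1 _ tmA) Dm; rewrite q1E; lra.
  - by move: (D1 _ tmA) Dm; rewrite q1E; lra.
  - by move: (D2 _ tmA) Dm; rewrite -q2E; lra.
have tm1 : t1 < tm <= t2.
  move: (tmA) => /andP[+ ->]; rewrite le_eqVlt => /predU1P[t1E|->//].
  by move: (D0 _ qmA) Dm; rewrite t1E; lra.
have [|d dD d0] := Dmax _ _ qm1 tm1 Dm.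
  have : \forall z \near qm, z \in `]q1, q2[ by apply: near_in_itvoo; rewrite in_itv.
  apply: filterS => z; rewrite in_itv/= => /andP[/ltW z1 /ltW z2].
  by have := Fm z tm; rewrite z1 z2 => /(_ isT tmA); rewrite /F/=; lra.
have del2 : 0 < del / 2 by rewrite divr_gt0.
have := is_derive_expansion dD del2 => /nbhs_ballP[e3 /= e30 B3].
(* Only an earlier time is compared, since [tm] may be the final time [t2]. *)
pose s := Num.max t1 (tm - e3 / 2).
have stm : s < tm.
  rewrite /s gt_max; case/andP: tm1 => -> _ /=.
  by rewrite ltrBlDr ltrDl divr_gt0.
have st1 : t1 <= s by rewrite le_max lexx.
have se : tm - s < e3.
  have : tm - e3 / 2 <= s by rewrite le_max lexx orbT.
  lra.
have : `|D qm s - D qm tm - d * (s - tm)| <= del / 2 * `|s - tm|.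
  by apply: B3; rewrite /ball/= ltr_norml; lra.
have : F (qm, s) <= F (qm, tm) by apply: Fm => //; move: tmA; lra.
rewrite /F/= (ltr0_norm (_ : s - tm < 0)) ?subr_lt0// ler_norml => + /andP[A1 A2].
have : d * (s - tm) >= 0 by rewrite mulr_le0// subr_le0 ltW.
have : 0 < del * (tm - s) by rewrite mulr_gt0// subr_gt0.
lra.
Qed.

End Calculus.

Ltac derive_rule := first
  [ eassumption
  | apply: has_derivative_cst | apply: has_derivative_id
  | apply: has_derivativeN | apply: has_derivativeD | apply: has_derivativeM
  | apply: has_derivativeX | apply: has_derivativeV
  | apply: has_derivative_powR | apply: has_derivative_sqrt ].
Ltac derive_rules := (apply: has_derivative_eq); [repeat derive_rule | cbv beta].

(** * Integrals of radial functions over [R^N], written in the variable [q = |x|^2] *)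

Section RadialIntegral.
Context {R : realType}.
Implicit Types (h g H J : R -> R) (x y t q s K C M : R).
Notation mu := (@lebesgue_measure R).

Lemma Rintegral_subset (D : set R) h a b :
  `[a, b] `<=` D -> (forall x, D x -> ~~ (a <= x <= b) -> h x = 0) ->
  \int[mu]_(x in D) h x = \int[mu]_(x in `[a, b]) h x.
Proof.
move=> abD h0; rewrite Rintegral_mkcond [RHS]Rintegral_mkcond; congr Rintegral.
apply/funext => x; rewrite /patch; case: ifPn; rewrite ?inE ?notin_setE => Dx; case: ifPn => //.
- by rewrite notin_setE/= in_itv/= => /negP; exact: h0.
- by rewrite inE => /abD.
Qed.

(** Whole-line integrals become differences of a primitive, so linearity, bounds, positivity and
    scaling reduce to facts about derivatives. *)
Lemma Rintegral_support h H C : 0 <= C -> continuous h ->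
  (forall x, C < `|x| -> h x = 0) -> (forall x, is_derive x 1 H (h x)) ->
  \int[mu]_x h x = H C - H (- C).
Proof.
move=> C0 ch h0 dH; rewrite (@Rintegral_subset _ _ (- C) C)//.
  by apply: FTC_Rintegral => //; rewrite ge0_cp.
by move=> x _; rewrite -ler_norml -ltNge => /h0.
Qed.

(** A nondecreasing primitive with equal end values is constant, hence has zero derivative. This is
    how vanishing integrals of nonnegative functions are exploited throughout. *)
Lemma antiderivative_eq_ge0 h H (c d : R) : (forall x, 0 <= h x) ->
  (forall x, is_derive x 1 H (h x)) -> H c = H d ->
  forall x, c < x < d -> h x = 0.
Proof.
move=> h0 dH Hcd x xcd.
have Hmono y z : y <= z -> H y <= H z.
  by move=> yz; apply: (@is_derive_ge0_le _ H h).
have Hcst y : c <= y <= d -> H y = H d.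
  move=> /andP[y1 y2]; apply/eqP; rewrite eq_le Hmono//=.
  by rewrite -Hcd Hmono.
suff dx : is_derive x 1 H 0 by have [_ <-] := dH x; case: dx.
apply: (@near_eq_is_derive _ _ _ (cst (H d))).
have : \forall z \near x, z \in `]c, d[ by apply: near_in_itvoo; rewrite in_itv.
by apply: filterS => z; rewrite in_itv/= => /andP[/ltW z1 /ltW z2]; rewrite Hcst ?z1.
Qed.

Section Support.
Variable C : R.
Hypothesis C0 : 0 <= C.
Definition csupp h := continuous h /\ forall x, C < `|x| -> h x = 0.

Lemma RintegralT_lin h g (a : R) : csupp h -> csupp g ->
  \int[mu]_x (a * h x + g x) = a * \int[mu]_x h x + \int[mu]_x g x.
Proof.
move=> [ch h0] [cg g0].
have [H dH _] := antiderivative_exists 0 ch.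
have [G dG _] := antiderivative_exists 0 cg.
rewrite (Rintegral_support C0 ch h0 dH) (Rintegral_support C0 cg g0 dG).
rewrite (@Rintegral_support _ (fun x => a * H x + G x) C)//; first by lra.
- move=> x; apply: cvgD; last exact: cg.
  by apply: cvgM; [exact: cvg_cst|exact: ch].
- by move=> x Cx; rewrite h0// g0// mulr0 addr0.
Qed.

Lemma RintegralT_le h M : csupp h -> (forall x, `|h x| <= M) ->
  `|\int[mu]_x h x| <= 2 * C * M.
Proof.
move=> [ch h0] hM; have [H dH _] := antiderivative_exists 0 ch.
rewrite (Rintegral_support C0 ch h0 dH).
have [|c _ ->] := @MVT_is_derive R H h (- C) C _ (fun x _ => dH x); first by rewrite ge0_cp.
have -> : C - - C = 2 * C by ring.
by rewrite normrM [`|2 * C|]ger0_norm ?mulr_ge0// mulrC ler_wpM2l ?mulr_ge0.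
Qed.

Lemma RintegralT_eq0 h : csupp h -> (forall x, 0 <= h x) ->
  \int[mu]_x h x = 0 -> forall x, h x = 0.
Proof.
move=> [ch h0] hge0; have [H dH _] := antiderivative_exists 0 ch.
rewrite (Rintegral_support C0 ch h0 dH) => /eqP; rewrite subr_eq0 => /eqP HC x.
have [/h0//|xC] := ltP C `|x|.
have hio y : - C < y < C -> h y = 0.
  by apply: (antiderivative_eq_ge0 hge0 dH); rewrite HC.
apply/eqP; rewrite eq_le hge0 andbT leNgt; apply/negP => hx0.
have : \forall y \near x, 0 < h y by exact: (cvgr_gt (h x) (ch x)).
move=> /nbhs_ballP[e /= e0 B].
(* The primitive controls [h] inside []-C, C[] and the support hypothesis outside [[-C, C]].
   Positivity at an end point would spread to a neighbour in one of these two regions. *)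
suff [y xye [yC|yC]] : exists2 y, `|x - y| < e & (- C < y < C) \/ C < `|y|.
- by have := B _ xye; rewrite hio// ltxx.
- by have := B _ xye; rewrite h0// ltxx.
have [xlt|xge] := ltP `|x| C.
  by exists x; [rewrite subrr normr0|left; rewrite -ltr_norml].
have [x0|x0] := leP 0 x.
  exists (x + e / 2); first by rewrite opprD addrA subrr add0r normrN gtr0_norm; lra.
  by right; rewrite ger0_norm; move: xge; rewrite ger0_norm//; lra.
exists (x - e / 2); first by rewrite opprB addrCA subrr addr0 gtr0_norm; lra.
by right; rewrite ltr0_norm; move: xge; rewrite ltr0_norm//; lra.
Qed.

Lemma RintegralT_scale h (c : R) : csupp h -> 0 < c ->
  \int[mu]_x h (c * x) = c^-1 * \int[mu]_x h x.
Proof.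
move=> [ch h0] c0; have [H dH _] := antiderivative_exists 0 ch.
rewrite (Rintegral_support C0 ch h0 dH).
transitivity (c^-1 * H (c * (c^-1 * C)) - c^-1 * H (c * - (c^-1 * C))); last first.
  rewrite -mulrBr; congr (_ * (H _ - H _)); first by rewrite mulVKf// gt_eqF.
  by rewrite mulrN mulVKf// gt_eqF.
apply: (@Rintegral_support (fun x => h (c * x)) (fun x => c^-1 * H (c * x))).
- by rewrite mulr_ge0// invr_ge0 ltW.
- by move=> x; apply: continuous_comp; [apply: cvgM; [exact: cvg_cst|exact: cvg_id]|exact: ch].
- by move=> x cx; apply: h0; rewrite normrM gtr0_norm// -ltr_pdivrMl.
- move=> x; have d1 : is_derive x 1 (fun y => c * y) c.
    by apply: is_derive_eq; rewrite [LHS]mulr1.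
  have := @is_derive1_comp _ H (fun y => c * y) x _ _ (dH _) d1 => d2.
  have -> : h (c * x) = c^-1 *: (h (c * x) * c).
    by rewrite /GRing.scale/= mulrCA mulVf ?mulr1// gt_eqF.
  by apply: is_deriveZ; exact: d2.
Qed.

End Support.

(** This is the integral of [h(|x|^2)] over [R^N]: with the first coordinate equal to [s], the
    remaining integral is of the same kind for a shifted profile. *)
Fixpoint radial_integral (N : nat) h : R :=
  if N is N'.+1 then \int[mu]_s radial_integral N' (fun q => h (s ^+ 2 + q))
  else h 0.

Lemma sum_sqr_row_mx N s (y : 'rV[R]_N) :
  \sum_(i < 1 + N) row_mx (const_mx s : 'rV_1) y ord0 i ^+ 2 =
  s ^+ 2 + \sum_i y ord0 i ^+ 2.
Proof.
rewrite big_split_ord big_ord1; congr (_ + _); first by rewrite row_mxEl mxE.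
by apply: eq_bigr => i _; rewrite row_mxEr.
Qed.

Lemma integral_space_radial N h :
  integral_space (fun x : 'rV[R]_N => h (\sum_i x ord0 i ^+ 2)) = radial_integral N h.
Proof.
elim: N h => [|N IH] h /=; first by rewrite big_ord0.
congr Rintegral; apply/funext => s; rewrite -IH; congr integral_space.
by apply/funext => y; congr h; exact: sum_sqr_row_mx.
Qed.

Lemma eq_radial_integral N h g : (forall q, 0 <= q -> h q = g q) ->
  radial_integral N h = radial_integral N g.
Proof.
elim: N h g => [|N IH] h g hg /=; first exact: hg.
congr Rintegral; apply/funext => s; apply: IH => q q0; apply: hg.
by rewrite addr_ge0// sqr_ge0.
Qed.

(** Only the right end is bounded, because profiles are integrated at arguments [|x|^2 >= 0]. *)
Definition csupp_right K h := continuous h /\ forall q, K < q -> h q = 0.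

Lemma csupp_right_lin K h g (a : R) : csupp_right K h -> csupp_right K g ->
  csupp_right K (fun q => a * h q + g q).
Proof.
move=> [ch h0] [cg g0]; split=> [q|q Kq]; last by rewrite h0// g0// mulr0 addr0.
by apply: cvgD; [apply: cvgM; [exact: cvg_cst|exact: ch]|exact: cg].
Qed.

Lemma csupp_right_slice K h s : csupp_right K h ->
  csupp_right K (fun q => h (s ^+ 2 + q)).
Proof.
move=> [ch h0]; split=> q.
  by apply: continuous_comp; [apply: cvgD; [exact: cvg_cst|exact: cvg_id]|exact: ch].
by move=> Kq; apply: h0; rewrite (lt_le_trans Kq)// lerDr sqr_ge0.
Qed.

(** [K + 1] stands in for [sqrt K] as a support radius of the slices. *)
Lemma sqr_gt_of_norm K s : 0 <= K -> K + 1 < `|s| -> K < s ^+ 2.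
Proof.
move=> K0 Ks; rewrite -real_normK ?num_real//.
have : `|s| ^+ 2 = `|s| * `|s| by [].
nra.
Qed.

Lemma radial_integral0 N : radial_integral N (fun=> 0) = 0.
Proof.
elim: N => [//|N IH] /=; under eq_fun do rewrite IH.
by rewrite /Rintegral integral0.
Qed.

(** Linearity and boundedness are carried together through the induction on the dimension: together
    they make the slice integral continuous in [s], which both of them require one dimension
    higher. *)
Definition linear_bounded_on K (I : (R -> R) -> R) (B : R) : Prop :=
  (forall h g (a : R), csupp_right K h -> csupp_right K g ->
     I (fun q => a * h q + g q) = a * I h + I g) /\
  (forall h M, csupp_right K h -> (forall q, 0 <= q <= K -> `|h q| <= M) -> 0 <= M ->
     `|I h| <= B * M).

Lemma linear_bounded_continuous K I (B : R) F t0 : 0 <= B -> linear_bounded_on K I B ->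
  (forall t, continuous (F^~ t)) -> (forall q t, K < q -> F q t = 0) ->
  (forall q, 0 <= q <= K -> {for (q, t0), continuous (fun p : R * R => F p.1 p.2)}) ->
  {for t0, continuous (fun t => I (F^~ t))}.
Proof.
move=> B0 [Il Ib] cF F0 jF; apply/cvgrPdist_le => e e0.
pose e' := e / (B + 1).
have e'0 : 0 < e' by rewrite divr_gt0// ltr_wpDl.
have sF t : csupp_right K (F^~ t) by split => // q; exact: F0.
have := @continuous_uniform_segment R F 0 K t0 e' jF e'0.
apply: filterS => t Ht; rewrite distrC.
have -> : I (F^~ t) - I (F^~ t0) = I (fun q => -1 * F q t0 + F q t).
  by rewrite Il// mulN1r addrC.
rewrite (@le_trans _ _ (B * e'))//.
  apply: Ib; [exact: csupp_right_lin| |exact: ltW].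
  by move=> q /Ht /ltW; rewrite mulN1r addrC.
by rewrite /e' mulrA ler_pdivrMr ?ltr_wpDl// mulrC ler_pM2l// lerDl.
Qed.

Lemma csupp_slice N K h (B : R) : 0 <= K -> 0 <= B ->
  linear_bounded_on K (radial_integral N) B -> csupp_right K h ->
  csupp (K + 1) (fun s => radial_integral N (fun q => h (s ^+ 2 + q))).
Proof.
move=> K0 B0 IN hK; have [ch h0] := hK; split; last first.
  move=> s /(sqr_gt_of_norm K0) Ks; rewrite -[RHS](radial_integral0 N).
  by apply: eq_radial_integral => q q0; rewrite h0// (lt_le_trans Ks)// lerDl.
move=> s; apply: (@linear_bounded_continuous K _ B (fun q s => h (s ^+ 2 + q))) => //.
- by move=> t; have [] := csupp_right_slice t hK.
- by move=> q t; have [_ H] := csupp_right_slice t hK; exact: H.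
- move=> q _; apply: (@continuous_comp _ _ _ (fun p : R * R => p.2 ^+ 2 + p.1) h); last exact: ch.
  apply: cvgD; last exact: cvg_fst.
  by apply: (@continuous_comp _ _ _ snd (fun x : R => x ^+ 2)); [exact: cvg_snd|exact: exprn_continuous].
Qed.

(** The constant is the volume of a cube of half-side [K + 1], which contains the support. *)
Lemma radial_integral_linear_bounded N K : 0 <= K ->
  linear_bounded_on K (radial_integral N) ((2 * (K + 1)) ^+ N).
Proof.
move=> K0; have K1 : 0 <= K + 1 by rewrite addr_ge0.
elim: N => [|N IH].
  by split=> //= h M _ + M0; rewrite expr0 mul1r; apply; rewrite lexx.
have D0 : 0 <= (2 * (K + 1)) ^+ N by rewrite exprn_ge0// mulr_ge0.
have slice h : csupp_right K h -> _ := csupp_slice K0 D0 IH.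
have [IHl IHb] := IH.
split.
  move=> h g a hK gK /=; rewrite -(@RintegralT_lin (K + 1))//; [|exact: slice..].
  by congr Rintegral; apply/funext => s; rewrite IHl//; exact: csupp_right_slice.
move=> h M hK hM M0 /=; rewrite exprS -mulrA; apply: RintegralT_le => //.
  exact: slice.
move=> s; apply: IHb => //; first exact: csupp_right_slice.
move=> q /andP[q0 qK]; have [sK|Ks] := leP (s ^+ 2 + q) K.
  by apply: hM; rewrite sK addr_ge0// sqr_ge0.
by have [_ ->] := hK; rewrite // normr0.
Qed.

Lemma radial_integral_lin N K h g (a : R) : 0 <= K ->
  csupp_right K h -> csupp_right K g ->
  radial_integral N (fun q => a * h q + g q) =
  a * radial_integral N h + radial_integral N g.
Proof. by move=> K0; have [+ _] := radial_integral_linear_bounded N K0; exact. Qed.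

Lemma radial_integral_bound N K h M : 0 <= K -> 0 <= M -> csupp_right K h ->
  (forall q, 0 <= q <= K -> `|h q| <= M) ->
  `|radial_integral N h| <= (2 * (K + 1)) ^+ N * M.
Proof. by move=> K0 M0 hK hM; have [_ /(_ h M)] := radial_integral_linear_bounded N K0; exact. Qed.

Lemma radial_integral_cont N K F t0 : 0 <= K ->
  (forall t, continuous (F^~ t)) -> (forall q t, K < q -> F q t = 0) ->
  (forall q, 0 <= q <= K -> {for (q, t0), continuous (fun p : R * R => F p.1 p.2)}) ->
  {for t0, continuous (fun t => radial_integral N (F^~ t))}.
Proof.
move=> K0; apply: linear_bounded_continuous (radial_integral_linear_bounded N K0).
by rewrite exprn_ge0// mulr_ge0// addr_ge0.
Qed.

Lemma csupp_slice_integral N K h : 0 <= K -> csupp_right K h ->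
  csupp (K + 1) (fun s => radial_integral N (fun q => h (s ^+ 2 + q))).
Proof.
move=> K0; apply: (csupp_slice K0 _ (radial_integral_linear_bounded N K0)).
by rewrite exprn_ge0// mulr_ge0// addr_ge0.
Qed.

Lemma radial_integral_ge0 N h : (forall q, 0 <= h q) -> 0 <= radial_integral N h.
Proof.
elim: N h => [|N IH] h h0 /=; first exact: h0.
by apply: Rintegral_ge0 => s _; exact: IH.
Qed.

(** A zero integral forces almost every slice, hence by continuity every slice, to have zero
    integral. Slicing at [s = sqrt q] moves the value at [q] to the origin of the slice, where
    [main] reads it; this first slicing needs [0 < N]. *)
Lemma radial_integral_eq0 N K h : (0 < N)%N -> 0 <= K -> csupp_right K h ->
  (forall q, 0 <= h q) -> radial_integral N h = 0 -> forall q, 0 <= q -> h q = 0.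
Proof.
move=> N0 K0 hK h0 I0.
have main n g : csupp_right K g -> (forall q, 0 <= g q) -> radial_integral n g = 0 ->
    g 0 = 0.
  elim: n g => [//|n IH] g gK g0 /= Ig.
  have K1 : 0 <= K + 1 by rewrite addr_ge0.
  have J s := RintegralT_eq0 K1 (csupp_slice_integral n K0 gK)
    (fun s => radial_integral_ge0 n (fun q => g0 (s ^+ 2 + q))) Ig s.
  have := IH _ (csupp_right_slice 0 gK) (fun q => g0 _) (J 0).
  by rewrite expr0n add0r.
case: N N0 I0 => // N _ /= I0 q q0.
have K1 : 0 <= K + 1 by rewrite addr_ge0.
have J s := RintegralT_eq0 K1 (csupp_slice_integral N K0 hK)
    (fun s => radial_integral_ge0 N (fun q => h0 (s ^+ 2 + q))) I0 s.
have := main _ _ (csupp_right_slice (Num.sqrt q) hK) (fun q => h0 _) (J (Num.sqrt q)).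
by rewrite sqr_sqrtr// addr0.
Qed.

Lemma radial_integral_scale N K h (c : R) : 0 <= K -> csupp_right K h -> 0 < c ->
  radial_integral N (fun q => h (c ^+ 2 * q)) = c ^- N * radial_integral N h.
Proof.
move=> + + c0; elim: N h => [|N IH] h K0 hK /=; first by rewrite mulr0 expr0 invr1 mul1r.
transitivity (\int[mu]_s (c ^- N * radial_integral N (fun q => h ((c * s) ^+ 2 + q)))).
  congr Rintegral; apply/funext => s; rewrite -IH//; last exact: csupp_right_slice.
  by congr radial_integral; apply/funext => q; rewrite mulrDr exprMn.
have K1 : 0 <= K + 1 by rewrite addr_ge0.
have sl := csupp_slice_integral N K0 hK.
rewrite (@RintegralT_scale _ K1 (fun s => c ^- N * radial_integral N (fun q => h (s ^+ 2 + q))))//.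
  transitivity (c^-1 * \int[mu]_s (c ^- N * radial_integral N (fun q => h (s ^+ 2 + q)) + 0)).
    by congr (_ * Rintegral _ _ _); apply/funext => s; rewrite addr0.
  rewrite (@RintegralT_lin _ K1)//; last by split => // x; exact: cvg_cst.
  by rewrite [X in _ * (_ + X)]/Rintegral integral0 addr0 mulrA exprS invfM.
have [c1 c2] := sl; split => x; first by apply: cvgM; [exact: cvg_cst|exact: c1].
by move=> /c2 ->; rewrite mulr0.
Qed.

(** Differentiation under the integral: the mean value theorem turns the difference quotient into a
    value of [F1], and uniform continuity of [F1] on [[0, K]] plays the part of dominated
    convergence. *)
Lemma is_derive_radial_integral N K (F F1 : R -> R -> R) (c d t0 : R) :
  0 <= K -> c < t0 < d ->
  (forall t, c < t < d -> continuous (F^~ t)) ->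
  (forall q t, c < t < d -> K < q -> F q t = 0) ->
  (forall q t, c < t < d -> 0 <= q -> is_derive t 1 (F q) (F1 q t)) ->
  csupp_right K (F1^~ t0) ->
  (forall q, 0 <= q <= K -> {for (q, t0), continuous (fun p : R * R => F1 p.1 p.2)}) ->
  is_derive t0 1 (fun t => radial_integral N (F^~ t)) (radial_integral N (F1^~ t0)).
Proof.
move=> K0 tcd cF F0 dF sF1 cF1; apply: is_derive_intro => e e0.
have K1 : 0 <= K + 1 by rewrite addr_ge0.
have D0 : 0 <= (2 * (K + 1)) ^+ N by rewrite exprn_ge0// mulr_ge0.
pose e' := e / ((2 * (K + 1)) ^+ N + 1).
have e'0 : 0 < e' by rewrite divr_gt0// ltr_wpDl.
have := @continuous_uniform_segment R F1 0 K t0 e' cF1 e'0.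
move=> /nbhs_ballP[r /= r0 B].
have : \forall z \near t0, z \in `]c, d[ by apply: near_in_itvoo; rewrite in_itv.
move=> /nbhs_ballP[r' /= r'0 B'].
apply/nbhs_ballP; exists (Num.min r r'); rewrite /= ?lt_min ?r0// => t.
rewrite /ball/= lt_min => /andP[tr tr'].
have tcd' : c < t < d by have := B' _ tr'; rewrite in_itv.
have sF s : c < s < d -> csupp_right K (F^~ s).
  by move=> scd; split; [exact: cF|move=> q; exact: F0].
have -> : radial_integral N (F^~ t) - radial_integral N (F^~ t0) -
    radial_integral N (F1^~ t0) * (t - t0) =
    radial_integral N (fun q => (t0 - t) * F1 q t0 + (-1 * F q t0 + F q t)).
  rewrite (radial_integral_lin _ _ K0)//; last by apply: csupp_right_lin; exact: sF.
  rewrite (radial_integral_lin _ _ K0)//; [|exact: sF..].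
  by ring.
rewrite (@le_trans _ _ ((2 * (K + 1)) ^+ N * (e' * `|t - t0|)))//.
  apply: radial_integral_bound => //; first by rewrite mulr_ge0// ltW.
    by do 2 (apply: csupp_right_lin => //); exact: sF.
  move=> q qK; have q0 : 0 <= q by case/andP: qK.
  have mvt u v : c < u < d -> c < v < d -> u <= v ->
      exists2 s, u <= s <= v & F q v - F q u = F1 q s * (v - u).
    by move=> ucd vcd uv; apply: MVT_is_derive => // x xuv; apply: dF => //; lra.
  have [s st st'] : exists2 s, `|t0 - s| < r & F q t - F q t0 = F1 q s * (t - t0).
    have [tt|tt] := leP t0 t.
      have [s sI E] := mvt _ _ tcd tcd' tt; exists s => //.
      rewrite (le_lt_trans _ tr)// distrC [`|t0 - t|]distrC !ger0_norm ?subr_ge0//; lra.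
    have [s sI E] := mvt _ _ tcd' tcd (ltW tt); exists s => //.
      rewrite (le_lt_trans _ tr)// !ger0_norm ?subr_ge0; lra.
    by rewrite -opprB E -mulrN opprB.
  have -> : (t0 - t) * F1 q t0 + (-1 * F q t0 + F q t) = (F1 q s - F1 q t0) * (t - t0).
    by rewrite mulN1r [- _ + _]addrC st'; ring.
  rewrite normrM ler_wpM2r//; apply/ltW; exact: (B s).
by rewrite mulrA ler_wpM2r// /e' mulrA ler_pdivrMr ?ltr_wpDl// mulrC ler_pM2l// lerDl.
Qed.

(** The integrand is the divergence of [x J(|x|^2)]. Its integral vanishes on differentiating at
    [t = 1] the dilation identity that equates the integral of [J(t^2 |x|^2)] with [t^(-N)] times
    that of [J(|x|^2)]. *)
Lemma radial_divergence N K (J J1 : R -> R) : 0 <= K -> csupp_right K J ->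
  csupp_right K J1 -> (forall q, is_derive q 1 J (J1 q)) ->
  radial_integral N (fun q => 2 * q * J1 q + N%:R * J q) = 0.
Proof.
move=> K0 sJ sJ1 dJ.
(* Dilations with [t > 1/2] enlarge the support in [q] by a factor of at most [4]. *)
have K40 : 0 <= 4 * K by rewrite mulr_ge0.
have d1 : is_derive (1 : R) 1 (fun t => radial_integral N (fun q => J (t ^+ 2 * q)))
    (radial_integral N (fun q => 2 * 1 * q * J1 (1 ^+ 2 * q))).
  have [cJ J0] := sJ; have [cJ1 J10] := sJ1.
  apply: (@is_derive_radial_integral N (4 * K) (fun q t => J (t ^+ 2 * q))
    (fun q t => 2 * t * q * J1 (t ^+ 2 * q)) 2^-1 2) => //; [lra| | | | |].
  - move=> t tI q; apply: continuous_comp; last exact: cJ.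
    by apply: cvgM; [exact: cvg_cst|exact: cvg_id].
  - move=> q t tI Kq; apply: J0; have : 4^-1 < t ^+ 2 by nra.
    have : 0 < q by rewrite (le_lt_trans K40).
    nra.
  - move=> q t tI q0; rewrite mulrC; apply: (@has_derivative_comp _ _ _ _ _ J); last exact: dJ.
    by derive_rules; rewrite /=; ring.
  - split => q; last by move=> Kq; rewrite expr1n mul1r J10 ?mulr0//; nra.
    rewrite expr1n; apply: cvgM; first by apply: cvgM; [exact: cvg_cst|exact: cvg_id].
    by apply: continuous_comp; last exact: cJ1; apply: cvgM; [exact: cvg_cst|exact: cvg_id].
  - move=> q _; apply: cvgM.
      apply: cvgM; last exact: cvg_fst.
      by apply: cvgM; [exact: cvg_cst|exact: cvg_snd].
    apply: (@continuous_comp _ _ _ (fun p : R * R => p.2 ^+ 2 * p.1) J1); last exact: cJ1.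
    apply: cvgM; last exact: cvg_fst.
    by apply: (@continuous_comp _ _ _ snd (fun x : R => x ^+ 2)); [exact: cvg_snd|exact: exprn_continuous].
have d2 : is_derive (1 : R) 1 (fun t => radial_integral N (fun q => J (t ^+ 2 * q)))
    (- N%:R * radial_integral N J).
  apply: (@near_eq_is_derive _ _ _ (fun t => t ^- N * radial_integral N J)).
    have : \forall z \near (1 : R), 0 < z by exact: lt_nbhsr.
    by apply: filterS => z z0; rewrite (radial_integral_scale _ K0).
  by derive_rules; rewrite ?expr1n ?oner_eq0//; field.
have E : radial_integral N (fun q => 2 * 1 * q * J1 (1 ^+ 2 * q)) = - N%:R * radial_integral N J.
  by case: d1 => _ <-; case: d2 => _ <-.
transitivity (radial_integral N (fun q => N%:R * J q + 2 * 1 * q * J1 (1 ^+ 2 * q))).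
  by congr radial_integral; apply/funext => q; rewrite expr1n mul1r; ring.
rewrite (radial_integral_lin _ _ K0)//; first by rewrite E; ring.
have [c1 c0] := sJ1; split=> q; last by move=> Kq; rewrite expr1n mul1r c0 ?mulr0.
apply: cvgM; first by apply: cvgM; [exact: cvg_cst|exact: cvg_id].
by apply: continuous_comp; last exact: c1; apply: cvgM; [exact: cvg_cst|exact: cvg_id].
Qed.

End RadialIntegral.

(** * A du Bois-Reymond lemma for the time variable *)

Section DuBoisReymond.
Context {R : realType}.
Implicit Types (h g H W : R -> R) (x y t q s c d : R).
Notation mu := (@lebesgue_measure R).

(** A merely continuous weight is enough: test functions are primitives built from it, once
    integrated in time and twice in space, which gives exactly the [C^{2,1}] regularity demanded of
    them. *)
Definition bump (c d t : R) : R := Num.max 0 ((t - c) * (d - t)).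

Lemma bump_ge0 c d t : 0 <= bump c d t.
Proof. by rewrite /bump le_max lexx. Qed.

Lemma bump_gt0 c d t : c < t < d -> 0 < bump c d t.
Proof. by move=> /andP[ct td]; rewrite /bump lt_max mulr_gt0 ?subr_gt0// orbT. Qed.

Lemma bump_eq0 c d t : c <= d -> ~~ (c < t < d) -> bump c d t = 0.
Proof.
move=> cd; rewrite negb_and -!leNgt => tI; apply/max_idPl.
case/orP: tI => tI; nra.
Qed.

Lemma bump_continuous c d : continuous (bump c d).
Proof.
move=> t; apply: (@continuous_max _ _ (fun=> 0) (fun t => (t - c) * (d - t))).
  exact: cvg_cst.
by apply: cvgM; apply: cvgB; (exact: cvg_cst || exact: cvg_id).
Qed.

Lemma primitive_bump_gt0 c d (k : R -> R) H : c < d -> (forall t, 0 <= k t) ->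
  (forall t, c < t < d -> 0 < k t) ->
  (forall t, is_derive t 1 H (bump c d t * k t)) -> H c < H d.
Proof.
move=> cd k0 k1 dH; rewrite lt_neqAle (@is_derive_ge0_le _ H (fun t => bump c d t * k t)) ?(ltW cd)//.
  rewrite andbT; apply/eqP => HE.
  have mI : c < (c + d) / 2 < d by lra.
  have := antiderivative_eq_ge0 (fun x => mulr_ge0 (bump_ge0 c d x) (k0 x)) dH HE mI.
  by apply/eqP; rewrite gt_eqF// mulr_gt0 ?k1 ?bump_gt0.
by move=> x _; rewrite mulr_ge0// bump_ge0.
Qed.

Lemma is_derive_vanish_outside H h c d : c <= d -> (forall t, is_derive t 1 H (h t)) ->
  (forall t, ~~ (c < t < d) -> h t = 0) -> H c = 0 -> H d = 0 ->
  forall t, ~~ (c < t < d) -> H t = 0.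
Proof.
move=> cd dH h0 Hc Hd t; rewrite negb_and -!leNgt => /orP[tc|td].
  rewrite -Hc; apply: is_derive0_eq => // x xI; rewrite -(h0 x)//.
  by rewrite negb_and -!leNgt; case/andP: xI => _ ->.
rewrite -Hd; apply/esym; apply: is_derive0_eq => // x xI; rewrite -(h0 x)//.
by rewrite negb_and -!leNgt; case/andP: xI => -> _; rewrite orbT.
Qed.

(* The test function with derivative [bump * (W - mean of W)] shows that [W]
   equals its weighted mean. *)
Lemma du_bois_reymond W c d : c < d -> continuous W ->
  (forall chi chi1 : R -> R, (forall t, is_derive (t : R) 1 chi (chi1 t)) -> continuous chi1 ->
     (forall t, ~~ (c < t < d) -> chi t = 0) ->
     (forall t, ~~ (c < t < d) -> chi1 t = 0) ->
     \int[mu]_(t in `[c, d]) (chi1 t * W t) = 0) ->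
  forall s t, c < s < d -> c < t < d -> W s = W t.
Proof.
move=> cd cW hW.
have cb := @bump_continuous c d.
have [Om dO O0] := antiderivative_exists c cb.
have cbW : continuous (fun t => bump c d t * W t).
  by move=> t; apply: cvgM; [exact: cb|exact: cW].
have [B dB B0] := antiderivative_exists c cbW.
have Od : 0 < Om d.
  rewrite -O0; apply: (@primitive_bump_gt0 c d (fun=> 1)) => // t.
  by rewrite mulr1.
pose k := B d / Om d.
pose chi t := B t - k * Om t; pose chi1 t := bump c d t * (W t - k).
have dchi t : is_derive t 1 chi (chi1 t).
  have := dO t; have := dB t => b1 o1; rewrite /chi; derive_rules.
  by rewrite /chi1; ring.
have cchi1 : continuous chi1.
  by move=> t; apply: cvgM; [exact: cb|apply: cvgB; [exact: cW|exact: cvg_cst]].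
have chi10 t : ~~ (c < t < d) -> chi1 t = 0.
  by move=> tI; rewrite /chi1 bump_eq0 ?mul0r// ltW.
have chi0 t : ~~ (c < t < d) -> chi t = 0.
  apply: (is_derive_vanish_outside (ltW cd) dchi chi10).
    by rewrite /chi B0 O0 mulr0 subr0.
  by rewrite /chi /k divfK ?subrr// gt_eqF.
have := hW _ _ dchi cchi1 chi0 chi10.
have cE : continuous (fun t => bump c d t * (W t - k) ^+ 2).
  move=> t; apply: cvgM; first exact: cb.
  apply: (@continuous_comp _ _ _ (fun t => W t - k) (fun x => x ^+ 2)); last exact: exprn_continuous.
  by apply: cvgB; [exact: cW|exact: cvg_cst].
have [E dE E0] := antiderivative_exists c cE.
(* [chi1 * W] splits as [bump * (W - k)^2 + k * chi1]; the second part integrates to zero because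
   [chi] vanishes at both ends. *)
have -> : \int[mu]_(t in `[c, d]) (chi1 t * W t) = E d + k * chi d - (E c + k * chi c).
  apply: (@FTC_Rintegral _ (fun t => chi1 t * W t) (fun t => E t + k * chi t)).
  - exact: ltW.
  - by move=> t; apply: cvgM; [exact: cchi1|exact: cW].
  - move=> t; have e1 := dE t; have c1 := dchi t; derive_rules.
    by rewrite /chi1; ring.
rewrite !chi0 ?ltxx ?andbF// !mulr0 !addr0 => /eqP; rewrite subr_eq0 => /eqP Ecd.
have Wk s : c < s < d -> W s = k.
  move=> sI; have := antiderivative_eq_ge0 _ dE (esym Ecd) sI.
  have /[swap]/[apply] : forall x, 0 <= bump c d x * (W x - k) ^+ 2.
    by move=> x; rewrite mulr_ge0 ?bump_ge0 ?sqr_ge0.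
  move/eqP; rewrite mulf_eq0 gt_eqF ?bump_gt0//= sqrf_eq0 subr_eq0.
  by move/eqP.
by move=> s t /Wk -> /Wk ->.
Qed.

End DuBoisReymond.

(** * Test functions of the form [zeta(|x|^2) chi(t)] *)

Section TestFunctions.
Context {R : realType}.
Variable N : nat.
Implicit Types (x v : 'rV[R]_N) (i j : 'I_N).

Definition sqnorm x : R := \sum_i x ord0 i ^+ 2.

Lemma sqnorm_ge0 x : 0 <= sqnorm x.
Proof. by apply: sumr_ge0 => i _; rewrite sqr_ge0. Qed.

Lemma enormE x : enorm x = Num.sqrt (sqnorm x).
Proof. by []. Qed.

(** Partial derivatives become one-variable derivatives at [0], within reach of the differentiation
    rules; along a coordinate line [sqnorm] is a quadratic polynomial. *)
Lemma is_derive_line (g : 'rV[R]_N -> R) x v (d : R) :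
  is_derive (0 : R) 1 (fun h => g (h *: v + x)) d -> is_derive x v g d.
Proof.
move=> [h1 h2]; split; first exact/derivable1P.
rewrite -h2 /derive.
have -> // : (fun h => h^-1 *: ((g \o shift x) (h *: v) - g x)) =
  (fun h => h^-1 *: (((fun h => g (h *: v + x)) \o shift 0) (h *: 1) - g (0 *: v + x))).
by apply/funext => h /=; rewrite addr0 scale0r add0r [_%:A]mulr1.
Qed.

Lemma line_coord x i j (h : R) : (h *: delta_mx ord0 i + x) ord0 j = h * (i == j)%:R + x ord0 j.
Proof. by rewrite !mxE eqxx /= eq_sym. Qed.

Lemma sqnorm_line x i (h : R) :
  sqnorm (h *: delta_mx ord0 i + x) = sqnorm x + 2 * h * x ord0 i + h ^+ 2.
Proof.
rewrite /sqnorm (bigD1 i)//= [in RHS](bigD1 i)//= line_coord eqxx mulr1.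
rewrite (eq_bigr (fun k => x ord0 k ^+ 2)); first by ring.
by move=> k ki; rewrite line_coord eq_sym (negbTE ki) mulr0 add0r.
Qed.

Lemma sqnorm_continuous : continuous sqnorm.
Proof.
apply: (@continuous_big R 'I_N +%R 0 xpredT _ _ _ (fun i x => x ord0 i ^+ 2)).
  exact: add_continuous.
move=> i _ x.
apply: (@continuous_comp _ _ _ (fun x : 'rV[R]_N => x ord0 i) (fun x : R => x ^+ 2)).
  exact: coord_continuous.
exact: exprn_continuous.
Qed.

Variables (zeta zeta1 zeta2 : R -> R).
Hypothesis dz : forall q, is_derive (q : R) 1 zeta (zeta1 q).
Hypothesis dz1 : forall q, is_derive (q : R) 1 zeta1 (zeta2 q).
Hypothesis cz2 : continuous zeta2.

Lemma partial_radial (a : R) i x :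
  is_derive x (delta_mx ord0 i) (fun x => zeta (sqnorm x) * a)
    (2 * x ord0 i * zeta1 (sqnorm x) * a).
Proof.
apply: is_derive_line; under eq_fun do rewrite sqnorm_line.
have h1 : has_derivative (fun h : R => zeta (sqnorm x + 2 * h * x ord0 i + h ^+ 2)) 0
    (zeta1 (sqnorm x) * (2 * x ord0 i)).
  apply: (@has_derivative_comp _ (fun h => sqnorm x + 2 * h * x ord0 i + h ^+ 2) _ _ _ zeta).
    by derive_rules; rewrite /=; ring.
  by rewrite mulr0 mul0r addr0 expr0n addr0; exact: dz.
by derive_rules; ring.
Qed.

Lemma partial2_radial (a : R) i j x :
  is_derive x (delta_mx ord0 j) (fun x => 2 * x ord0 i * zeta1 (sqnorm x) * a)
    ((2 * (i == j)%:R * zeta1 (sqnorm x) + 4 * x ord0 i * x ord0 j * zeta2 (sqnorm x)) * a).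
Proof.
apply: is_derive_line; under eq_fun do rewrite sqnorm_line line_coord.
have h1 : has_derivative (fun h : R => zeta1 (sqnorm x + 2 * h * x ord0 j + h ^+ 2)) 0
    (zeta2 (sqnorm x) * (2 * x ord0 j)).
  apply: (@has_derivative_comp _ (fun h => sqnorm x + 2 * h * x ord0 j + h ^+ 2) _ _ _ zeta1).
    by derive_rules; rewrite /=; ring.
  by rewrite mulr0 mul0r addr0 expr0n addr0; exact: dz1.
derive_rules.
by rewrite !mulr0 mul0r expr0n !addr0 eq_sym; ring.
Qed.

Lemma laplacian_radial (a : R) x : laplacian (fun x => zeta (sqnorm x) * a) x =
  (4 * sqnorm x * zeta2 (sqnorm x) + 2 * N%:R * zeta1 (sqnorm x)) * a.
Proof.
rewrite /laplacian.
have p1 i : partial i (fun x => zeta (sqnorm x) * a) = (fun x => 2 * x ord0 i * zeta1 (sqnorm x) * a).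
  by apply/funext => y; case: (partial_radial a i y).
under eq_bigr => i _.
  rewrite p1 /partial; have [_ ->] := partial2_radial a i i x.
  rewrite eqxx mulr1 -[4 * x ord0 i * x ord0 i]mulrA -expr2.
over.
rewrite -mulr_suml; congr (_ * _); rewrite big_split/= sumr_const card_ord addrC.
congr (_ + _); last by rewrite -mulr_natl; ring.
by rewrite -mulr_suml -mulr_sumr.
Qed.

Variables (chi chi1 : R -> R) (K : R).
Hypothesis dchi : forall t, is_derive (t : R) 1 chi (chi1 t).
Hypothesis cchi1 : continuous chi1.
Hypothesis zeta0 : forall q, K < q -> zeta q = 0.
Hypothesis chi0 : forall t, K < `|t| -> chi t = 0.

Lemma derive1_test x t : derive1 (fun t => zeta (sqnorm x) * chi t) t =
  zeta (sqnorm x) * chi1 t.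
Proof.
rewrite derive1E; suff [_ ->] : is_derive t 1 (fun t => zeta (sqnorm x) * chi t) (zeta (sqnorm x) * chi1 t) by [].
have c1 := dchi t; by derive_rules; ring.
Qed.

Lemma test_function_radial : test_function (fun x t => zeta (sqnorm x) * chi t).
Proof.
have csq : continuous (fun p : 'rV[R]_N * R => sqnorm p.1).
  by move=> p; apply: continuous_comp; [exact: cvg_fst|exact: sqnorm_continuous].
have comp1 (k : R -> R) : continuous k -> continuous (fun p : 'rV[R]_N * R => k (sqnorm p.1)).
  by move=> ck p; apply: (@continuous_comp _ _ _ (fun p : 'rV[R]_N * R => sqnorm p.1) k); [exact: csq|exact: ck].
have comp2 (k : R -> R) : continuous k -> continuous (fun p : 'rV[R]_N * R => k p.2).
  by move=> ck p; apply: (@continuous_comp _ _ _ (snd : 'rV[R]_N * R -> R) k); [exact: cvg_snd|exact: ck].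
have ccoord i : continuous (fun p : 'rV[R]_N * R => p.1 ord0 i).
  by move=> p; apply: (@continuous_comp _ _ _ (fst : 'rV[R]_N * R -> _) (fun x : 'rV[R]_N => x ord0 i)); [exact: cvg_fst|exact: coord_continuous].
have cz : continuous zeta by move=> q; exact: is_derive_continuous (dz q).
have cz1 : continuous zeta1 by move=> q; exact: is_derive_continuous (dz1 q).
have cchi : continuous chi by move=> q; exact: is_derive_continuous (dchi q).
have p1 t i : partial i (fun x => zeta (sqnorm x) * chi t) = (fun x => 2 * x ord0 i * zeta1 (sqnorm x) * chi t).
  by apply/funext => y; case: (partial_radial (chi t) i y).
split.
- by move=> p; apply: cvgM; [exact: comp1|exact: comp2].
- split => [x t|]; first by have c1 := dchi t; have [] : is_derive t 1 (fun t => zeta (sqnorm x) * chi t) (zeta (sqnorm x) * chi1 t) by derive_rules; ring.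
  under eq_fun do rewrite derive1_test.
  by move=> p; apply: cvgM; [exact: comp1|exact: comp2].
- move=> i; split => [x t|]; first by case: (partial_radial (chi t) i x).
  under eq_fun do rewrite p1.
  move=> p; apply: cvgM; last exact: comp2.
  by apply: cvgM; [apply: cvgM; [exact: cvg_cst|exact: ccoord]|exact: comp1].
- move=> i j; split => [x t|]; first by rewrite p1; case: (partial2_radial (chi t) i j x).
  under eq_fun => p.
    rewrite p1 /partial; have [_ ->] := partial2_radial (chi p.2) i j p.1; over.
  move=> p; apply: cvgM; last exact: comp2.
  apply: cvgD; first by apply: cvgM; [exact: cvg_cst|exact: comp1].
  apply: cvgM; last exact: comp1.
  by apply: cvgM; [apply: cvgM; [exact: cvg_cst|exact: ccoord]|exact: ccoord].
(* The [1] turns [enorm x > K] into [sqnorm x > K], since above [1] the square dominates the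
   norm. *)
- exists (Num.max 1 K) => x t [xK|tK]; last by rewrite chi0 ?mulr0//; move: tK; rewrite gt_max => /andP[].
  rewrite zeta0 ?mul0r//; move: xK; rewrite gt_max => /andP[x1 xK].
  have : enorm x ^+ 2 = sqnorm x by rewrite enormE sqr_sqrtr// sqnorm_ge0.
  have : enorm x ^+ 2 = enorm x * enorm x by [].
  by move=> -> <-; nra.
Qed.

End TestFunctions.

(** * Green identity and Weyl lemma for the operator [L p = 4 q p'' + 2 N p'] *)

Section RadialWeyl.
Context {R : realType}.
Implicit Types (h H : R -> R) (a b c q : R).

(** Real powers of [q] are singular at [0], so formulas are available only for [q > c]. The
    functions involved vanish up to [a > c], and the overlap []c, a]] extends the formulas to the
    whole line. *)
Lemma is_derive_glue h h1 c a : c < a ->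
  (forall q, q <= a -> h q = 0) -> (forall q, q <= a -> h1 q = 0) ->
  (forall q, c < q -> is_derive q 1 h (h1 q)) -> forall q, is_derive q 1 h (h1 q).
Proof.
move=> ca h0 h10 dh q; have [/dh//|qc] := ltP c q.
rewrite h10; last by rewrite (le_trans qc)// ltW.
apply: (@near_eq_is_derive _ _ _ (cst 0)).
have : \forall z \near q, z < a by apply: lt_nbhsl; exact: le_lt_trans ca.
by apply: filterS => z za; rewrite h0// ltW.
Qed.

Lemma continuous_glue h c a : c < a -> (forall q, q <= a -> h q = 0) ->
  (forall q, c < q -> {for q, continuous h}) -> continuous h.
Proof.
move=> ca h0 ch q; have [/ch//|qc] := ltP c q.
have e : \forall z \near q, cst 0 z = h z.
  have : \forall z \near q, z < a by apply: lt_nbhsl; exact: le_lt_trans ca.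
  by apply: filterS => z za; rewrite h0// ltW.
rewrite /continuous_at h0; last by rewrite (le_trans qc)// ltW.
by apply: cvg_trans (near_eq_cvg e) _; exact: cvg_cst.
Qed.

Lemma antiderivative_exists_right h c : (forall q, c <= q -> {for q, continuous h}) ->
  exists H, forall q, c < q -> is_derive q 1 H (h q).
Proof.
move=> ch; have cm : continuous (fun q => h (Num.max c q)).
  move=> q; apply: (@continuous_comp _ _ _ (fun q => Num.max c q) h).
    by apply: (@continuous_max _ _ (fun=> c) (fun q => q)); [exact: cvg_cst|exact: cvg_id].
  by apply: ch; rewrite le_max lexx.
have [H dH _] := antiderivative_exists 0 cm.
by exists H => q cq; have := dH q; rewrite max_r// ltW.
Qed.

(** With [J = 2 (p0 zeta' - zeta p0')], the difference [p0 L zeta - zeta L p0] is [2 q J' + N J], a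
    divergence. *)
Lemma radial_Green N (p0 p1 p2 zeta zeta1 zeta2 : R -> R) a b c : 0 <= b -> c < a ->
  (forall q, c < q -> is_derive q 1 p0 (p1 q)) ->
  (forall q, c < q -> is_derive q 1 p1 (p2 q)) ->
  (forall q, c < q -> {for q, continuous p2}) ->
  (forall q, is_derive q 1 zeta (zeta1 q)) ->
  (forall q, is_derive q 1 zeta1 (zeta2 q)) ->
  continuous zeta2 ->
  (forall q, ~~ (a < q < b) -> [/\ zeta q = 0, zeta1 q = 0 & zeta2 q = 0]) ->
  radial_integral N (fun q => p0 q * (4 * q * zeta2 q + 2 * N%:R * zeta1 q)) =
  radial_integral N (fun q => zeta q * (4 * q * p2 q + 2 * N%:R * p1 q)).
Proof.
move=> b0 ca dp0 dp1 cp2 dz dz1 cz2 z0.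
have la q : q <= a -> ~~ (a < q < b) by rewrite negb_and -leNgt => ->.
have gb q : b < q -> ~~ (a < q < b) by move=> /ltW; rewrite negb_and -!leNgt => ->; rewrite orbT.
have cz q : {for q, continuous zeta} := is_derive_continuous (dz q).
have cz1 q : {for q, continuous zeta1} := is_derive_continuous (dz1 q).
pose J q := 2 * (p0 q * zeta1 q - zeta q * p1 q).
pose J1 q := 2 * (p0 q * zeta2 q - zeta q * p2 q).
have J0 q : ~~ (a < q < b) -> J q = 0.
  by move=> /z0[h1 h2 h3]; rewrite /J h1 h2 mulr0 mul0r subrr mulr0.
have J10 q : ~~ (a < q < b) -> J1 q = 0.
  by move=> /z0[h1 h2 h3]; rewrite /J1 h1 h3 mulr0 mul0r subrr mulr0.
have dJ q : is_derive q 1 J (J1 q).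
  move: q; apply: (is_derive_glue ca) => [q /la/J0//|q /la/J10//|q cq].
  have := dp0 q cq; have := dp1 q cq; have := dz q; have := dz1 q => d1 d2 d3 d4.
  rewrite /J; derive_rules; rewrite /J1; ring.
have cp0 q : c < q -> {for q, continuous p0} by move=> /dp0 /is_derive_continuous.
have cp1 q : c < q -> {for q, continuous p1} by move=> /dp1 /is_derive_continuous.
have cJ1 : continuous J1.
  apply: (continuous_glue ca) => [q /la/J10//|q cq].
  apply: cvgM; first exact: cvg_cst.
  apply: cvgB; first by apply: cvgM; [exact: cp0|exact: cz2].
  by apply: cvgM; [exact: cz|exact: cp2].
have /= := @radial_divergence R N b J J1 b0.
move=> /(_ _ _ dJ) E.
have {}E : radial_integral N (fun q => 2 * q * J1 q + N%:R * J q) = 0.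
  apply: E; split; [|by move=> q /gb/J0|exact: cJ1|by move=> q /gb/J10].
  by move=> q; exact: is_derive_continuous (dJ q).
have E2 : radial_integral N (fun q => 1 * (2 * q * J1 q + N%:R * J q) +
    zeta q * (4 * q * p2 q + 2 * N%:R * p1 q)) =
    1 * radial_integral N (fun q => 2 * q * J1 q + N%:R * J q) +
    radial_integral N (fun q => zeta q * (4 * q * p2 q + 2 * N%:R * p1 q)).
  apply: (@radial_integral_lin _ _ b) => //.
    split=> q; last by move=> /gb bq; rewrite J0// J10// !mulr0 addr0.
    apply: cvgD; apply: cvgM; rewrite ?[X in X @ _]/=.
    - by apply: cvgM; [exact: cvg_cst|exact: cvg_id].
    - exact: cJ1.
    - exact: cvg_cst.
    - exact: is_derive_continuous (dJ q).
  split.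
    apply: (continuous_glue ca) => [q /la/z0[-> _ _]|q cq]; first by rewrite mul0r.
    apply: cvgM; first exact: cz.
    apply: cvgD; apply: cvgM.
    - by apply: cvgM; [exact: cvg_cst|exact: cvg_id].
    - exact: cp2.
    - exact: cvg_cst.
    - exact: cp1.
  by move=> q /gb/z0[-> _ _]; rewrite mul0r.
rewrite E mulr0 add0r in E2; rewrite -E2; congr radial_integral; apply/funext => q.
by rewrite /J /J1; ring.
Qed.

Lemma powR_continuous_pos (r : R) q : 0 < q -> {for q, continuous (fun q => q `^ r)}.
Proof. by move=> q0; apply: is_derive_continuous; exact: is_derive1_powR. Qed.

Lemma powR_mulE q (r1 r2 r3 : R) : 0 < q -> r1 + r2 = r3 -> q `^ r1 * q `^ r2 = q `^ r3.
Proof. by move=> q0 <-; rewrite powRD// (gt_eqF q0) implybT. Qed.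

(** For [s = N/2] one has [L p = 4 q^(1-s) (q^s p')'], so two integrations solve the equation: [G]
    is [q^s p']. The first is done on the larger half-line [q > c/2] to have [G] continuous up to
    [c]. *)
Lemma radial_poisson_exists N (g : R -> R) c : 0 < c -> continuous g ->
  exists p0 p1 p2 : R -> R, forall q, c < q ->
    [/\ is_derive q 1 p0 (p1 q), is_derive q 1 p1 (p2 q), {for q, continuous p2} &
        4 * q * p2 q + 2 * N%:R * p1 q = g q].
Proof.
move=> c0 cg; pose s : R := N%:R / 2.
have c20 : 0 < c / 2 by rewrite divr_gt0.
have [G dG] : exists G, forall q, c / 2 < q -> is_derive q 1 G (q `^ (s - 1) * g q / 4).
  apply: antiderivative_exists_right => q cq; apply: cvgM; last exact: cvg_cst.
  by apply: cvgM; [apply: powR_continuous_pos; lra|exact: cg].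
have [p0 dp0] : exists H, forall q, c < q -> is_derive q 1 H (q `^ (- s) * G q).
  apply: antiderivative_exists_right => q cq; apply: cvgM.
    by apply: powR_continuous_pos; lra.
  by apply: is_derive_continuous; apply: dG; lra.
exists p0, (fun q => q `^ (- s) * G q), (fun q => - s * q `^ (- s - 1) * G q + g q / (4 * q)).
move=> q cq; have q0 : 0 < q by lra.
have dGq : is_derive q 1 G (q `^ (s - 1) * g q / 4) by apply: dG; lra.
split; first exact: dp0.
- derive_rules => //; rewrite mulr1; congr (_ + _).
  rewrite !mulrA (@powR_mulE q _ _ (- 1)) //; last by ring.
  by rewrite powR_inv1 ?ltW//; field; lra.
- apply: cvgD; apply: cvgM.
  + by apply: cvgM; [exact: cvg_cst|exact: powR_continuous_pos].
  + exact: is_derive_continuous dGq.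
  + exact: cg.
  + apply: cvgV; first by lra.
    by apply: cvgM; [exact: cvg_cst|exact: cvg_id].
- have -> : q `^ (- s) = q * q `^ (- s - 1).
    by rewrite -{2}(powRr1 (ltW q0)) (@powR_mulE q _ _ (- s))//; ring.
  by rewrite /s; field; lra.
Qed.

(* Radial Weyl lemma.  The test function solves [L zeta = bump * (p - P)] with
   compact support, where [P] solves [L P = g]; the two free constants of [P]
   make [zeta] vanish to second order at [b]. *)
Lemma radial_weyl N (p g : R -> R) a b : (3 <= N)%N -> 0 < a -> a < b ->
  continuous p -> continuous g ->
  (forall zeta zeta1 zeta2 : R -> R,
    (forall q : R, is_derive q 1 zeta (zeta1 q)) ->
    (forall q : R, is_derive q 1 zeta1 (zeta2 q)) ->
    continuous zeta2 ->
    (forall q, ~~ (a < q < b) -> [/\ zeta q = 0, zeta1 q = 0 & zeta2 q = 0]) ->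
    radial_integral N (fun q => p q * (4 * q * zeta2 q + 2 * N%:R * zeta1 q)) =
    radial_integral N (fun q => g q * zeta q)) ->
  exists p1 p2 : R -> R, forall q, a < q < b ->
    [/\ is_derive q 1 p (p1 q), is_derive q 1 p1 (p2 q) &
        4 * q * p2 q + 2 * N%:R * p1 q = g q].
Proof.
move=> N3 a0 ab cp cg weak; pose c := a / 2; pose s : R := N%:R / 2.
have c0 : 0 < c by rewrite divr_gt0.
have ca : c < a by rewrite /c; lra.
(* [N >= 3] makes [y = q^(1-s)] a second solution of [L y = 0], independent of the constants. *)
have s1 : 1 - s != 0.
  have : (3%:R : R) <= N%:R by rewrite ler_nat.
  by rewrite /s; lra.
have [p0 [p01 [p02 hp0]]] := radial_poisson_exists N c0 cg.
pose y q : R := q `^ (1 - s).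
pose w q := p q - p0 q.
have cpw r q : c < q -> {for q, continuous (fun q : R => q `^ r)}.
  by move=> cq; apply: powR_continuous_pos; exact: lt_trans cq.
have cw q : c < q -> {for q, continuous w}.
  move=> cq; apply: cvgB; first exact: cp.
  by have [/is_derive_continuous + _ _ _] := hp0 q cq.
have antider (k : R -> R) : (forall q, c < q -> {for q, continuous k}) ->
    exists2 H, forall q, is_derive q 1 H (bump a b q * k q) & H a = 0.
  move=> ck; apply: antiderivative_exists; apply: (continuous_glue ca).
    by move=> q qa; rewrite bump_eq0 ?mul0r// ?ltW// negb_and -leNgt qa.
  by move=> q cq; apply: cvgM; [exact: bump_continuous|exact: ck].
(* Primitives of the moments of [1], [y], [y^2], and then of [w] and [w y], for the weight
   [bump * q^(s-1)]; the power is the radial volume density in the variable [q], up to a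
   constant. *)
have [A0 dA0 A00] := antider _ (cpw (s - 1)).
have [A1 dA1 A10] := antider (fun q => y q * q `^ (s - 1))
  (fun q cq => cvgM (cpw _ q cq) (cpw _ q cq)).
have [A2 dA2 A20] := antider (fun q => y q ^+ 2 * q `^ (s - 1))
  (fun q cq => cvgM (cvgM (cpw _ q cq) (cpw _ q cq)) (cpw _ q cq)).
have [B0 dB0 B00] := antider (fun q => w q * q `^ (s - 1))
  (fun q cq => cvgM (cw q cq) (cpw _ q cq)).
have [B1 dB1 B10] := antider (fun q => w q * y q * q `^ (s - 1))
  (fun q cq => cvgM (cvgM (cw q cq) (cpw _ q cq)) (cpw _ q cq)).
have A0b : 0 < A0 b.
  rewrite -A00; apply: (@primitive_bump_gt0 _ a b (fun q => q `^ (s - 1))) => //.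
    by move=> t; exact: powR_ge0.
  by move=> t /andP[/(lt_trans a0) t0 _]; exact: powR_gt0.
(* Gram determinant of [1] and [y]. With [mean = A1 b / A0 b], the quotient [det / A0 b] is the
   weighted integral of [(y - mean)^2], positive because [y] is not constant. *)
pose det := A0 b * A2 b - A1 b ^+ 2.
have det0 : 0 < det.
  pose mean := A1 b / A0 b.
  have dD q : is_derive q 1 (fun q => A2 q - 2 * mean * A1 q + mean ^+ 2 * A0 q)
      (bump a b q * ((y q - mean) ^+ 2 * q `^ (s - 1))).
    have h0 := dA0 q; have h1 := dA1 q; have h2 := dA2 q.
    by derive_rules; ring.
  have Dpos q : 0 <= bump a b q * ((y q - mean) ^+ 2 * q `^ (s - 1)).
    by rewrite mulr_ge0 ?bump_ge0// mulr_ge0 ?sqr_ge0 ?powR_ge0.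
  suff : 0 < A2 b - 2 * mean * A1 b + mean ^+ 2 * A0 b.
    rewrite -(pmulr_rgt0 _ A0b) /det /mean; congr (_ < _); field.
    by rewrite gt_eqF.
  rewrite lt_neqAle; apply/andP; split; last first.
    have := @is_derive_ge0_le _ _ _ a b (ltW ab) (fun q _ => dD q) (fun q _ => Dpos q).
    by rewrite A20 A10 A00 !mulr0 subr0 addr0.
  apply/eqP => E.
  have z q : a < q < b -> y q = mean.
    move=> qI; have := antiderivative_eq_ge0 Dpos dD _ qI.
    rewrite A20 A10 A00 !mulr0 subr0 addr0 => /(_ E)/eqP.
    rewrite mulf_eq0 gt_eqF ?bump_gt0//= mulf_eq0 sqrf_eq0 subr_eq0.
    by rewrite [q `^ _ == 0]gt_eqF ?orbF ?powR_gt0//; [move/eqP|lra].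
  have yy : y ((2 * a + b) / 3) = y ((a + 2 * b) / 3) by rewrite !z//; lra.
  have := congr1 (@ln R) yy; rewrite /y !ln_powR => /(mulfI s1) lnE.
  suff : (2 * a + b) / 3 = (a + 2 * b) / 3 by lra.
  by apply: (@ln_inj R) lnE; rewrite posrE; lra.
(* Cramer's rule: [al + ga * y] is the weighted projection of [w] onto the span of [1] and [y], so
   that [chi] and [Y] below vanish at [b]. *)
pose al := (B0 b * A2 b - B1 b * A1 b) / det.
pose ga := (B1 b * A0 b - B0 b * A1 b) / det.
have e1 : B0 b = al * A0 b + ga * A1 b.
  by rewrite /al /ga /det; field; rewrite -/det gt_eqF.
have e2 : B1 b = al * A1 b + ga * A2 b.
  by rewrite /al /ga /det; field; rewrite -/det gt_eqF.
pose P0 q := p0 q + (al + ga * y q).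
pose P1 q := p01 q + ga * ((1 - s) * q `^ (- s)).
pose P2 q := p02 q + ga * ((1 - s) * (- s * q `^ (- s - 1))).
have hP q : c < q -> [/\ is_derive q 1 P0 (P1 q), is_derive q 1 P1 (P2 q),
    {for q, continuous P2} & 4 * q * P2 q + 2 * N%:R * P1 q = g q].
  move=> cq; have [d0 d1 cp2 eq] := hp0 q cq; have q0 : 0 < q by lra.
  split.
  - rewrite /P0 /y; derive_rules => //; rewrite /P1.
    by rewrite (_ : 1 - s - 1 = - s); ring.
  - by rewrite /P1; derive_rules => //; rewrite /P2; ring.
  - apply: cvgD; first exact: cp2.
    by do 3 (apply: cvgM; first exact: cvg_cst); exact: cpw.
  - rewrite /P1 /P2 !mulrDr addrACA eq -[RHS]addr0; congr (_ + _).
    have -> : q `^ (- s) = q * q `^ (- s - 1).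
      by rewrite -{2}(powRr1 (ltW q0)) (@powR_mulE q _ _ (- s))//; ring.
    by rewrite /s; field.
pose chi q := (B0 q - al * A0 q - ga * A1 q) / 4.
pose Y q := (B1 q - al * A1 q - ga * A2 q) / 4.
pose h q := bump a b q * ((p q - P0 q) * q `^ (s - 1) / 4).
have dchi q : is_derive q 1 chi (h q).
  have h0 := dA0 q; have h1 := dA1 q; have h2 := dB0 q.
  by rewrite /chi; derive_rules; rewrite /h /P0 /w; field.
have dY q : is_derive q 1 Y (h q * y q).
  have h0 := dA1 q; have h1 := dA2 q; have h2 := dB1 q.
  by rewrite /Y; derive_rules; rewrite /h /P0 /w; field.
have h0 q : ~~ (a < q < b) -> h q = 0 by move=> qI; rewrite /h bump_eq0 ?mul0r// ltW.
have chi0 q : ~~ (a < q < b) -> chi q = 0.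
  apply: (is_derive_vanish_outside (ltW ab) dchi h0).
    by rewrite /chi B00 A00 A10; ring.
  by rewrite /chi e1; ring.
have Y0 q : ~~ (a < q < b) -> Y q = 0.
  apply: (is_derive_vanish_outside (ltW ab) dY).
  - by move=> t /h0 ->; rewrite mul0r.
  - by rewrite /Y B10 A10 A20; ring.
  - by rewrite /Y e2; ring.
(* The equation for [zeta] is solved by [q^s zeta' = chi]. Integrating [q^(-s) chi] by parts, with
   [Y' = h y], gives this closed form. *)
pose zeta q := (chi q * y q - Y q) / (1 - s).
pose zeta1 q := chi q * q `^ (- s).
pose zeta2 q := h q * q `^ (- s) - s * chi q * q `^ (- s - 1).
have z0 q : ~~ (a < q < b) -> [/\ zeta q = 0, zeta1 q = 0 & zeta2 q = 0].
  move=> qI; rewrite /zeta /zeta1 /zeta2 h0// chi0// Y0//.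
  by split; rewrite ?mulr0 ?mul0r ?subrr// mul0r.
have la q : q <= a -> ~~ (a < q < b) by rewrite negb_and -leNgt => ->.
have dz q : is_derive q 1 zeta (zeta1 q).
  move: q; apply: (is_derive_glue ca) => [q /la/z0[]//|q /la/z0[]//|q cq].
  have q0 : 0 < q by lra.
  have h1 := dchi q; have h2 := dY q; rewrite /zeta /y; derive_rules => //.
  rewrite /zeta1 -/(y q) (_ : 1 - s - 1 = - s); last by ring.
  by field.
have dz1 q : is_derive q 1 zeta1 (zeta2 q).
  move: q; apply: (is_derive_glue ca) => [q /la/z0[]//|q /la/z0[]//|q cq].
  have q0 : 0 < q by lra.
  by have h1 := dchi q; rewrite /zeta1; derive_rules => //; rewrite /zeta2; ring.
have cP0 q : c < q -> {for q, continuous P0}.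
  by move=> /hP[/is_derive_continuous].
have ch q : c < q -> {for q, continuous h}.
  move=> cq; apply: cvgM; first exact: bump_continuous.
  apply: cvgM; last exact: cvg_cst.
  by apply: cvgM; [apply: cvgB; [exact: cp|exact: cP0]|exact: cpw].
have cchi q : {for q, continuous chi} := is_derive_continuous (dchi q).
have cz2 : continuous zeta2.
  apply: (continuous_glue ca) => [q /la/z0[]//|q cq].
  apply: cvgB; apply: cvgM; [exact: ch|exact: cpw| |exact: cpw].
  by apply: cvgM; [exact: cvg_cst|exact: cchi].
have Lz q : c < q -> 4 * q * zeta2 q + 2 * N%:R * zeta1 q = bump a b q * (p q - P0 q).
  move=> cq; have q0 : 0 < q by lra.
  have -> : bump a b q * (p q - P0 q) = 4 * q * (h q * q `^ (- s)).
    rewrite /h -!mulrA; have -> : q `^ (s - 1) * (4^-1 * q `^ (- s)) = (4 * q)^-1.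
      rewrite mulrCA (@powR_mulE q _ _ (-1))//; last by ring.
      by rewrite powR_inv1 ?ltW// invfM.
    by field; lra.
  rewrite /zeta1 /zeta2; have -> : q `^ (- s) = q * q `^ (- s - 1).
    by rewrite -{2}(powRr1 (ltW q0)) (@powR_mulE q _ _ (- s))//; ring.
  by rewrite /s; field.
have b0 : 0 <= b by rewrite ltW// (lt_trans a0).
have W := weak _ _ _ dz dz1 cz2 z0.
have G := @radial_Green N P0 P1 P2 zeta zeta1 zeta2 a b c b0 ca
  (fun q cq => let: And4 x _ _ _ := hP q cq in x)
  (fun q cq => let: And4 _ x _ _ := hP q cq in x)
  (fun q cq => let: And4 _ _ x _ := hP q cq in x) dz dz1 cz2 z0.
have gb q : b < q -> ~~ (a < q < b) by move=> /ltW; rewrite negb_and -!leNgt => ->; rewrite orbT.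
pose Lzeta q := 4 * q * zeta2 q + 2 * N%:R * zeta1 q.
have Lz0 q : ~~ (a < q < b) -> Lzeta q = 0.
  by move=> /z0[_ e3 e4]; rewrite /Lzeta e3 e4 !mulr0 addr0.
have cLz : continuous Lzeta.
  move=> q; apply: cvgD; apply: cvgM.
  - by apply: cvgM; [exact: cvg_cst|exact: cvg_id].
  - exact: cz2.
  - exact: cvg_cst.
  - exact: is_derive_continuous (dz1 q).
(* The weak equation for [p] and Green's identity for [P0] give the same integral against [L zeta];
   hence [sq] has integral zero. *)
pose sq q := bump a b q * (p q - P0 q) ^+ 2.
have sqE q : sq q = -1 * (P0 q * Lzeta q) + p q * Lzeta q.
  have [qa|aq] := leP q a; first by rewrite /sq Lz0 ?la// bump_eq0 ?ltW ?la//; ring.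
  by rewrite /Lzeta Lz ?(lt_trans ca)// /sq; ring.
have csq : csupp_right b (fun q => P0 q * Lzeta q).
  split; last by move=> q /gb/Lz0 ->; rewrite mulr0.
  apply: (continuous_glue ca) => [q /la/Lz0 ->|q cq]; first by rewrite mulr0.
  by apply: cvgM; [exact: cP0|exact: cLz].
have csp : csupp_right b (fun q => p q * Lzeta q).
  split; last by move=> q /gb/Lz0 ->; rewrite mulr0.
  by move=> q; apply: cvgM; [exact: cp|exact: cLz].
have I0 : radial_integral N sq = 0.
  have -> : sq = (fun q => -1 * (P0 q * Lzeta q) + p q * Lzeta q) by apply/funext.
  rewrite (radial_integral_lin _ _ b0)// W G; apply/eqP; rewrite mulN1r addrC subr_eq0.
  apply/eqP; congr radial_integral; apply/funext => q.
  have [qa|aq] := leP q a; first by have [-> _ _] := z0 q (la q qa); rewrite mulr0 mul0r.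
  by have [_ _ _ ->] := hP q (lt_trans ca aq); rewrite mulrC.
have pP q : a < q < b -> P0 q = p q.
  move=> qI; have sq0 := @radial_integral_eq0 _ N b sq _ b0 _ _ I0 q.
  have : sq q = 0.
    apply: sq0; [by case: (N) N3| |by move=> t; rewrite mulr_ge0 ?bump_ge0 ?sqr_ge0|lra].
    have -> : sq = (fun q => -1 * (P0 q * Lzeta q) + p q * Lzeta q) by apply/funext.
    exact: csupp_right_lin.
  move/eqP; rewrite mulf_eq0 gt_eqF ?bump_gt0//= sqrf_eq0 subr_eq0.
  by move/eqP.
exists P1, P2 => q qI; have cq : c < q by lra.
have [d0 d1 _ eL] := hP q cq; split=> //.
apply: near_eq_is_derive d0.
have : \forall z \near q, z \in `]a, b[ by apply: near_in_itvoo; rewrite in_itv.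
by apply: filterS => z; rewrite in_itv/= => /pP.
Qed.

End RadialWeyl.

(** * From the weak formulation to the potential and its equation *)

Section Potential.
Context {R : realType}.
Notation mu := (@lebesgue_measure R).
Implicit Types (q t : R).

Lemma powR_max_continuous (m : R) : 1 < m -> continuous (fun x : R => Num.max x 0 `^ m).
Proof.
move=> m1 x; have m0 : 0 < m by lra.
have [x0|x0|->] := ltgtP x 0.
- rewrite /continuous_at max_r ?ltW// powR0 ?gt_eqF//.
  have e : \forall z \near x, cst 0 z = Num.max z 0 `^ m.
    have : \forall z \near x, z < 0 by exact: lt_nbhsl.
    by apply: filterS => z z0; rewrite max_r ?ltW// powR0 ?gt_eqF.
  by apply: cvg_trans (near_eq_cvg e) _; exact: cvg_cst.
- apply: (@continuous_comp _ _ _ (fun x : R => Num.max x 0) (fun x => x `^ m)).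
    by apply: (@continuous_max _ _ (fun x => x) (fun=> 0)); [exact: cvg_id|exact: cvg_cst].
  by apply: powR_continuous_pos; rewrite lt_max x0.
- apply/cvgrPdist_le => e e0; rewrite maxxx powR0 ?gt_eqF//.
  apply/nbhs_ballP; exists (Num.min 1 e); rewrite /= ?lt_min ?ltr01// => z.
  rewrite /ball/= sub0r normrN lt_min => /andP[z1 ze].
  rewrite sub0r normrN ger0_norm ?powR_ge0//.
  have [z0|z0] := leP z 0; first by rewrite powR0 ?gt_eqF// ltW.
  rewrite (le_trans (ge1r_powR _ (ltW m1)))//.
    by rewrite z0 (le_trans (ler_norm _))// ltW.
  by rewrite (le_trans (ler_norm _))// ltW.
Qed.

Lemma continuous_pair (T U V : topologicalType) (g : T -> U) (h : T -> V) (x : T) :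
  {for x, continuous g} -> {for x, continuous h} ->
  {for x, continuous (fun y => (g y, h y))}.
Proof. by move=> cg ch; exact: (@cvg_pair _ _ _ _ _ _ _ _ _ g h cg ch). Qed.

(** [P] is Lipschitz in time with constant [M]. At a fixed time, it depends continuously on [q]
    because [w] does so uniformly on the compact interval between [t0] and [s]. *)
Lemma antiderivative_family_continuous (w P : R -> R -> R) (t0 M : R) :
  continuous (fun p : R * R => w p.1 p.2) -> (forall q t, `|w q t| <= M) ->
  (forall q t, is_derive t 1 (P q) (w q t)) -> (forall q, P q t0 = 0) ->
  continuous (fun p : R * R => P p.1 p.2).
Proof.
move=> cw wM dP P0 [q s].
have M0 : 0 <= M by rewrite (le_trans _ (wM 0 0)).
have lip q' a b : `|P q' b - P q' a| <= M * `|b - a|.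
  wlog ab : a b / a <= b => [H|].
    have [/H//|/ltW/H] := leP a b; by rewrite distrC [`|a - b|]distrC.
  have [c _ ->] := MVT_is_derive ab (fun x _ => dP q' x).
  by rewrite normrM ler_wpM2r.
have dist q' a b e : 0 <= e -> a <= b -> (forall x, a <= x <= b -> `|w q' x - w q x| <= e) ->
    `|(P q' b - P q b) - (P q' a - P q a)| <= e * `|b - a|.
  move=> e0 ab H; have dD (x : R) : is_derive x 1 (fun x => P q' x - P q x) (w q' x - w q x).
    by apply: is_deriveB; exact: dP.
  have [c cab ->] := MVT_is_derive ab (fun x _ => dD x).
  by rewrite normrM ler_wpM2r// H.
apply/cvgrPdist_lt => e e0.
pose L := `|s - t0| + 1; have L0 : 0 < L by rewrite ltr_wpDl.
pose e1 := e / (2 * L); have e10 : 0 < e1 by rewrite divr_gt0// mulr_gt0.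
have := @continuous_uniform_segment R (fun x q => w q x) (Num.min s t0) (Num.max s t0) q e1 _ e10.
have cw' x : Num.min s t0 <= x <= Num.max s t0 ->
    {for (x, q), continuous (fun p : R * R => w p.2 p.1)}.
  move=> _; apply: (@continuous_comp _ _ _ (fun p : R * R => (p.2, p.1)) (fun p => w p.1 p.2)).
    by apply: (@continuous_pair _ _ _ snd fst); [exact: cvg_snd|exact: cvg_fst].
  exact: cw.
move=> /(_ cw') U.
pose e2 := e / (2 * (M + 1)); have M1 : 0 < M + 1 by rewrite ltr_wpDl.
have e20 : 0 < e2 by rewrite divr_gt0// mulr_gt0.
exists ([set q' | forall x, Num.min s t0 <= x <= Num.max s t0 -> `|w q' x - w q x| < e1],
        ball s e2).
  by split; [exact: U|exact: nbhsx_ballx].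
move=> [q' s'] /= [Uq]; rewrite /ball/= => Bs.
have h1 : `|P q' s' - P q' s| < e / 2.
  rewrite (le_lt_trans (lip _ _ _))// distrC.
  rewrite (@le_lt_trans _ _ ((M + 1) * `|s - s'|))//; first by rewrite ler_wpM2r// lerDl.
  rewrite -ltr_pdivlMl// (lt_le_trans Bs)// /e2 le_eqVlt; apply/orP; left; apply/eqP.
  by field; rewrite gt_eqF.
have h2 : `|P q' s - P q s| <= e / 2.
  have -> : e / 2 = e1 * L by rewrite /e1; field; rewrite gt_eqF.
  have st : `|s - t0| <= L by rewrite lerDl.
  have [ts|st'] := leP t0 s.
    have := dist q' t0 s e1 (ltW e10) ts; rewrite !P0 !subr0 => H.
    rewrite (le_trans (H _))//; last by rewrite ler_wpM2l// ltW.
    by move=> x xI; apply/ltW/Uq; rewrite min_r// max_l.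
  have := dist q' s t0 e1 (ltW e10) (ltW st'); rewrite !P0 !subrr sub0r normrN => H.
  rewrite (le_trans (H _))//; last by rewrite distrC ler_wpM2l// ltW.
  by move=> x xI; apply/ltW/Uq; rewrite min_l ?max_r// ltW.
rewrite distrC (_ : P q' s' - P q s = (P q' s' - P q' s) + (P q' s - P q s)); last by ring.
rewrite (le_lt_trans (ler_normD _ _))//; lra.
Qed.

Definition axis (N : nat) : 'rV[R]_N := \row_(i < N) (i == 0 :> nat)%:R.

Lemma sqnorm_axis N (c : R) : (0 < N)%N -> sqnorm (c *: axis N) = c ^+ 2.
Proof.
case: N => // N _; rewrite /sqnorm big_ord_recl !mxE eqxx mulr1 big1 ?addr0//.
by move=> i _; rewrite !mxE /= mulr0 expr0n.
Qed.

(** The square root is [0] for negative [q], and [Num.max t 0] freezes the solution before time [0].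
    The profile is thus defined, and continuous, on the whole plane. *)
Definition profile N (u : 'rV[R]_N -> R -> R) (q t : R) : R :=
  u (Num.sqrt q *: axis N) (Num.max t 0).

Section Solution.
Variables (N : nat) (m : R) (f u0 : R -> R) (u : 'rV[R]_N -> R -> R).
Hypotheses (N3 : (3 <= N)%N) (m1 : 1 < m).
Hypothesis hu : weak_solution m f u0 u.

Let v := profile u.
Let N0 : (0 < N)%N. Proof. by case: (N) N3. Qed.

Lemma profileE x t : 0 <= t -> u x t = v (sqnorm x) t.
Proof.
move=> t0; case: hu => _ _ rad _ _; rewrite /v /profile max_l//; apply: rad => //.
by rewrite !enormE sqnorm_axis// sqr_sqrtr// sqnorm_ge0.
Qed.

Lemma profile_ge0 q t : 0 <= v q t.
Proof.
by case: hu => _ [M HM] _ _ _; case/andP: (HM (Num.sqrt q *: axis N) (Num.max t 0) ltac:(by rewrite le_max lexx orbT)).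
Qed.

Lemma profile_bounded : exists M, forall q t, v q t <= M.
Proof.
case: hu => _ [M HM] _ _ _; exists M => q t.
by case/andP: (HM (Num.sqrt q *: axis N) (Num.max t 0) ltac:(by rewrite le_max lexx orbT)).
Qed.

Lemma profile_continuous : continuous (fun p : R * R => v p.1 p.2).
Proof.
case: hu => cu _ _ _ _ p.
pose A := [set p : 'rV[R]_N * R | 0 <= p.2].
pose gm (p : R * R) : 'rV[R]_N * R := (Num.sqrt p.1 *: axis N, Num.max p.2 0).
have gA r : A (gm r) by rewrite /A /= le_max lexx orbT.
have cg : gm r @[r --> p] --> gm p.
  apply: (@continuous_pair _ _ _ (fun p : R * R => Num.sqrt p.1 *: axis N) (fun p => Num.max p.2 0)).
    apply: cvgZr_tmp.
    apply: (@continuous_comp _ _ _ (fst : R * R -> R) Num.sqrt); [exact: cvg_fst|exact: sqrt_continuous].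
  apply: (@continuous_comp _ _ _ (snd : R * R -> R) (fun t => Num.max t 0)); first exact: cvg_snd.
  by apply: (@continuous_max _ _ (fun t => t) (fun=> 0)); [exact: cvg_id|exact: cvg_cst].
have cu' : u r.1 r.2 @[r --> within A (nbhs (gm p))] --> u (gm p).1 (gm p).2.
  by rewrite (nbhs_subspace_in (gA p)); exact: cu.
apply: (@cvg_comp _ _ _ gm (fun p => u p.1 p.2) (nbhs p) (within A (nbhs (gm p)))); last exact: cu'.
move=> B BA; have BA' : \forall r \near p, A (gm r) -> B (gm r) := cg _ BA.
suff : \forall r \near p, B (gm r) by [].
by apply: filterS BA' => r; apply; exact: gA.
Qed.

Let w q t := v q t `^ m.

Lemma profile_pow_continuous : continuous (fun p : R * R => w p.1 p.2).
Proof.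
move=> p; have -> : (fun p : R * R => w p.1 p.2) = (fun p => Num.max (v p.1 p.2) 0 `^ m).
  by apply/funext => r; rewrite max_l// profile_ge0.
apply: (@continuous_comp _ _ _ (fun p => v p.1 p.2) (fun x => Num.max x 0 `^ m)).
  exact: profile_continuous.
exact: powR_max_continuous.
Qed.

Lemma continuous_slice1 (F : R -> R -> R) t : continuous (fun p : R * R => F p.1 p.2) ->
  continuous (F^~ t).
Proof.
move=> cF q; apply: (@continuous_comp _ _ _ (fun q => (q, t)) (fun p => F p.1 p.2)); last exact: cF.
by apply: continuous_pair; [exact: cvg_id|exact: cvg_cst].
Qed.

Lemma continuous_slice2 (F : R -> R -> R) q : continuous (fun p : R * R => F p.1 p.2) ->
  continuous (F q).
Proof.
move=> cF t; apply: (@continuous_comp _ _ _ (fun t => (q, t)) (fun p => F p.1 p.2)); last exact: cF.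
by apply: continuous_pair; [exact: cvg_cst|exact: cvg_id].
Qed.

Section Weak.
Variables (theta rho T1 : R).
Hypotheses (T10 : 0 <= T1) (rho0 : 0 < rho).
Hypothesis f0 : forall s, 0 <= s <= theta -> f s = 0.
Hypothesis small : forall x t, T1 <= t -> rho <= enorm x -> u x t <= theta.

Variables (a b : R) (zeta zeta1 zeta2 : R -> R).
Hypotheses (ra : rho ^+ 2 <= a) (ab : a < b).
Hypothesis dz : forall q, is_derive (q : R) 1 zeta (zeta1 q).
Hypothesis dz1 : forall q, is_derive (q : R) 1 zeta1 (zeta2 q).
Hypothesis cz2 : continuous zeta2.
Hypothesis z0 : forall q, ~~ (a < q < b) -> [/\ zeta q = 0, zeta1 q = 0 & zeta2 q = 0].

Let Lzeta q := 4 * q * zeta2 q + 2 * N%:R * zeta1 q.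
Let a0 : 0 < a. Proof. by rewrite (lt_le_trans _ ra)// exprn_gt0. Qed.
Let b0 : 0 <= b. Proof. by rewrite ltW// (lt_trans a0). Qed.
Let gb q : b < q -> ~~ (a < q < b).
Proof. by move=> /ltW; rewrite negb_and -!leNgt => ->; rewrite orbT. Qed.
Let cz : continuous zeta. Proof. by move=> q; exact: is_derive_continuous (dz q). Qed.
Let cLz : continuous Lzeta.
Proof.
move=> q; apply: cvgD; apply: cvgM.
- by apply: cvgM; [exact: cvg_cst|exact: cvg_id].
- exact: cz2.
- exact: cvg_cst.
- exact: is_derive_continuous (dz1 q).
Qed.
Let zeta_out q : b < q -> zeta q = 0. Proof. by move=> /gb/z0[]. Qed.
Let Lzeta_out q : b < q -> Lzeta q = 0.
Proof. by move=> /gb/z0[_ e1 e2]; rewrite /Lzeta e1 e2 !mulr0 addr0. Qed.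

Let csupp_mul (F : R -> R -> R) (k : R -> R) t : continuous (fun p : R * R => F p.1 p.2) ->
  continuous k -> (forall q, b < q -> k q = 0) -> csupp_right b (fun q => F q t * k q).
Proof.
move=> cF ck k0; split=> [q|q /k0 ->]; last by rewrite mulr0.
by apply: cvgM; [exact: continuous_slice1|exact: ck].
Qed.

Let joint_mul (F : R -> R -> R) (k : R -> R) : continuous (fun p : R * R => F p.1 p.2) ->
  continuous k -> continuous (fun p : R * R => F p.1 p.2 * k p.1).
Proof.
move=> cF ck p; apply: cvgM; first exact: cF.
by apply: (@continuous_comp _ _ _ (fst : R * R -> R) k); [exact: cvg_fst|exact: ck].
Qed.

Let moment_continuous (F : R -> R -> R) (k : R -> R) : continuous (fun p : R * R => F p.1 p.2) ->
  continuous k -> (forall q, b < q -> k q = 0) ->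
  continuous (fun t => radial_integral N (fun q => F q t * k q)).
Proof.
move=> cF ck k0 t; apply: (@radial_integral_cont R N b (fun q t => F q t * k q)) => //.
- by move=> s; have [] := csupp_mul s cF ck k0.
- by move=> q s /k0 ->; rewrite mulr0.
- by move=> q _; exact: joint_mul.
Qed.

(** The test function lives where [q > rho^2] and [t > T1]; there [u <= theta], so the reaction term
    is zero. The initial term drops out because [chi] vanishes at time [0 <= T1]. *)
Lemma weak_time_identity (chi chi1 : R -> R) (d : R) : T1 <= d ->
  (forall t, is_derive (t : R) 1 chi (chi1 t)) -> continuous chi1 ->
  (forall t, ~~ (T1 < t < d) -> chi t = 0) ->
  (forall t, ~~ (T1 < t < d) -> chi1 t = 0) ->
  \int[mu]_(t in `[T1, d])
    (chi1 t * radial_integral N (fun q => v q t * zeta q) +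
     chi t * radial_integral N (fun q => w q t * Lzeta q)) = 0.
Proof.
move=> T1d dchi cchi1 chi0 chi10.
have d0 : 0 <= d by exact: le_trans T1d.
pose K := b + d.
have zK q : K < q -> zeta q = 0 by move=> Kq; apply: zeta_out; rewrite /K in Kq; lra.
have cK t : K < `|t| -> chi t = 0.
  move=> Kt; apply: chi0; apply/negP => /andP[t1 t2]; move: Kt.
  have := b0; have := T10 => ? ?; rewrite ger0_norm /K; lra.
have tst := @test_function_radial R N zeta zeta1 zeta2 dz dz1 cz2 chi chi1 K dchi cchi1 zK cK.
case: hu => _ _ _ _ /(_ _ tst).
have -> : integral_space (fun x : 'rV[R]_N => u0 (enorm x) * (zeta (sqnorm x) * chi 0)) = 0.
  rewrite chi0 ?negb_and -?leNgt ?T10//.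
  rewrite (_ : (fun _ => _) = (fun=> 0)); last by apply/funext => x; rewrite !mulr0.
  exact: etrans (@integral_space_radial R N (fun=> 0)) (radial_integral0 N).
rewrite addr0 => <-.
have inner t : 0 <= t -> integral_space (fun x : 'rV[R]_N =>
    u x t * derive1 (fun t => zeta (sqnorm x) * chi t) t +
    u x t `^ m * laplacian (fun x => zeta (sqnorm x) * chi t) x +
    f (u x t) * (zeta (sqnorm x) * chi t)) =
    chi1 t * radial_integral N (fun q => v q t * zeta q) +
    chi t * radial_integral N (fun q => w q t * Lzeta q).
  move=> t0; pose h q := chi1 t * (v q t * zeta q) + (chi t * (w q t * Lzeta q) + 0).
  have -> : (fun x : 'rV[R]_N => u x t * derive1 (fun t => zeta (sqnorm x) * chi t) t +
    u x t `^ m * laplacian (fun x => zeta (sqnorm x) * chi t) x +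
    f (u x t) * (zeta (sqnorm x) * chi t)) = (fun x => h (\sum_i x ord0 i ^+ 2)).
    apply/funext => x.
    rewrite (@derive1_test R N zeta chi chi1 dchi x t) (@laplacian_radial R N zeta zeta1 zeta2 dz dz1) -/(sqnorm x) profileE//.
    have -> : f (v (sqnorm x) t) * (zeta (sqnorm x) * chi t) = 0.
      have [xI|/z0[-> _ _]] := boolP (a < sqnorm x < b); last by rewrite mul0r mulr0.
      have [tI|/chi0 ->] := boolP (T1 < t < d); last by rewrite !mulr0.
      rewrite f0 ?mul0r// profile_ge0 -profileE//= small//; first by case/andP: tI => /ltW.
      rewrite enormE -(ger0_norm (ltW rho0)) -sqrtr_sqr ler_sqrt ?sqnorm_ge0//.
      by rewrite (le_trans ra)// ltW//; case/andP: xI.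
    by rewrite /h /w /Lzeta -/(sqnorm x); ring.
  rewrite (@integral_space_radial R N h) /h (radial_integral_lin _ _ b0).
  - by congr (_ + _); rewrite (radial_integral_lin _ _ b0) ?radial_integral0 ?addr0//;
      [apply: csupp_mul => //; exact: profile_pow_continuous|split=> // q; exact: cvg_cst].
  - by apply: csupp_mul => //; exact: profile_continuous.
  - apply: csupp_right_lin; last by split=> // q; exact: cvg_cst.
    by apply: csupp_mul => //; exact: profile_pow_continuous.
rewrite (@Rintegral_subset R `[0, +oo[ _ T1 d).
- apply: eq_Rintegral => t; rewrite inE/= in_itv/= => /andP[T1t td].
  by rewrite inner// (le_trans T10).
- by move=> t; rewrite /= !in_itv/= andbT => /andP[/(le_trans T10)].
- move=> t; rewrite /= in_itv/= andbT => t0 tI; rewrite inner//.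
  have tI' : ~~ (T1 < t < d) by apply: contra tI => /andP[/ltW -> /ltW ->].
  by rewrite chi0// chi10// !mul0r addr0.
Qed.

(* Here the time integral [P] of [u^m] absorbs the time derivative: [L P = v - v(., T0)]
   in the sense of distributions in [q]. *)
Lemma weak_potential_identity (P : R -> R -> R) (T0 t : R) : T1 < T0 -> T0 <= t ->
  (forall q t, is_derive t 1 (P q) (w q t)) -> (forall q, P q T0 = 0) ->
  radial_integral N (fun q => P q t * Lzeta q) =
  radial_integral N (fun q => (v q t - v q T0) * zeta q).
Proof.
(* The du Bois-Reymond lemma compares interior times only: the extra unit puts [t] inside []T1, d[],
   and [T1 < T0] does it for [T0]. *)
move=> T10' T0t dP P0; pose d := t + 1.
have [M vM] := profile_bounded.
have M0 : 0 <= M by rewrite (le_trans (profile_ge0 0 0)).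
have m0 : 0 <= m by have := m1; lra.
have cP : continuous (fun p : R * R => P p.1 p.2).
  apply: (@antiderivative_family_continuous w P T0 (M `^ m)) => //; first exact: profile_pow_continuous.
  move=> q s; rewrite ger0_norm ?powR_ge0// ge0_ler_powR// ?nnegrE//.
  exact: profile_ge0.
pose A1 s := radial_integral N (fun q => v q s * zeta q).
pose A2 s := radial_integral N (fun q => P q s * Lzeta q).
pose a2 s := radial_integral N (fun q => w q s * Lzeta q).
have dA2 (s : R) : is_derive s 1 A2 (a2 s).
  apply: (@is_derive_radial_integral R N b (fun q t => P q t * Lzeta q)
    (fun q t => w q t * Lzeta q) (s - 1) (s + 1)) => //; first by lra.
  - by move=> r _; have [] := csupp_mul r cP cLz Lzeta_out.
  - by move=> q r _ /Lzeta_out ->; rewrite mulr0.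
  - by move=> q r _ _; have h := dP q r; derive_rules; ring.
  - by apply: csupp_mul => //; exact: profile_pow_continuous.
  - by move=> q _; apply: joint_mul => //; exact: profile_pow_continuous.
have ca2 : continuous a2 by apply: moment_continuous => //; exact: profile_pow_continuous.
have cA1 : continuous A1 by apply: moment_continuous => //; exact: profile_continuous.
(* Integrating [chi * a2] by parts in time, with [a2] the derivative of [A2], turns the weak
   identity into the orthogonality of [W] to every [chi1], so [W] is constant. *)
pose W s := A1 s - A2 s.
have cW : continuous W.
  by move=> s; apply: cvgB; [exact: cA1|exact: is_derive_continuous (dA2 s)].
have T1d : T1 < d by rewrite /d; lra.
have := du_bois_reymond T1d cW; move=> /(_ _ T0 t) E.
have {}E : W T0 = W t.
  apply: E; [|by rewrite /d; lra..].
  move=> chi chi1 dchi cchi1 chi0 chi10.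
  have := weak_time_identity (ltW T1d) dchi cchi1 chi0 chi10.
  have c1W : continuous (fun s => chi1 s * W s).
    by move=> s; apply: cvgM; [exact: cchi1|exact: cW].
  have [E dE _] := antiderivative_exists 0 c1W.
  have -> : \int[mu]_(t in `[T1, d]) (chi1 t * A1 t + chi t * a2 t) =
      E d + chi d * A2 d - (E T1 + chi T1 * A2 T1).
    apply: (@FTC_Rintegral R (fun t => chi1 t * A1 t + chi t * a2 t) (fun s => E s + chi s * A2 s)).
    - exact: ltW.
    - move=> s; apply: cvgD; apply: cvgM; [exact: cchi1|exact: cA1| |exact: ca2].
      exact: is_derive_continuous (dchi s).
    - move=> s; have h1 := dE s; have h2 := dchi s; have h3 := dA2 s.
      by derive_rules; rewrite /W /A1 /a2; ring.
  rewrite !chi0 ?ltxx ?andbF// !mul0r !addr0 => <-.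
  exact: (@FTC_Rintegral R (fun s => chi1 s * W s) E _ _ (ltW T1d)).
have A20 : A2 T0 = 0.
  rewrite -(radial_integral0 N); congr radial_integral; apply/funext => q.
  by rewrite P0 mul0r.
have -> : radial_integral N (fun q => P q t * Lzeta q) = A1 t - A1 T0.
  by move: E; rewrite /W A20 -/(A2 t); lra.
transitivity (-1 * A1 T0 + A1 t); first by ring.
rewrite -(radial_integral_lin _ _ b0); last 2 first.
- by apply: csupp_mul => //; exact: profile_continuous.
- by apply: csupp_mul => //; exact: profile_continuous.
by congr radial_integral; apply/funext => q; ring.
Qed.

End Weak.

(** A primitive in time is chosen for each [q] separately; the bound on [w] restores joint
    continuity, and the Weyl lemma with right-hand side [v(.,t) - v(.,T0)] supplies the derivatives
    in [q]. *)
Lemma potential_exists (theta rho T1 T0 : R) : 0 <= T1 -> T1 < T0 -> 0 < rho ->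
  (forall s, 0 <= s <= theta -> f s = 0) ->
  (forall x t, T1 <= t -> rho <= enorm x -> u x t <= theta) ->
  exists P : R -> R -> R,
  [/\ forall q, P q T0 = 0, forall q t, is_derive t 1 (P q) (w q t),
      continuous (fun p : R * R => P p.1 p.2) &
      forall t a b, T0 <= t -> rho ^+ 2 <= a -> a < b -> exists p1 p2 : R -> R,
        forall q, a < q < b ->
        [/\ is_derive q 1 (P^~ t) (p1 q), is_derive q 1 p1 (p2 q) &
            4 * q * p2 q + 2 * N%:R * p1 q = v q t - v q T0]].
Proof.
move=> T10 T1T0 rho0 f0 small.
have Pex q : exists2 H, forall t, is_derive t 1 H (w q t) & H T0 = 0.
  by apply: antiderivative_exists; exact: continuous_slice2 profile_pow_continuous.
pose P q := sval (cid2 (Pex q)).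
have dP q t : is_derive t 1 (P q) (w q t) by rewrite /P; case: cid2 => H /= dH _.
have P0 q : P q T0 = 0 by rewrite /P; case: cid2 => H.
have [M vM] := profile_bounded.
have M0 : 0 <= M by rewrite (le_trans (profile_ge0 0 0)).
have m0 : 0 <= m by have := m1; lra.
have cP : continuous (fun p : R * R => P p.1 p.2).
  apply: (@antiderivative_family_continuous w P T0 (M `^ m)) => //; first exact: profile_pow_continuous.
  move=> q s; rewrite ger0_norm ?powR_ge0// ge0_ler_powR// ?nnegrE//.
  exact: profile_ge0.
exists P; split=> // t a b T0t ra ab.
have a0 : 0 < a by rewrite (lt_le_trans _ ra)// exprn_gt0.
apply: radial_weyl => //.
- exact: continuous_slice1.
- by move=> q; apply: cvgB; exact: (continuous_slice1 profile_continuous).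
- move=> zeta zeta1 zeta2 dz dz1 cz2 z0.
  exact: (weak_potential_identity T10 rho0 f0 small ra ab dz dz1 cz2 z0 T1T0 T0t dP P0).
Qed.

End Solution.
End Potential.

(** * Comparison for the potential outside a fixed ball *)

Section Exterior.
Context {R : realType}.
Implicit Types (q t : R).
Variables (N : nat) (m q0 T0 : R) (v P : R -> R -> R).
Hypotheses (N3 : (3 <= N)%N) (m1 : 1 < m) (q0_gt0 : 0 < q0).
Hypothesis v_ge0 : forall q t, 0 <= v q t.
Hypothesis v_le1 : forall q t, q0 <= q -> T0 <= t -> v q t <= 1.
Hypothesis P_init : forall q, P q T0 = 0.
Hypothesis P_time : forall q t, is_derive t 1 (P q) (v q t `^ m).
Hypothesis P_cont : continuous (fun p : R * R => P p.1 p.2).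
Hypothesis P_space : forall t a b, T0 <= t -> q0 <= a -> a < b ->
  exists p1 p2 : R -> R, forall q, a < q < b ->
  [/\ is_derive q 1 (P^~ t) (p1 q), is_derive q 1 p1 (p2 q) &
      4 * q * p2 q + 2 * N%:R * p1 q = v q t].
Hypothesis v_supp : forall t, T0 <= t -> exists B, forall q, B <= q -> v q t = 0.

Let NR : 3%:R <= N%:R :> R. Proof. by rewrite ler_nat. Qed.

Lemma potential_le q t t' : t <= t' -> P q t <= P q t'.
Proof.
by move=> tt; apply: (@is_derive_ge0_le R _ (fun t => v q t `^ m)) => // x _; exact: powR_ge0.
Qed.

Lemma potential_ge0 q t : T0 <= t -> 0 <= P q t.
Proof. by move=> /(potential_le q); rewrite P_init. Qed.

Lemma powR_le_self (x : R) : 0 <= x <= 1 -> x `^ m <= x.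
Proof.
move=> /andP[x0 x1]; have := m1 => m1'; have [->|xn0] := eqVneq x 0.
  by rewrite powR0// gt_eqF//; lra.
by apply: ge1r_powR; [rewrite lt_neqAle eq_sym xn0 x0|lra].
Qed.

Lemma potential_le_time q t : q0 <= q -> T0 <= t -> P q t <= t - T0.
Proof.
move=> qq tT; have [c cI] := MVT_is_derive tT (fun x _ => P_time q x).
rewrite P_init subr0 => ->; rewrite ler_piMl ?subr_ge0//.
have vc : v q c <= 1 by apply: v_le1 => //; case/andP: cI.
by rewrite (le_trans (powR_le_self _))// v_ge0 vc.
Qed.

(** At a positive interior maximum of [P - phi] the first derivatives agree and the second are
    ordered, so [v = L P <= L phi]. The last hypothesis is quantified over the possible values [x]
    of [v], which avoids a real power of [L phi], whose sign is not known. *)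
Lemma supersolution (phi : R -> R -> R) (q1 q2 T : R) : q0 <= q1 ->
  (forall q t, q1 <= q <= q2 -> T0 <= t <= T ->
     {for (q, t), continuous (fun p : R * R => phi p.1 p.2)}) ->
  (forall t, T0 <= t <= T -> P q1 t <= phi q1 t) ->
  (forall t, T0 <= t <= T -> P q2 t <= phi q2 t) ->
  (forall q, q1 <= q <= q2 -> 0 <= phi q T0) ->
  (forall q t, q1 < q < q2 -> T0 < t <= T -> exists (f1 : R -> R) (f2 ft : R),
     [/\ \forall z \near q, is_derive (z : R) 1 (phi^~ t) (f1 z), is_derive q 1 f1 f2,
         is_derive t 1 (phi q) ft &
         forall x, 0 <= x <= 1 -> x <= 4 * q * f2 + 2 * N%:R * f1 q -> x `^ m <= ft]) ->
  forall q t, q1 <= q <= q2 -> T0 <= t <= T -> P q t <= phi q t.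
Proof.
move=> q01 cphi b1 b2 b0 hphi q t qI tI; rewrite -subr_le0.
apply: (@max_principle R (fun q t => P q t - phi q t) q1 q2 T0 T) => // {q t qI tI}.
- by move=> q t qI tI; apply: cvgB; [exact: P_cont|exact: cphi].
- by move=> t tI; rewrite subr_le0 b1.
- by move=> t tI; rewrite subr_le0 b2.
- by move=> q qI; rewrite P_init sub0r oppr_le0 b0.
move=> q t qI tI _ qmax.
have [f1 [f2 [ft [d1 d2 dt hx]]]] := hphi q t qI tI.
have T0t : T0 <= t by case/andP: tI => /ltW.
have q12 : q1 < q2 by lra.
have [p1 [p2 hp]] := P_space T0t q01 q12.
have [_ dp2 Lp] := hp q qI.
have dD : is_derive q 1 (fun z => p1 z - f1 z) (p2 q - f2) by apply: is_deriveB.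
have dD1 : \forall z \near q, is_derive (z : R) 1 (fun z => P z t - phi z t) (p1 z - f1 z).
  have : \forall z \near q, z \in `]q1, q2[ by apply: near_in_itvoo; rewrite in_itv.
  apply: filterS2 d1 => z fz; rewrite in_itv/= => /hp[pz _ _].
  by apply: is_deriveB.
have [/eqP e1 e2] := second_derivative_test dD1 dD qmax.
exists (v q t `^ m - ft).
  by have h1 := P_time q t; apply: is_deriveB.
rewrite subr_le0; apply: hx; first by rewrite v_ge0 v_le1//; lra.
rewrite -Lp; have -> : p1 q = f1 q by move: e1; rewrite subr_eq0 => /eqP.
have q_gt0 : 0 < q by have := q0_gt0; lra.
by rewrite lerD2r ler_wpM2l//; [rewrite mulr_ge0// ltW|rewrite -subr_le0].
Qed.

(** Mirror image of [supersolution]. As [P >= 0], a positive maximum of [phi - P] lies where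
    [phi > 0], so a truncated [phi] is tested only inside its support. *)
Lemma subsolution (phi : R -> R -> R) (q1 q2 T1 T : R) : q0 <= q1 -> T0 <= T1 ->
  (forall q t, q1 <= q <= q2 -> T1 <= t <= T ->
     {for (q, t), continuous (fun p : R * R => phi p.1 p.2)}) ->
  (forall t, T1 <= t <= T -> phi q1 t <= P q1 t) ->
  (forall t, T1 <= t <= T -> phi q2 t <= P q2 t) ->
  (forall q, q1 <= q <= q2 -> phi q T1 <= 0) ->
  (forall q t, q1 < q < q2 -> T1 < t <= T -> 0 < phi q t -> exists (f1 : R -> R) (f2 ft : R),
     [/\ \forall z \near q, is_derive (z : R) 1 (phi^~ t) (f1 z), is_derive q 1 f1 f2,
         is_derive t 1 (phi q) ft &
         forall x, 0 <= x -> 4 * q * f2 + 2 * N%:R * f1 q <= x -> ft <= x `^ m]) ->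
  forall q t, q1 <= q <= q2 -> T1 <= t <= T -> phi q t <= P q t.
Proof.
move=> q01 T01 cphi b1 b2 b0 hphi q t qI tI; rewrite -subr_le0.
apply: (@max_principle R (fun q t => phi q t - P q t) q1 q2 T1 T) => // {q t qI tI}.
- by move=> q t qI tI; apply: cvgB; [exact: cphi|exact: P_cont].
- by move=> t tI; rewrite subr_le0 b1.
- by move=> t tI; rewrite subr_le0 b2.
- by move=> q qI; rewrite subr_le0 (le_trans (b0 q qI))// potential_ge0.
move=> q t qI tI pos qmax.
have T0t : T0 <= t by case/andP: tI => /ltW tI _; exact: le_trans tI.
have pos' : 0 < phi q t.
  by move: pos; rewrite subr_gt0; apply: le_lt_trans; exact: potential_ge0.
have [f1 [f2 [ft [d1 d2 dt hx]]]] := hphi q t qI tI pos'.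
have q12 : q1 < q2 by lra.
have [p1 [p2 hp]] := P_space T0t q01 q12.
have [_ dp2 Lp] := hp q qI.
have dD : is_derive q 1 (fun z => f1 z - p1 z) (f2 - p2 q) by apply: is_deriveB.
have dD1 : \forall z \near q, is_derive (z : R) 1 (fun z => phi z t - P z t) (f1 z - p1 z).
  have : \forall z \near q, z \in `]q1, q2[ by apply: near_in_itvoo; rewrite in_itv.
  apply: filterS2 d1 => z fz; rewrite in_itv/= => /hp[pz _ _].
  by apply: is_deriveB.
have [/eqP e1 e2] := second_derivative_test dD1 dD qmax.
exists (ft - v q t `^ m).
  by have h1 := P_time q t; apply: is_deriveB.
rewrite subr_le0; apply: hx => //.
rewrite -Lp; have -> : p1 q = f1 q by move: e1; rewrite subr_eq0 => /eqP.
have q_gt0 : 0 < q by have := q0_gt0; lra.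
by rewrite lerD2r ler_wpM2l//; [rewrite mulr_ge0// ltW|rewrite -subr_le0].
Qed.

Lemma le0_of_le_div (a K X : R) : (forall x, X <= x -> a <= K / x) -> a <= 0.
Proof.
move=> H; rewrite leNgt; apply/negP => a0.
pose x := Num.max (Num.max X 1) (2 * K / a).
have xX : X <= x by rewrite !le_max lexx.
have x1 : 1 <= x by rewrite !le_max lexx orbT.
have xK : 2 * K / a <= x by rewrite !le_max lexx !orbT.
have := H x xX; rewrite ler_pdivlMr; last by lra.
move: xK; rewrite ler_pdivrMr//.
have : 0 < a * x by rewrite mulr_gt0//; lra.
lra.
Qed.

(* Since [v <= 1], [P_t = v^m <= v = L P]: the potential is a heat subsolution
   and cannot keep the tail [q^(1-N/2)] of a flux coming from infinity. *)
Lemma potential_decay T : T0 <= T -> exists K, forall q, q0 <= q -> P q T <= K / q ^+ N.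
Proof.
move=> T0T; have := q0_gt0; have := NR => NR' q0_gt.
(* [K / q^N] equals the trivial bound [T - T0] at [q0]. Since [L (q^(-N)) = (2 N^2 + 4 N) q^(-N-1)],
   the exponential rate [C] pays for this term when [q >= q0], and also for the linear term below
   because [C q >= 2 N]. *)
pose K := (T - T0) * q0 ^+ N.
pose C := (2 * N%:R ^+ 2 + 4 * N%:R) / q0.
have A0 : 0 < 2 * N%:R ^+ 2 + 4 * N%:R :> R by nra.
have C0 : 0 < C by rewrite divr_gt0.
have K0 : 0 <= K by rewrite mulr_ge0 ?subr_ge0// exprn_ge0// ltW.
pose E := expR (C * (T - T0)).
exists (E * K) => q qq; have q_gt0 : 0 < q by lra.
rewrite -subr_le0; apply: (@le0_of_le_div _ (E * q * (T - T0)) (Num.max q 1)) => x.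
rewrite ge_max => /andP[qx x1]; have x0 : 0 < x by lra.
(* The linear term reaches [T - T0] at the outer boundary [q = x], where only the trivial bound is
   known; letting [x] grow removes it. *)
pose d := (T - T0) / x; have d0 : 0 <= d by rewrite divr_ge0 ?subr_ge0// ltW.
pose phi (q t : R) := expR (C * (t - T0)) * (K / q ^+ N + d * q).
have phi_ge0 z t : q0 <= z -> 0 <= phi z t.
  move=> qz; have z0 : 0 < z by lra.
  rewrite mulr_ge0 ?expR_ge0// addr_ge0//; first by rewrite divr_ge0// exprn_ge0// ltW.
  by rewrite mulr_ge0// ltW.
have exp1 t : T0 <= t -> 1 <= expR (C * (t - T0)).
  by move=> tT; rewrite -expR0 ler_expR mulr_ge0 ?subr_ge0// ltW.
suff : P q T <= phi q T.
  have -> : E * q * (T - T0) / x = E * ((T - T0) / x * q) by field; lra.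
  by rewrite /phi -/E /d mulrDr mulrA; lra.
apply: (@supersolution phi q0 x T) => //; last 2 first.
- by rewrite qq qx.
- by rewrite T0T lexx.
- move=> z t /andP[qz zx] _; have z0 : 0 < z by lra.
  apply: cvgM.
    apply: (@continuous_comp _ _ _ (fun p : R * R => C * (p.2 - T0)) expR); last exact: continuous_expR.
    by apply: cvgM; [exact: cvg_cst|apply: cvgB; [exact: cvg_snd|exact: cvg_cst]].
  apply: cvgD; last by apply: cvgM; [exact: cvg_cst|exact: cvg_fst].
  apply: cvgM; first exact: cvg_cst.
  apply: cvgV; first by rewrite expf_neq0// gt_eqF.
  by apply: (@continuous_comp _ _ _ (fst : R * R -> R) (fun x => x ^+ N)); [exact: cvg_fst|exact: exprn_continuous].
- move=> t /andP[t1 t2]; rewrite (le_trans (potential_le_time _ t1))//.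
  have [e1 g0] := (exp1 t t1, K / q0 ^+ N).
  rewrite /phi /K mulfK ?expf_neq0 ?gt_eqF//.
  have : 0 <= d * q0 by rewrite mulr_ge0// ltW.
  have := exp1 t t1; nra.
- move=> t /andP[t1 t2]; rewrite (le_trans (potential_le_time _ t1))//; first by rewrite (le_trans qq).
  have : 0 <= K / x ^+ N by rewrite divr_ge0// exprn_ge0// ltW.
  have -> : phi x t = expR (C * (t - T0)) * (K / x ^+ N + (T - T0)).
    by rewrite /phi /d divfK// gt_eqF.
  have := exp1 t t1; nra.
- by move=> z /andP[qz _]; exact: phi_ge0.
move=> z t /andP[qz zx] /andP[t1 t2]; have z0 : 0 < z by lra.
pose e := expR (C * (t - T0)).
exists (fun z => e * (- (K * N%:R) / z ^+ N.+1 + d)).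
exists (e * (K * N%:R * N.+1%:R / z ^+ N.+2)), (C * phi z t).
split.
- have : \forall z \near z, 0 < z by exact: lt_nbhsr.
  apply: filterS => y y0; rewrite /phi -/e; derive_rules; first by rewrite expf_neq0// gt_eqF.
  have -> : y ^+ N.-1 = y ^+ N / y by case: (N) N3 => // n _; rewrite exprS /= mulrAC mulfV ?mul1r// gt_eqF.
  by rewrite !exprS; field; rewrite expf_neq0 gt_eqF.
- derive_rules; first by rewrite expf_neq0// gt_eqF.
  by rewrite /= !exprS -natr1; field; rewrite expf_neq0 gt_eqF.
- have he : has_derivative (fun t => expR (C * (t - T0))) t (expR (C * (t - T0)) * C).
    apply: (@has_derivative_comp _ _ _ _ _ expR); last exact: is_derive_expR.
    by derive_rules; ring.
  by rewrite /phi; derive_rules; ring.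
- move=> y yI yL; rewrite (le_trans (powR_le_self yI))// (le_trans yL)//.
  rewrite /phi -/e; have e0 : 0 <= e by exact: expR_ge0.
  have -> : 4 * z * (e * (K * N%:R * N.+1%:R / z ^+ N.+2)) + 2 * N%:R * (e * (- (K * N%:R) / z ^+ N.+1 + d)) =
     e * ((2 * N%:R ^+ 2 + 4 * N%:R) / z * (K / z ^+ N) + 2 * N%:R * d).
    by rewrite !exprS -natr1; field; rewrite expf_neq0 gt_eqF.
  rewrite [leRHS]mulrCA ler_wpM2l// mulrDr lerD//.
    rewrite ler_wpM2r ?divr_ge0 ?exprn_ge0 ?(ltW z0)// /C ler_wpM2l// ?(ltW A0)//.
    by rewrite lef_pV2 ?posrE// ltW.
  rewrite [leRHS]mulrCA [leLHS]mulrC ler_wpM2l//.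
  have : 2 * N%:R ^+ 2 + 4 * N%:R <= C * z.
    by rewrite /C mulrAC ler_pdivlMr// ler_wpM2l// ltW.
  nra.
Qed.

Let s : R := N%:R / 2.
Let y (q : R) : R := q `^ (1 - s).
Let s1 : 3%:R / 2 <= s. Proof. by have := NR; rewrite /s; lra. Qed.

Lemma powR_sqr_le_inv (x : R) : 1 <= x -> (x ^+ 2) `^ (1 - s) <= x^-1.
Proof.
move=> x1; have x0 : 0 <= x by lra.
rewrite -powR_mulrn// -powRrM -powR_inv1// ler_powR//.
by have := s1; lra.
Qed.

(** Beyond the support of [v(.,T)] the equation is [L P = 0]: the flux [q^s P'] is constant, and one
    more integration gives the two-parameter form. *)
Lemma potential_tail B T : q0 <= B -> T0 <= T -> (forall q, B < q -> v q T = 0) ->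
  exists c k, forall q, B < q -> P q T = c + k * y q.
Proof.
move=> qB T0T vB; have := q0_gt0 => q0_gt; have := s1 => s1'.
pose p := P^~ T.
have dp q : B < q -> is_derive q 1 p (derive1 p q) /\
    is_derive q 1 (derive1 p) (- s * derive1 p q / q).
  move=> Bq; have Bq1 : B < q + 1 by lra.
  have [p1 [p2 hp]] := P_space T0T qB Bq1.
  have qI : B < q < q + 1 by lra.
  (* The witness [p1] depends on the chosen interval; [derive1 p] is one function for all of
     them. *)
  have e z : B < z < q + 1 -> p1 z = derive1 p z.
    by move=> /hp[[_ <-] _ _]; rewrite derive1E.
  have [d1 d2] := hp q qI; rewrite (vB q Bq) (e q qI) => L.
  split; first by rewrite -e.
  have -> : - s * derive1 p q / q = p2 q.
    have q_gt0 : 0 < q by lra.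
    have -> : p2 q = - (2 * N%:R * derive1 p q) / (4 * q).
      apply/(mulfI (_ : 4 * q != 0)); first by rewrite mulf_neq0// gt_eqF.
      rewrite [RHS]mulrC divfK; last by rewrite mulf_neq0// gt_eqF.
      by move: L; lra.
    by rewrite /s; field; lra.
  apply: near_eq_is_derive d2.
  have : \forall z \near q, z \in `]B, (q + 1)[ by apply: near_in_itvoo; rewrite in_itv.
  by apply: filterS => z; rewrite in_itv/= => /e.
pose b := B + 1.
have b0 : 0 < b by rewrite /b; lra.
pose k := b `^ s * derive1 p b / (1 - s).
have constant (h : R -> R) : (forall q, B < q -> is_derive q 1 h 0) -> forall q, B < q -> h q = h b.
  move=> dh q Bq; have [qb|/ltW bq] := leP q b.
    by apply: is_derive0_eq => // x xI; apply: dh; lra.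
  by apply/esym; apply: is_derive0_eq => // x xI; apply: dh; move: xI; rewrite /b; lra.
have flux q : B < q -> q `^ s * derive1 p q = (1 - s) * k.
  move=> Bq; rewrite /k mulrCA divff ?mulr1; last by lra.
  apply: (constant (fun q => q `^ s * derive1 p q)) => // x Bx.
  have x0 : 0 < x by lra.
  have [_ h2] := dp x Bx; derive_rules => //.
  have -> : x `^ s = x * x `^ (s - 1).
    by rewrite -{2}(powRr1 (ltW x0)) (@powR_mulE _ x _ _ s)//; ring.
  by field; lra.
exists (p b - k * y b), k => q Bq.
suff /(constant _)/(_ q Bq) e : forall q, B < q -> is_derive q 1 (fun q => p q - k * y q) 0.
  by rewrite -/(p q) -e; ring.
move=> x Bx; have x0 : 0 < x by lra.
have [h1 _] := dp x Bx; rewrite /y; derive_rules => //.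
rewrite mulr1 mul0r add0r; have -> : 1 - s - 1 = - s by ring.
have := flux x Bx => /(congr1 (fun z => x `^ (- s) * z)).
rewrite mulrA (@powR_mulE _ x _ _ 0)//; last by ring.
by rewrite powRr0 mul1r => ->; ring.
Qed.

(** The tail is squeezed between [0] and [K q^(-N)]. Sampling at [q = x^2] with [x] large yields
    first [c = 0], then [k = 0]. *)
Lemma potential_support B T : q0 <= B -> T0 <= T -> (forall q, B < q -> v q T = 0) ->
  forall q, B < q -> P q T = 0.
Proof.
move=> qB T0T vB; have := q0_gt0 => q0_gt; have := s1 => s1'.
have [c [k E]] := potential_tail qB T0T vB.
have [K HK] := potential_decay T0T.
pose X := Num.max 1 (B + 1).
have hX x : X <= x -> [/\ 1 <= x, 0 < x & B < x ^+ 2].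
  rewrite ge_max => /andP[x1 xB]; split => //; first by lra.
  have : x <= x ^+ 2 by rewrite expr2; nra.
  lra.
have bounds x : X <= x -> 0 <= c + k * y (x ^+ 2) /\ c + k * y (x ^+ 2) <= K / (x ^+ 2) ^+ N.
  move=> /hX[x1 x0 Bx]; rewrite -E//; split; first exact: potential_ge0.
  by apply: HK; lra.
have K0 : 0 <= K.
  have [h1 h2] := bounds X (lexx _); have := le_trans h1 h2.
  have [x1 x0 _] := hX X (lexx _).
  by rewrite pmulr_lge0// invr_gt0 !exprn_gt0.
have invle (x : R) n : 1 <= x -> (0 < n)%N -> (x ^+ n)^-1 <= x^-1.
  case: n => [|n] x1 // _; rewrite lef_pV2 ?posrE ?exprn_gt0//; [|lra..].
  rewrite exprS ler_peMr//; [lra|exact: exprn_ege1].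
have N2 : (0 < 2 * N)%N by case: (N) N3.
have c0 : c = 0.
  apply/eqP; rewrite -normr_eq0 eq_le normr_ge0 andbT.
  apply: (@le0_of_le_div _ (`|k| + K) X) => x Xx.
  have [x1 x0 Bx] := hX x Xx; have [h1 h2] := bounds x Xx.
  have ky : `|k * y (x ^+ 2)| <= `|k| / x.
    rewrite normrM ler_wpM2l// ger0_norm ?powR_ge0//; exact: powR_sqr_le_inv.
  have Kx : K / (x ^+ 2) ^+ N <= K / x by rewrite -exprM ler_wpM2l// invle.
  rewrite mulrDl; move: ky; rewrite ler_norml => /andP[k1 k2].
  have Kx0 : 0 <= K / x by rewrite divr_ge0// ltW.
  have kx0 : 0 <= `|k| / x by rewrite divr_ge0// ltW.
  by rewrite ler_norml; apply/andP; split; lra.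
(* Here [y (x^2) = x^(2-N)], so the decay bound reads [k <= K x^(-N-2)]. *)
have k0 : k = 0.
  apply/eqP; rewrite eq_le; apply/andP; split; last first.
    have [h1 _] := bounds X (lexx _); have [x1 x0 _] := hX X (lexx _).
    move: h1; rewrite c0 add0r pmulr_lge0// /y powR_gt0// exprn_gt0//.
  apply: (@le0_of_le_div _ K X) => x Xx.
  have [x1 x0 Bx] := hX x Xx; have [_] := bounds x Xx; rewrite c0 add0r => h2.
  have yx : (x ^+ (N - 2))^-1 = y (x ^+ 2).
    rewrite -powR_invn ?(ltW x0)// /y -powR_mulrn ?(ltW x0)// -powRrM; congr (_ `^ _).
    by rewrite natrB; [rewrite /s; field|case: (N) N3 => [|[|]]].
  have xN : 0 < x ^+ (N - 2) by rewrite exprn_gt0.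
  move: h2; rewrite -yx ler_pdivrMr// => /le_trans; apply.
  have -> : K / (x ^+ 2) ^+ N * x ^+ (N - 2) = K * (x ^+ (N + 2))^-1.
    have nE : (2 * N)%N = ((N + 2) + (N - 2))%N by rewrite -addnA subnKC ?addnn ?mul2n// ltnW.
    by rewrite -exprM nE exprD invfM mulrA divfK// gt_eqF.
  by rewrite ler_wpM2l// invle// addn2.
by move=> q Bq; rewrite E// c0 k0 mul0r addr0.
Qed.

(** [P q] is nondecreasing in time and vanishes at both [T0] and [T], so its derivative [v^m]
    vanishes in between. *)
Lemma potential_zero_density q T t : P q T = 0 -> T0 < t < T -> v q t = 0.
Proof.
move=> PT tI; have PE : P q T0 = P q T by rewrite PT P_init.
have := antiderivative_eq_ge0 (fun x => powR_ge0 (v q x) m) (P_time q) PE tI.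
exact: powR_eq0_eq0.
Qed.

Lemma potential_eventually_zero T : T0 <= T -> exists B, forall q, B < q -> P q T = 0.
Proof.
move=> T0T; have [B hB] := v_supp T0T; exists (Num.max B q0).
by apply: potential_support; rewrite ?le_max ?lexx ?orbT// => q; rewrite gt_max => /andP[/ltW/hB].
Qed.

Lemma y_gt0 q : 0 < q -> 0 < y q.
Proof. exact: powR_gt0. Qed.

Lemma y_derivatives q : 0 < q -> is_derive q 1 y ((1 - s) * (y q / q)).
Proof.
move=> q_gt0; rewrite /y; have h := @has_derivative_id R q; derive_rules => //.
rewrite mulr1; congr (_ * _); apply/(mulIf (_ : q != 0)); first by rewrite gt_eqF.
by rewrite divfK ?gt_eqF// -[X in _ * X](powRr1 (ltW q_gt0)) (@powR_mulE _ q _ _ (1 - s))//; ring.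
Qed.

Lemma y_derivatives2 (a : R) q : 0 < q ->
  is_derive q 1 (fun z => a * ((1 - s) * (y z / z))) (a * ((1 - s) * (- s * (y q / q ^+ 2)))).
Proof.
move=> q_gt0; have h := y_derivatives q_gt0; derive_rules; first by rewrite gt_eqF.
by field; rewrite gt_eqF.
Qed.

(** [y] solves [L y = 0], so the comparison condition only involves [x <= 0], that is [x = 0]. The
    inner boundary uses the trivial bound, the outer one the vanishing of [P] far away. *)
Lemma potential_upper q t : q0 <= q -> T0 <= t -> P q t <= (t - T0) * (y q / y q0).
Proof.
move=> qq tT; have := q0_gt0 => q0_gt; have y0 := y_gt0 q0_gt.
have [B hB] := potential_eventually_zero tT.
pose q2 := Num.max q B + 1.
have q2q : q < q2 by rewrite /q2 ltr_pwDr// le_max lexx.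
have q2B : B < q2 by rewrite /q2 ltr_pwDr// le_max lexx orbT.
apply: (@supersolution (fun q t => (t - T0) * (y q / y q0)) q0 q2 t) => //; last 2 first.
- by rewrite qq ltW.
- by rewrite tT lexx.
- move=> z r /andP[z1 _] _; have z0 : 0 < z by lra.
  apply: cvgM; first by apply: cvgB; [exact: cvg_snd|exact: cvg_cst].
  apply: cvgM; last exact: cvg_cst.
  by apply: (@continuous_comp _ _ _ (fst : R * R -> R) y); [exact: cvg_fst|exact: powR_continuous_pos].
- move=> r /andP[r1 r2]; rewrite divff ?gt_eqF// mulr1.
  exact: potential_le_time.
- move=> r /andP[r1 r2]; rewrite (le_trans (potential_le _ r2))// hB//.
  by rewrite mulr_ge0 ?subr_ge0// divr_ge0 ?powR_ge0.
- by move=> z _; rewrite subrr mul0r.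
move=> z r /andP[z1 z2] /andP[r1 r2]; have z0 : 0 < z by lra.
exists (fun z => (r - T0) / y q0 * ((1 - s) * (y z / z))).
exists ((r - T0) / y q0 * ((1 - s) * (- s * (y z / z ^+ 2)))), (y z / y q0).
split.
- have : \forall z \near z, 0 < z by exact: lt_nbhsr.
  by apply: filterS => x /y_derivatives h; derive_rules; ring.
- exact: y_derivatives2.
- by derive_rules; ring.
- move=> x /andP[x0 _]; rewrite (_ : _ + _ = 0); last by rewrite /s; field; lra.
  move=> x0'; have -> : x = 0 by apply/le_anti/andP.
  by rewrite powR0 ?divr_ge0 ?powR_ge0//; have := m1; lra.
Qed.

(** An exponent of at least two lets the truncated power pass through [0] with zero slope. *)
Lemma is_derive_posX k (x : R) :
  is_derive x 1 (fun x => Num.max x 0 ^+ k.+2) (k.+2%:R * Num.max x 0 ^+ k.+1).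
Proof.
have [x0|x0|->] := ltgtP x 0.
- rewrite expr0n mulr0.
  apply: (@near_eq_is_derive _ _ _ (cst 0)).
  have : \forall z \near x, z < 0 by exact: lt_nbhsl.
  by apply: filterS => z z0; rewrite max_r ?ltW// expr0n.
- apply: (@near_eq_is_derive _ _ _ (fun z : R => z ^+ k.+2)).
    have : \forall z \near x, 0 < z by exact: lt_nbhsr.
    by apply: filterS => z z0; rewrite max_l// ltW.
  by have := @has_derivativeX R (fun z => z) x 1 (has_derivative_id x) k.+2; rewrite mulr1.
- rewrite expr0n mulr0; apply: is_derive_intro => e e0.
  apply/nbhs_ballP; exists (Num.min 1 e); rewrite /= ?lt_min ?ltr01// => z.
  rewrite /ball/= sub0r normrN lt_min => /andP[z1 ze].
  rewrite maxxx expr0n !subr0 mul0r subr0 ger0_norm ?exprn_ge0 ?le_max ?lexx ?orbT//.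
  have [z0|z0] := leP z 0; first by rewrite expr0n mulr_ge0// ltW.
  move: z1 ze; rewrite gtr0_norm// => z1 ze; rewrite exprS mulrC ler_wpM2r ?(ltW z0)//.
  by rewrite exprS (le_trans _ (ltW ze))// ler_piMr ?(ltW z0)// exprn_ile1 ?(ltW z0) ?(ltW z1).
Qed.

(* Travelling front: [z^(j+3)] with [z] affine in [q] and [t]; it starts at
   [q = 2 Q0] and moves by [Q0] during the time [T - T0]. *)
Lemma potential_zero_beyond (j : nat) (e Q0 T : R) :
  e = j.+1%:R * m - j.+2%:R -> 0 <= e -> q0 <= Q0 -> T0 < T ->
  (12 * (j.+3%:R * j.+2%:R) * ((T - T0) * (y Q0 / y q0) / Q0)) `^ m * 3 `^ e <= y Q0 / y q0 ->
  forall q, 3 * Q0 <= q -> P q T = 0.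
Proof.
move=> eE e0 qQ T0T hQ q q3; have := q0_gt0; have := m1 => m1' q0_gt.
pose d := T - T0; have d0 : 0 < d by rewrite subr_gt0.
have Q00 : 0 < Q0 by lra.
pose A := d * (y Q0 / y q0).
have yy0 : 0 < y Q0 / y q0 by rewrite divr_gt0// y_gt0.
have A0 : 0 < A by rewrite mulr_gt0.
(* At [q = Q0] this is at least [1], so [phi >= A], which dominates [potential_upper] there; at
   [t = T] it is nonpositive for [q >= 3 * Q0]. *)
pose aff (q t : R) := 2 + (t - T0) / d - q / Q0.
pose phi (q t : R) := A * Num.max (aff q t) 0 ^+ j.+3.
have [B hB] := potential_eventually_zero (ltW T0T).
pose q2 := Num.max q B + 1.
have q2q : q < q2 by rewrite /q2 ltr_pwDr// le_max lexx.
have q2B : B < q2 by rewrite /q2 ltr_pwDr// le_max lexx orbT.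
have phi_ge0 z t : 0 <= phi z t.
  by rewrite mulr_ge0 ?(ltW A0)// exprn_ge0// le_max lexx orbT.
apply/le_anti; rewrite potential_ge0 ?(ltW T0T)// andbT.
have -> : 0 = phi q T.
  have h3 : 3 <= q / Q0 by rewrite ler_pdivlMr.
  by rewrite /phi max_r ?expr0n ?mulr0// /aff -/d divff ?gt_eqF//; lra.
apply: (@supersolution phi Q0 q2 T) => //; last 2 first.
- by rewrite (ltW q2q) andbT; lra.
- by rewrite (ltW T0T) lexx.
- move=> z t _ _; apply: cvgM; first exact: cvg_cst.
  apply: (@continuous_comp _ _ _ (fun p : R * R => aff p.1 p.2) (fun x => Num.max x 0 ^+ j.+3)).
    apply: cvgB; last by apply: cvgM; [exact: cvg_fst|exact: cvg_cst].
    apply: cvgD; first exact: cvg_cst.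
    by apply: cvgM; [apply: cvgB; [exact: cvg_snd|exact: cvg_cst]|exact: cvg_cst].
  by apply: is_derive_continuous; exact: is_derive_posX.
- move=> t /andP[t1 t2]; rewrite (le_trans (potential_upper qQ t1))//.
  have a1 : 1 <= aff Q0 t.
    rewrite /aff divff ?gt_eqF//; have : 0 <= (t - T0) / d by rewrite divr_ge0 ?subr_ge0// ltW.
    lra.
  rewrite /phi max_l; last by lra.
  rewrite -[leLHS]mulr1 ler_pM ?exprn_ege1//; last by rewrite /A ler_wpM2r ?(ltW yy0)// lerD2r.
  by rewrite mulr_ge0 ?subr_ge0// ltW.
- move=> t /andP[t1 t2]; by rewrite (le_trans (potential_le _ t2))// hB.
move=> z t /andP[z1 z2] /andP[t1 t2]; have z0 : 0 < z by lra.
pose w z := Num.max (aff z t) 0.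
have daff (x : R) : is_derive x 1 (aff^~ t) (- Q0^-1).
  by have h := @has_derivative_id R x; rewrite /aff; derive_rules; ring.
have dpow k (x : R) : is_derive x 1 (fun x => w x ^+ k.+2) (k.+2%:R * w x ^+ k.+1 * (- Q0^-1)).
  exact: (@has_derivative_comp R (aff^~ t) x _ (daff x) (fun x => Num.max x 0 ^+ k.+2) _ (is_derive_posX k (aff x t))).
exists (fun z => A * (j.+3%:R * w z ^+ j.+2 * (- Q0^-1))).
exists (A * (j.+3%:R * (j.+2%:R * w z ^+ j.+1 * (- Q0^-1)) * (- Q0^-1))).
exists (A * (j.+3%:R * w z ^+ j.+2 * d^-1)).
split.
- by apply: filterE => x; have h := dpow j.+1 x; rewrite /phi; derive_rules; ring.
- by have h := dpow j z; derive_rules; ring.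
- have da : is_derive t 1 (aff z) d^-1.
    by have h := @has_derivative_id R t; rewrite /aff; derive_rules; ring.
  have h := (@has_derivative_comp R (aff z) t _ da (fun x => Num.max x 0 ^+ j.+3) _ (is_derive_posX j.+1 (aff z t))).
  by rewrite /phi; derive_rules; rewrite -/(w z); ring.
move=> x /andP[x0 _] xL.
have w0 : 0 <= w z by rewrite /w le_max lexx orbT.
have affle : aff z t <= 3 - z / Q0.
  have : (t - T0) / d <= 1 by rewrite ler_pdivrMr// mul1r lerD2r.
  by rewrite /aff; lra.
(* [12 = 4 * 3]: where the front is positive, [z <= 3 * Q0]. The first-order part of [L phi] is
   nonpositive and is dropped. *)
pose c : R := 12 * (j.+3%:R * j.+2%:R).
have c0 : 0 <= c by rewrite /c !mulr_ge0.
have A0' := ltW A0.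
have Qi : 0 <= Q0^-1 by rewrite invr_ge0 ltW.
have AQ0 : 0 <= A / Q0 by rewrite mulr_ge0.
have wj n : 0 <= w z ^+ n by rewrite exprn_ge0.
have xle : x <= c * (A / Q0) * w z ^+ j.+1.
  have [wz|wz] := eqVneq (w z) 0.
    rewrite wz expr0n mulr0; apply: (le_trans xL); rewrite wz !expr0n.
    by rewrite !(mulr0, mul0r) addr0.
  have apos : 0 < aff z t.
    by rewrite ltNge; apply/negP => h; move: wz; rewrite /w max_r ?eqxx.
  have zQ : z <= 3 * Q0.
    have : z / Q0 <= 3 by lra.
    by rewrite ler_pdivrMr.
  rewrite (le_trans xL)//.
  have -> : 4 * z * (A * (j.+3%:R * (j.+2%:R * w z ^+ j.+1 * (- Q0^-1)) * (- Q0^-1))) =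
    (4 * (j.+3%:R * j.+2%:R) * (A / Q0) * w z ^+ j.+1) * (z / Q0) by field; lra.
  have -> : c * (A / Q0) * w z ^+ j.+1 = (4 * (j.+3%:R * j.+2%:R) * (A / Q0) * w z ^+ j.+1) * 3.
    by rewrite /c; ring.
  have h1 : 0 <= 4 * (j.+3%:R * j.+2%:R) * (A / Q0) * w z ^+ j.+1.
    by do 3 ?[apply: mulr_ge0 => //].
  have h2 : 0 <= A * (j.+3%:R * w z ^+ j.+2 * Q0^-1).
    by do 3 ?[apply: mulr_ge0 => //].
  have h3 : (4 * (j.+3%:R * j.+2%:R) * (A / Q0) * w z ^+ j.+1) * (z / Q0) <=
    (4 * (j.+3%:R * j.+2%:R) * (A / Q0) * w z ^+ j.+1) * 3.
    by rewrite ler_wpM2l// ler_pdivrMr.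
  rewrite !mulrN; have : 0 <= 2 * N%:R * (A * (j.+3%:R * w z ^+ j.+2 * Q0^-1)).
    by rewrite mulr_ge0.
  lra.
have m0 : 0 <= m by lra.
have cA0 : 0 <= c * (A / Q0) by rewrite mulr_ge0// divr_ge0 ?ltW.
(* [L phi] is of order [w^(j+1)], the time derivative of order [w^(j+2)]. With [e >= 0] and
   [w <= 3], the [m]-th power of the former is absorbed by the latter. *)
have wpow : (w z ^+ j.+1) `^ m <= 3 `^ e * w z ^+ j.+2.
  have [->|wz] := eqVneq (w z) 0; first by rewrite !expr0n powR0 ?mulr0//; lra.
  have wp : 0 < w z by rewrite lt_neqAle eq_sym wz.
  have w3 : w z <= 3.
    have : 0 <= z / Q0 by rewrite divr_ge0 ?ltW.
    by rewrite /w ge_max; move: affle; lra.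
  rewrite -!powR_mulrn// -powRrM (_ : j.+1%:R * m = e + j.+2%:R); last by rewrite eE; ring.
  rewrite -(@powR_mulE _ (w z) e j.+2%:R _ wp erefl) ler_wpM2r ?powR_ge0//.
  by rewrite ge0_ler_powR// nnegrE.
have xm : x `^ m <= (c * (A / Q0) * w z ^+ j.+1) `^ m.
  by rewrite ge0_ler_powR// nnegrE mulr_ge0// exprn_ge0.
rewrite (le_trans xm)// powRM// ?exprn_ge0//.
rewrite (@le_trans _ _ ((c * (A / Q0)) `^ m * (3 `^ e * w z ^+ j.+2)))//.
  by rewrite ler_wpM2l// powR_ge0.
rewrite mulrA (@le_trans _ _ (y Q0 / y q0 * w z ^+ j.+2))//.
  by rewrite ler_wpM2r ?exprn_ge0// /c /A.
have -> : A * (j.+3%:R * w z ^+ j.+2 / d) = j.+3%:R * (y Q0 / y q0 * w z ^+ j.+2).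
  by rewrite /A; field; rewrite !gt_eqF// y_gt0.
by rewrite ler_peMl ?ler1n// mulr_ge0 ?exprn_ge0// ltW.
Qed.

Let beta : R := m / (N%:R * (m - 1) + 2).

Let D0 : 0 < N%:R * (m - 1) + 2.
Proof. by rewrite ltr_wpDl// mulr_ge0//; have := m1; lra. Qed.

Let beta0 : 0 < beta.
Proof. by rewrite divr_gt0//; have := m1; lra. Qed.

Let betaD : beta * (N%:R * (m - 1) + 2) = m.
Proof. by rewrite /beta divfK// gt_eqF. Qed.

Lemma potential_front_upper : 0 <= T0 -> exists2 lam : R, 0 < lam &
  forall T, T0 < T -> 1 <= T -> forall q, 3 * (lam * T `^ (2 * beta)) <= q -> P q T = 0.
Proof.
move=> T00; have := q0_gt0; have := m1; have := s1 => s1' m1' q0_gt.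
(* This makes [(j+1)(m-1) > 1], hence [e = (j+1)(m-1) - 1] positive; [m] close to [1] calls for a
   high power. *)
pose j := Num.truncn (m - 1)^-1.
have m10 : 0 < m - 1 by lra.
have jm : 1 < j.+1%:R * (m - 1).
  have h : (m - 1)^-1 < j.+1%:R by apply: truncnS_gt.
  by rewrite -ltr_pdivrMr// mul1r.
pose e := j.+1%:R * m - j.+2%:R.
have e0 : 0 <= e by rewrite /e; move: jm; rewrite -[j.+2]addn1 natrD; lra.
pose c : R := 12 * (j.+3%:R * j.+2%:R).
have c0 : 0 < c by rewrite /c !mulr_gt0.
have y0 : 0 < y q0 by exact: y_gt0.
pose M := (c / y q0) `^ m * 3 `^ e * y q0.
pose lam := Num.max (Num.max 1 q0) M.
have lam1 : 1 <= lam by rewrite !le_max lexx.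
have lamq : q0 <= lam by rewrite !le_max lexx !orbT.
have lamM : M <= lam by rewrite !le_max lexx !orbT.
exists lam; first by lra.
move=> T T0T T1; pose Q0 := lam * T `^ (2 * beta).
have Tpow : 1 <= T `^ (2 * beta).
  by rewrite -[leLHS](powRr0 T) ler_powR// mulr_ge0// (ltW beta0).
have Q0q : q0 <= Q0 by rewrite (le_trans lamq)// /Q0 ler_peMr//; lra.
have Q00 : 0 < Q0 by lra.
apply: (@potential_zero_beyond j e) => //; rewrite -/c.
have T_gt0 : 0 < T by lra.
have dT : 0 < T - T0 by lra.
have yQ : 0 < y Q0 by exact: y_gt0.
(* After bounding [T - T0] by [T], the smallness condition on the front becomes [M T^m <= Q0^ex]. As
   [2 beta ex = m], both sides scale alike in [T], and [lam >= M], [lam >= 1] suffice. *)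
pose ex := 1 + s * (m - 1).
have ex1 : 1 <= ex by rewrite /ex lerDl mulr_ge0//; lra.
have Qex : M * T `^ m <= Q0 `^ ex.
  rewrite /Q0 powRM ?powR_ge0//; last by lra.
  rewrite -powRrM (_ : 2 * beta * ex = m); last by rewrite -[RHS]betaD /ex /s; field.
  rewrite ler_wpM2r ?powR_ge0// (le_trans lamM)//; exact: le1r_powR.
have yQE : y Q0 / Q0 = Q0 `^ (- s).
  apply/(mulIf (_ : Q0 != 0)); first by rewrite gt_eqF.
  by rewrite divfK ?gt_eqF// -[X in _ * X](powRr1 (ltW Q00)) (@powR_mulE _ Q0 _ _ (1 - s))//; ring.
have m0 : 0 <= m by lra.
rewrite (@le_trans _ _ ((c * (T * (y Q0 / y q0) / Q0)) `^ m * 3 `^ e))//.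
  rewrite ler_wpM2r ?powR_ge0// ge0_ler_powR// ?nnegrE.
  - by rewrite mulr_ge0 ?(ltW c0)// divr_ge0 ?(ltW Q00)// mulr_ge0 ?(ltW dT)// divr_ge0 ?ltW.
  - by rewrite mulr_ge0 ?(ltW c0)// divr_ge0 ?(ltW Q00)// mulr_ge0 ?(ltW T_gt0)// divr_ge0 ?ltW.
  rewrite ler_wpM2l ?(ltW c0)// ler_wpM2r ?invr_ge0 ?(ltW Q00)// ler_wpM2r//.
    by rewrite divr_ge0 ?ltW.
  by rewrite gerBl.
have -> : c * (T * (y Q0 / y q0) / Q0) = (c / y q0) * T * Q0 `^ (- s).
  by rewrite -yQE; field; rewrite !gt_eqF.
have cy : 0 <= c / y q0 by rewrite divr_ge0 ?ltW.
have -> : (c / y q0 * T * Q0 `^ (- s)) `^ m = (c / y q0) `^ m * T `^ m * Q0 `^ (- s * m).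
  rewrite (@powRM _ (c / y q0 * T) (Q0 `^ (- s)) m (mulr_ge0 cy (ltW T_gt0)) (powR_ge0 _ _)).
  by rewrite (@powRM _ (c / y q0) T) ?(ltW T_gt0)// -powRrM.
rewrite ler_pdivlMr//.
have -> : (c / y q0) `^ m * T `^ m * Q0 `^ (- s * m) * 3 `^ e * y q0 = M * T `^ m * Q0 `^ (- s * m).
  by rewrite /M; ring.
rewrite (le_trans (ler_wpM2r (powR_ge0 _ _) Qex))// (@powR_mulE _ Q0 _ _ (1 - s))//.
by rewrite /ex; ring.
Qed.

Lemma y_sqr (r : R) : 0 < r -> y (r ^+ 2) = r `^ (2 - N%:R).
Proof.
move=> r0; rewrite /y -powR_mulrn ?ltW// -powRrM; congr (_ `^ _).
by rewrite /s; field.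
Qed.

(** Expanding the square gives the powers [z^(1-s)], [z^(3/2-s)] and [z^(2-s)]; [front1] and
    [front2] are the first and second derivatives taken term by term, without truncation. *)
Let front (a rho z : R) : R := a * (y z * (1 - Num.sqrt z / rho) ^+ 2).
Let front1 (a rho z : R) : R := a * ((1 - s) * (y z / z)
   - 2 / rho * ((3%:R / 2 - s) * (y z * Num.sqrt z / z)) + (2 - s) / rho ^+ 2 * y z).
Let front2 (a rho z : R) : R := a * ((1 - s) * (- s * (y z / z ^+ 2))
   - 2 / rho * ((3%:R / 2 - s) * ((2^-1 - s) * (y z * Num.sqrt z / z ^+ 2)))
   + (2 - s) / rho ^+ 2 * ((1 - s) * (y z / z))).

Lemma sqrt_representation (x : R) : 0 < x -> exists2 r, 0 < r & x = r ^+ 2 /\ Num.sqrt x = r.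
Proof. by move=> x0; exists (Num.sqrt x); rewrite ?sqrtr_gt0// sqr_sqrtr// ltW. Qed.

Lemma front_derive1 (a rho z : R) : 0 < rho -> 0 < z ->
  is_derive z 1 (front a rho) (front1 a rho z).
Proof.
move=> rho0 z0; have h := y_derivatives z0; have h' := @has_derivative_id R z.
rewrite /front; derive_rules => //.
have [r r0 [zE ->]] := sqrt_representation z0.
rewrite /front1 zE sqrtr_sqr gtr0_norm//; move: (y (r ^+ 2)) => Y.
by field; rewrite !gt_eqF.
Qed.

Lemma front_derive2 (a rho z : R) : 0 < rho -> 0 < z ->
  is_derive z 1 (front1 a rho) (front2 a rho z).
Proof.
move=> rho0 z0; have h := y_derivatives z0; have h' := @has_derivative_id R z.
rewrite /front1; derive_rules => //; rewrite ?gt_eqF//.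
have [r r0 [zE ->]] := sqrt_representation z0.
rewrite /front2 zE sqrtr_sqr gtr0_norm//; move: (y (r ^+ 2)) => Y.
by field; rewrite !gt_eqF.
Qed.

(** The leading term [y] contributes nothing to [L]. With [r = sqrt z], the two sides differ by a
    positive multiple of [(N - 3)(rho - r)]; there is equality in dimension three. *)
Lemma front_laplacian (a rho z : R) : 0 < a -> 0 < z -> Num.sqrt z < rho ->
  2 * a * y z / rho ^+ 2 <= 4 * z * front2 a rho z + 2 * N%:R * front1 a rho z.
Proof.
move=> a0 z0; have [r r0 [zE sE]] := sqrt_representation z0; rewrite sE => rrho.
have rho0 : 0 < rho by exact: lt_trans rrho.
have N0 : 0 <= N%:R - 3%:R :> R by rewrite subr_ge0.
have r3 : 0 < rho ^+ 2 * r by rewrite mulr_gt0// exprn_gt0.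
rewrite /front1 /front2 sE zE; have : 0 < y (r ^+ 2) by apply: y_gt0; rewrite exprn_gt0.
move: (y (r ^+ 2)) => Y Y0; rewrite -subr_ge0.
have -> : 4 * r ^+ 2 * (a * ((1 - s) * (- s * (Y / (r ^+ 2) ^+ 2)) -
    2 / rho * ((3%:R / 2 - s) * ((2^-1 - s) * (Y * r / (r ^+ 2) ^+ 2))) +
    (2 - s) / rho ^+ 2 * ((1 - s) * (Y / r ^+ 2)))) +
   2 * N%:R * (a * ((1 - s) * (Y / r ^+ 2) -
    2 / rho * ((3%:R / 2 - s) * (Y * r / r ^+ 2)) + (2 - s) / rho ^+ 2 * Y)) -
   2 * a * Y / rho ^+ 2 = 2 * a * Y / (rho ^+ 2 * r) * ((N%:R - 3%:R) * (rho - r)).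
  by rewrite /s; field; rewrite !gt_eqF.
apply: mulr_ge0; last by apply: mulr_ge0 => //; rewrite subr_ge0 ltW.
by apply: divr_ge0; apply: ltW => //; rewrite !mulr_gt0.
Qed.

(** After division by [A y], the bound [y(z) >= rho^(2-N)] for [sqrt z < rho] leaves the factor
    [t^m rho^(-D)], which is [eps^(-D)] because [beta D = m]. The time variable cancels, and
    smallness of [eps] decides. *)
Lemma front_time_bound (A t z eps : R) : 0 < A -> 0 < t -> 0 < z -> 0 < eps ->
  Num.sqrt z < eps * t `^ beta ->
  (1 + 2 * beta) * eps `^ (N%:R * (m - 1) + 2) <= 2 `^ m * A `^ (m - 1) ->
  A * y z * (1 + 2 * beta) <= (2 * (A * t) * y z / (eps * t `^ beta) ^+ 2) `^ m.
Proof.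
move=> A0 t0 z0 eps0; set rho := eps * t `^ beta; set D := N%:R * (m - 1) + 2.
have [r r0 [zE sE]] := sqrt_representation z0; rewrite sE => rrho epsD.
have rho0 : 0 < rho by exact: lt_trans rrho.
have m1' := m1; have m0 : 0 <= m by lra.
have yz0 : 0 < y z by exact: y_gt0.
have rhoD : rho `^ D = eps `^ D * t `^ m.
  by rewrite /rho powRM ?powR_ge0 ?(ltW eps0)// -powRrM betaD.
have Yrho : rho `^ ((2 - N%:R) * (m - 1)) <= y z `^ (m - 1).
  rewrite zE y_sqr// -powRrM.
  have -> : (2 - N%:R) * (m - 1) = - ((N%:R - 2) * (m - 1)) by ring.
  rewrite !powRN lef_pV2 ?posrE ?powR_gt0// ge0_ler_powR ?nnegrE ?(ltW r0) ?(ltW rho0) ?(ltW rrho)//.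
  by rewrite mulr_ge0//; have := NR; lra.
have -> : 2 * (A * t) * y z / rho ^+ 2 = 2 * A * t * y z * rho `^ (- 2).
  by have := @powR_invn R rho 2 (ltW rho0) => ->; rewrite mulrA.
have A2 : 0 <= 2 * A by rewrite mulr_ge0// ltW.
have A3 : 0 <= 2 * A * t by rewrite mulr_ge0// ltW.
have A4 : 0 <= 2 * A * t * y z by rewrite mulr_ge0// ltW.
rewrite (powRM _ A4 (powR_ge0 _ _)) (powRM _ A3 (ltW yz0)) (powRM _ A2 (ltW t0)).
rewrite (powRM _ _ (ltW A0))//.
have -> : y z `^ m = y z * y z `^ (m - 1) by rewrite mulr_powRB1 ?(ltW yz0)//; lra.
have -> : A `^ m = A * A `^ (m - 1) by rewrite mulr_powRB1 ?(ltW A0)//; lra.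
have e1 : eps `^ D * (t `^ m * rho `^ (- 2 * m) * rho `^ ((2 - N%:R) * (m - 1))) = 1.
  rewrite !mulrA -rhoD (@powR_mulE _ rho _ _ (D - 2 * m))//; last by ring.
  by rewrite (@powR_mulE _ rho _ _ 0) ?powRr0// /D; ring.
have eD : 0 < eps `^ D by rewrite powR_gt0.
pose Z := t `^ m * rho `^ (- 2 * m) * y z `^ (m - 1).
have Z1 : 1 <= eps `^ D * Z.
  rewrite -e1 /Z; apply: ler_wpM2l; first exact: ltW.
  by apply: ler_wpM2l => //; rewrite mulr_ge0 ?powR_ge0.
rewrite -powRrM.
have -> : 2 `^ m * (A * A `^ (m - 1)) * t `^ m * (y z * y z `^ (m - 1)) * rho `^ (- 2 * m) =
   A * y z * (2 `^ m * A `^ (m - 1) * Z) by rewrite /Z; ring.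
apply: ler_wpM2l; first by rewrite mulr_ge0 ?ltW.
have Z0 : 0 <= Z by rewrite !mulr_ge0 ?powR_ge0.
rewrite (le_trans _ (ler_wpM2r Z0 epsD))// -mulrA ler_peMr//.
by have := beta0; lra.
Qed.

(* The subsolution [A t y (1 - sqrt q / (eps t^beta))_+^2]: its Laplacian is at
   least [2 A t y / (eps t^beta)^2], which for small [eps] beats its time
   derivative by homogeneity. *)
Lemma potential_front_lower (T2 c0 : R) : T0 <= T2 -> 0 < T2 -> 0 < c0 ->
  (forall t, T2 <= t -> c0 * t <= P q0 t) ->
  exists2 eps : R, 0 < eps &
  forall t q, T2 <= t -> q0 <= q -> Num.sqrt q < eps * t `^ beta -> 0 < P q t.
Proof.
move=> T02 T20 c00 hP0; have := q0_gt0; have := NR; have := m1; have := s1.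
move=> s1' m1' NR' q0_gt; have y0 : 0 < y q0 by exact: y_gt0.
have r00 : 0 < Num.sqrt q0 by rewrite sqrtr_gt0.
(* Normalised so that [A t y(q0) = c0 t], the known lower bound at the inner boundary. *)
pose A := c0 / y q0; have A0 : 0 < A by rewrite divr_gt0.
pose D : R := N%:R * (m - 1) + 2.
have Nm0 : 0 <= N%:R * (m - 1) by rewrite mulr_ge0 ?subr_ge0 ?(ltW m1').
have D1 : 1 <= D by rewrite /D; lra.
have b0 := beta0.
pose G := 2 `^ m * A `^ (m - 1) / (1 + 2 * beta).
have G0 : 0 < G by rewrite divr_gt0 ?mulr_gt0 ?powR_gt0//; lra.
(* [eps <= 1] gives [eps^D <= eps], and [eps <= G] then yields the condition of [front_time_bound].
   The third bound keeps the front at time [T2] within radius [sqrt q0], so [phi] starts from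
   zero. *)
pose eps := Num.min (Num.min 1 G) (Num.sqrt q0 / T2 `^ beta).
have T2b : 0 < T2 `^ beta by rewrite powR_gt0.
have eps0 : 0 < eps by rewrite !lt_min ltr01 G0 divr_gt0.
have eps1 : eps <= 1 by rewrite !ge_min lexx.
have epsG : eps <= G by rewrite !ge_min lexx !orbT.
have epsq : eps * T2 `^ beta <= Num.sqrt q0.
  by rewrite -ler_pdivlMr// !ge_min lexx !orbT.
have epsD : (1 + 2 * beta) * eps `^ D <= 2 `^ m * A `^ (m - 1).
  rewrite mulrC -ler_pdivlMr; last by lra.
  by rewrite -/G (le_trans _ epsG)// ge1r_powR// eps0.
exists eps => // T q T2T qq qT.
pose rad (t : R) := eps * t `^ beta.
pose phi (q t : R) := A * t * (y q * Num.max (1 - Num.sqrt q / rad t) 0 ^+ 2).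
have rad0 t : 0 < t -> 0 < rad t by move=> t0; rewrite mulr_gt0// powR_gt0.
have q_gt0 : 0 < q by lra.
pose q2 := Num.max q (rad T ^+ 2) + 1.
have q2q : q < q2 by rewrite /q2 ltr_pwDr// le_max lexx.
have q2r : rad T ^+ 2 < q2 by rewrite /q2 ltr_pwDr// le_max lexx orbT.
have T_gt0 : 0 < T by lra.
apply: (@lt_le_trans _ _ (phi q T)).
  apply: mulr_gt0; first exact: mulr_gt0.
  apply: mulr_gt0; first exact: y_gt0.
  rewrite exprn_gt0// lt_max subr_gt0.
  by rewrite ltr_pdivrMr ?rad0// mul1r qT.
have phi0 z t : 0 < t -> rad t <= Num.sqrt z -> phi z t = 0.
  move=> t0 rz; rewrite /phi max_r ?expr0n ?mulr0//.
  by rewrite subr_le0 ler_pdivlMr ?rad0// mul1r.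
apply: (@subsolution phi q0 q2 T2 T) => //; last 2 first.
- by rewrite qq (ltW q2q).
- by rewrite T2T lexx.
- move=> z t /andP[z1 _] /andP[t1 _]; have z0 : 0 < z by lra.
  have t0 : 0 < t by lra.
  apply: cvgM; first by apply: cvgM; [exact: cvg_cst|exact: cvg_snd].
  apply: cvgM.
    by apply: (@continuous_comp _ _ _ (fst : R * R -> R) y); [exact: cvg_fst|exact: powR_continuous_pos].
  apply: (@continuous_comp _ _ _ (fun p : R * R => 1 - Num.sqrt p.1 / rad p.2) (fun x => Num.max x 0 ^+ 2)).
    apply: cvgB; first exact: cvg_cst.
    apply: cvgM.
      by apply: (@continuous_comp _ _ _ (fst : R * R -> R) Num.sqrt); [exact: cvg_fst|exact: sqrt_continuous].
    apply: cvgV; first by rewrite gt_eqF// rad0.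
    apply: cvgM; first exact: cvg_cst.
    by apply: (@continuous_comp _ _ _ (snd : R * R -> R) (fun t => t `^ beta)); [exact: cvg_snd|exact: powR_continuous_pos].
  by apply: is_derive_continuous; exact: is_derive_posX.
- move=> t /andP[t1 _]; rewrite (le_trans _ (hP0 t t1))//.
  have t0 : 0 < t by lra.
  have -> : c0 * t = A * t * (y q0 * 1) by rewrite /A; field; rewrite gt_eqF.
  apply: ler_wpM2l; first by rewrite ltW// mulr_gt0.
  apply: ler_wpM2l; first exact: ltW.
  rewrite exprn_ile1// ?le_max ?lexx ?orbT// ge_max ler01 andbT gerBl.
  by rewrite divr_ge0 ?sqrtr_ge0// ltW// rad0.
- move=> t /andP[t1 t2]; have t0 : 0 < t by lra.
  rewrite phi0//; first by apply: potential_ge0; lra.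
  have rT : rad t <= rad T.
    by rewrite ler_wpM2l ?(ltW eps0)// ge0_ler_powR ?nnegrE ?(ltW b0)//; lra.
  rewrite (le_trans rT)// -(ger0_norm (ltW (rad0 T T_gt0))) -sqrtr_sqr ler_wsqrtr//.
  exact: ltW.
- move=> z /andP[z1 _]; rewrite phi0//.
  by rewrite (le_trans epsq)// ler_wsqrtr.
move=> z t /andP[z1 z2] /andP[t1 t2] pos; have z0 : 0 < z by lra.
have t0 : 0 < t by lra.
have rt := rad0 t t0.
have zr : Num.sqrt z < rad t.
  by rewrite ltNge; apply/negP => h; move: pos; rewrite phi0// ltxx.
pose a := A * t; have a0 : 0 < a by rewrite mulr_gt0.
pose rho := rad t.
(* With [xi = sqrt z / rho], the motion of the radius contributes [2 beta (1 - xi) xi], hence the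
   factor [1 + 2 beta] in the bound on [ft]. *)
pose ft := A * y z * ((1 - Num.sqrt z / rho) ^+ 2 + 2 * (1 - Num.sqrt z / rho) * (Num.sqrt z / rho * beta)).
exists (front1 a rho), (front2 a rho z), ft; split.
- have near_z : \forall x \near z, x \in `]0, (rho ^+ 2)[.
    apply: near_in_itvoo; rewrite in_itv/= z0/= -(sqr_sqrtr (ltW z0)) /rho.
    by rewrite ltr_pXn2r// nnegrE ?sqrtr_ge0// ltW.
  apply: filterS near_z => x; rewrite in_itv/= => xI; have /andP[x0 _] := xI.
  apply: near_eq_is_derive (front_derive1 a rt x0).
  have : \forall w \near x, w \in `]0, (rho ^+ 2)[ by apply: near_in_itvoo; rewrite in_itv.
  apply: filterS => w; rewrite in_itv/= => /andP[w0 wr]; rewrite /phi max_l//.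
  rewrite subr_ge0 ler_pdivrMr// mul1r -(ger0_norm (ltW rt)) -sqrtr_sqr ler_wsqrtr//.
  exact: ltW.
- exact: front_derive2.
- have dr : is_derive t 1 rad (rad t * beta / t).
    rewrite /rad; have h' := @has_derivative_id R t; derive_rules => //.
    have -> : t `^ (beta - 1) = t `^ beta / t.
      apply/(mulIf (_ : t != 0)); first by rewrite gt_eqF.
      by rewrite divfK ?gt_eqF// -[X in _ * X](powRr1 (ltW t0)) (@powR_mulE _ t _ _ beta)//; ring.
    by field; rewrite gt_eqF.
  have crad : {for t, continuous rad} := is_derive_continuous dr.
  apply: (@near_eq_is_derive _ _ _ (fun t => A * t * (y z * (1 - Num.sqrt z / rad t) ^+ 2))).
    have n1 : \forall w \near t, 0 < w by exact: lt_nbhsr.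
    have n2 : \forall w \near t, Num.sqrt z < rad w by exact: (cvgr_gt (rad t) crad).
    apply: filterS2 n1 n2 => w w0 wr; rewrite /phi max_l//.
    by rewrite subr_ge0 ler_pdivrMr ?rad0// mul1r ltW.
  have h' := @has_derivative_id R t; derive_rules; rewrite ?gt_eqF//.
  by rewrite /ft /rho; field; rewrite !gt_eqF.
move=> x x0 Lx; have rho0 : 0 < rho by [].
have yz0 : 0 < y z by exact: y_gt0.
have L1 := le_trans (front_laplacian a0 z0 zr) Lx.
have F1 : ft <= A * y z * (1 + 2 * beta).
  rewrite /ft; apply: ler_wpM2l; first by rewrite mulr_ge0 ?ltW.
  have xi0 : 0 <= Num.sqrt z / rho by rewrite divr_ge0 ?sqrtr_ge0// ltW.
  have xi1 : Num.sqrt z / rho <= 1 by rewrite ler_pdivrMr// mul1r ltW.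
  move: (Num.sqrt z / rho) xi0 xi1 => xi xi0 xi1.
  have h1 : (1 - xi) ^+ 2 <= 1 by rewrite exprn_ile1//; lra.
  have h2 : (1 - xi) * xi <= 1 by nra.
  have h3 : 2 * (1 - xi) * (xi * beta) = 2 * beta * ((1 - xi) * xi) by ring.
  have h4 : 2 * beta * ((1 - xi) * xi) <= 2 * beta * 1 by rewrite ler_wpM2l// mulr_ge0// ltW.
  by rewrite h3; lra.
have m0 : 0 <= m by lra.
have g0 : 0 <= 2 * a * y z / rho ^+ 2.
  by rewrite divr_ge0 ?exprn_ge0 ?(ltW rho0)// mulr_ge0 ?(ltW yz0)// mulr_ge0 ?(ltW a0).
rewrite (le_trans F1)// (le_trans (front_time_bound A0 t0 z0 eps0 zr epsD))//.
by rewrite ge0_ler_powR ?nnegrE.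
Qed.

End Exterior.

(** * From uniform convergence of [u] to the two-sided bound on the free boundary *)

Section Final.
Context {R : realType}.

Lemma uniform_cvg_pinfty_lt (T : choiceType) (F : R -> T -> R) (G : T -> R) (e : R) :
  {uniform, F @ +oo --> G} -> 0 < e ->
  exists M : R, forall t x, M <= t -> `|F t x - G x| < e.
Proof.
move=> cF e0.
pose E : set (R * R) := [set p | ball p.1 e p.2].
have entE : entourage E by exists e.
have : nbhs (G : {uniform T -> R}) [set h | forall x, setT x -> E (G x, h x)].
  by apply/uniform_nbhs; exists E; split.
move=> /cF [M [_ MF]]; exists (M + 1) => t x Mt.
have := MF t _ x I; rewrite /E /= /ball /= distrC; apply.
by rewrite (lt_le_trans _ Mt)// ltrDl.
Qed.

Lemma pinfty_cvg_lt (U : R -> R) (e : R) : U r @[r --> +oo] --> (0 : R) -> 0 < e ->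
  exists M, forall r, M <= r -> U r < e.
Proof.
move=> cU e0; have /cvgr_lt/(_ e e0)[M [_ MF]] := cU; exists (M + 1) => r Mr.
by apply: MF; rewrite (lt_le_trans _ Mr)// ltrDl.
Qed.

End Final.

Unset Implicit Arguments.

Theorem theorem9p2 (R : realType) (N : nat) (m : R) (f : R -> R) (theta : R)
    (u0 : R -> R) (u : 'rV[R]_N -> R -> R) (U b : R -> R)
    (hN : (3 <= N)%N) (hm : 1 < m)
    (hf : assumptionA N m f theta)
    (hu0 : classX m u0)
    (hu : transition_solution m f u0 u)
    (hU : ground_state N m f theta U)
    (hconv : {uniform, (fun t x => u x t) @ +oo -->
                (fun x : 'rV[R]_N => U (enorm x))})
    (hb : free_boundary_radius u b) :
  exists cU CU T : R,
    [/\ 0 < cU, 0 < CU, 0 < T &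
        forall t, T <= t ->
          cU * t `^ (m / (N%:R * (m - 1) + 2)) <= b t
          <= CU * t `^ (m / (N%:R * (m - 1) + 2))].
Proof.
case: hu => hw _ _.
have [/andP[th0 th1] [_ _ _ f0 _] _ _] := hf.
have [U_pos _ _ _ U_lim] := hU.
have N0 : (0 < N)%N by case: (N) hN.
(* One half for the decay of [U], one half for the distance from [u] to [U]: together [u <= theta]
   far out at late times. *)
have th20 : 0 < theta / 2 by rewrite divr_gt0.
have [R1 hR1] := pinfty_cvg_lt U_lim th20.
have [M1 hM1] := uniform_cvg_pinfty_lt hconv th20.
pose T1 := Num.max M1 0; pose T0 := T1 + 1.
have T10 : 0 <= T1 by rewrite le_max lexx orbT.
have T1T0 : T1 < T0 by rewrite /T0; lra.
have T0_gt0 : 0 < T0 by lra.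
(* Including [b T0] gives [v(., T0) = 0] for [q >= q0], so the initial term disappears and [L P = v]
   there. *)
pose rho := Num.max (Num.max R1 (b T0)) 1.
have rho0 : 0 < rho by rewrite lt_max ltr01 orbT.
have rhoR : R1 <= rho by rewrite !le_max lexx.
have rhob : b T0 <= rho by rewrite !le_max lexx !orbT.
have small x t : T1 <= t -> rho <= enorm x -> u x t <= theta.
  move=> t1 xr; have M1t : M1 <= t by apply: le_trans t1; rewrite le_max lexx.
  have := hM1 t x M1t; have := hR1 _ (le_trans rhoR xr).
  by rewrite ltr_norml => ? /andP[? ?]; lra.
pose v := profile u.
pose q0 := rho ^+ 2; have q00 : 0 < q0 by rewrite exprn_gt0.
have vE q t : 0 <= q -> 0 <= t -> exists2 x : 'rV[R]_N, v q t = u x t & enorm x = Num.sqrt q.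
  move=> q_ge0 t_ge0; exists (Num.sqrt q *: axis N); first by rewrite /v /profile max_l.
  by rewrite enormE sqnorm_axis// sqr_sqrtr.
have v_ge0 : forall q t, 0 <= v q t by exact: (profile_ge0 hw).
have rhoq q : q0 <= q -> rho <= Num.sqrt q.
  by move=> qq; rewrite -(ger0_norm (ltW rho0)) -sqrtr_sqr ler_wsqrtr.
have v_out q t : 0 < t -> 0 <= q -> b t <= Num.sqrt q -> v q t = 0.
  move=> t0 q_ge0 bq; have [x xE xq] := vE q t q_ge0 (ltW t0).
  apply/le_anti; rewrite v_ge0 andbT leNgt; apply/negP => pos.
  have : [set x | 0 < u x t] x by rewrite /= -xE.
  by rewrite hb//= xq ltNge bq.
have v_in q t : 0 < t -> 0 <= q -> v q t = 0 -> b t <= Num.sqrt q.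
  move=> t0 q_ge0 vq; have [x xE xq] := vE q t q_ge0 (ltW t0).
  rewrite -xq leNgt; apply/negP => xb.
  have : [set x | enorm x < b t] x by [].
  by rewrite -hb//= -xE vq ltxx.
have v_le1 q t : q0 <= q -> T0 <= t -> v q t <= 1.
  move=> qq tt; have q_ge0 : 0 <= q by lra.
  have t_ge0 : 0 <= t by lra.
  have [x -> xq] := vE q t q_ge0 t_ge0.
  have : u x t <= theta by apply: small; [lra|rewrite xq rhoq].
  lra.
have [P [P_init P_time P_cont P_sp]] :=
  potential_exists hN hm hw T10 T1T0 rho0 f0 small.
have v_init q : q0 <= q -> v q T0 = 0.
  move=> qq; apply: v_out => //; first by lra.
  exact: le_trans (rhoq q qq).
have P_space t a c : T0 <= t -> q0 <= a -> a < c -> exists p1 p2 : R -> R,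
    forall q, a < q < c ->
    [/\ is_derive q 1 (P^~ t) (p1 q), is_derive q 1 p1 (p2 q) &
        4 * q * p2 q + 2 * N%:R * p1 q = v q t].
  move=> tt qa ac; have [p1 [p2 hp]] := P_sp t a c tt qa ac.
  exists p1, p2 => q qI; have [d1 d2 e] := hp q qI; split=> //.
  by rewrite e -/v v_init ?subr0//; lra.
have v_supp t : T0 <= t -> exists B, forall q, B <= q -> v q t = 0.
  move=> tt; exists (Num.max (b t) 0 ^+ 2) => q Bq.
  have q_ge0 : 0 <= q by rewrite (le_trans _ Bq)// sqr_ge0.
  apply: v_out => //; first by lra.
  rewrite (@le_trans _ _ (Num.max (b t) 0))//; first by rewrite le_max lexx.
  have m0 : 0 <= Num.max (b t) 0 by rewrite le_max lexx orbT.
  by rewrite -(ger0_norm m0) -sqrtr_sqr ler_wsqrtr.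
pose beta := m / (N%:R * (m - 1) + 2).
have D0 : 0 < N%:R * (m - 1) + 2 by rewrite ltr_wpDl// mulr_ge0//; lra.
have beta0 : 0 < beta by rewrite divr_gt0//; lra.
have [lam lam0 hlam] := potential_front_upper hN hm q00 v_ge0 v_le1 P_init P_time
  P_cont P_space v_supp (ltW T0_gt0).
pose eta := U rho / 2; have eta0 : 0 < eta by rewrite divr_gt0// U_pos// ltW.
have [M2 hM2] := uniform_cvg_pinfty_lt hconv eta0.
pose T3 := Num.max M2 T0; have T3T0 : T0 <= T3 by rewrite le_max lexx orbT.
have sq0 : Num.sqrt q0 = rho by rewrite sqrtr_sqr ger0_norm// ltW.
have v_low t : T3 <= t -> eta <= v q0 t.
  move=> tt; have t_ge0 : 0 <= t by lra.
  have [x -> xq] := vE q0 t (ltW q00) t_ge0.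
  have M2t : M2 <= t by apply: le_trans tt; rewrite le_max lexx.
  have := hM2 t x M2t; rewrite xq sq0 ltr_norml => /andP[h1 _].
  by move: h1; rewrite /eta; lra.
(* The rate is halved because [t - T3 >= t / 2] once [t >= 2 * T3]. *)
pose c0 := eta `^ m / 2; have c00 : 0 < c0 by rewrite divr_gt0// powR_gt0.
have P_low t : 2 * T3 <= t -> c0 * t <= P q0 t.
  move=> tt; have T3t : T3 <= t by lra.
  have [c cI E] := MVT_is_derive T3t (fun x _ => P_time q0 x).
  have P3 : 0 <= P q0 T3 by exact: (potential_ge0 P_init P_time).
  have vc : eta `^ m <= v q0 c `^ m.
    rewrite ge0_ler_powR ?nnegrE ?(ltW eta0)//; first by lra.
    by apply: v_low; case/andP: cI.
  have h : eta `^ m * (t - T3) <= v q0 c `^ m * (t - T3) by rewrite ler_wpM2r// subr_ge0.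
  have h2 : eta `^ m * (t / 2) <= eta `^ m * (t - T3) by rewrite ler_wpM2l ?powR_ge0//; lra.
  move: E; rewrite -/v /c0 => E.
  have -> : eta `^ m / 2 * t = eta `^ m * (t / 2) by ring.
  lra.
have T02 : T0 <= 2 * T3 by lra.
have T20 : 0 < 2 * T3 by lra.
have [eps eps0 heps] := potential_front_lower hN hm q00 v_ge0 P_init P_time
  P_cont P_space T02 T20 c00 P_low.
have t_large : exists2 T4, 0 < T4 & forall t, T4 <= t -> rho < eps * t `^ beta.
  pose X := rho / eps + 1; have X0 : 0 < X by rewrite ltr_wpDl// divr_ge0 ?ltW.
  exists (X `^ beta^-1); first by rewrite powR_gt0.
  move=> t Xt; rewrite mulrC -ltr_pdivrMr//.
  apply: (@lt_le_trans _ _ X); first by rewrite /X ltrDl.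
  have -> : X = (X `^ beta^-1) `^ beta by rewrite -powRrM mulVf ?gt_eqF// powRr1 ?ltW.
  rewrite ge0_ler_powR ?nnegrE ?powR_ge0 ?(ltW beta0)//.
  exact: le_trans (powR_ge0 _ _) Xt.
have [T4 T40 hT4] := t_large.
pose T := Num.max (2 * T3 + 1) T4 + 1.
have TT3 : 2 * T3 + 2 <= T.
  have : 2 * T3 + 1 <= Num.max (2 * T3 + 1) T4 by rewrite le_max lexx.
  by rewrite /T; lra.
have TT4 : T4 <= T.
  have : T4 <= Num.max (2 * T3 + 1) T4 by rewrite le_max lexx orbT.
  by rewrite /T; lra.
exists eps, (Num.sqrt (3 * (lam * 2 `^ (2 * beta)))), T; split => //.
- by rewrite sqrtr_gt0 !mulr_gt0// powR_gt0.
- by lra.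
move=> t Tt; have t0 : 0 < t by lra.
rewrite -/beta; apply/andP; split.
  rewrite leNgt; apply/negP => bt.
  have large := hT4 t (le_trans TT4 Tt).
  (* If [b t] were too small, [P(.,t)] would vanish beyond [B^2] by [potential_support], yet be
     positive at [r^2] for a radius [r] between [B] and the lower front. The maximum with [rho]
     stays in the exterior region, and [T4] keeps it below the front. *)
  pose B := Num.max (b t) rho.
  have Brho : rho <= B by rewrite le_max lexx orbT.
  have Bt : B < eps * t `^ beta by rewrite gt_max bt large.
  pose r := (B + eps * t `^ beta) / 2.
  have r0 : 0 < r by rewrite /r; lra.
  have rB : B < r by rewrite /r; lra.
  have sr : Num.sqrt (r ^+ 2) = r by rewrite sqrtr_sqr gtr0_norm.
  have B0 : 0 < B by exact: lt_le_trans Brho.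
  have Br2 : B ^+ 2 < r ^+ 2 by rewrite ltr_pXn2r// nnegrE ltW.
  have qB : q0 <= B ^+ 2 by rewrite ler_pXn2r// nnegrE ltW.
  have Pz : P (r ^+ 2) t = 0.
    apply: (potential_support hN hm q00 v_ge0 v_le1 P_init P_time P_cont P_space qB) => //.
      by lra.
    move=> q Bq; apply: v_out => //; first by have := sqr_ge0 B; lra.
    rewrite (@le_trans _ _ B) ?le_max ?lexx//.
    by rewrite -(ger0_norm (ltW B0)) -sqrtr_sqr ler_wsqrtr// ltW.
  have : 0 < P (r ^+ 2) t.
    apply: heps; [by lra|by rewrite (le_trans qB)// ltW|].
    by rewrite sr -/beta /r; lra.
  by rewrite Pz ltxx.
(* The front bound is used at time [2 t]: [P Q (2 t) = 0] makes [v Q] vanish at the earlier time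
   [t], so [b t <= sqrt Q]. Doubling time only changes the constant. *)
pose Q := 3 * (lam * (2 * t) `^ (2 * beta)).
have Q0 : 0 <= Q by rewrite !mulr_ge0 ?powR_ge0// ltW.
have PQ : P Q (2 * t) = 0 by apply: hlam; [lra|lra|rewrite /Q lexx].
have vQ : v Q t = 0.
  by apply: (potential_zero_density P_init P_time PQ); lra.
have -> : t `^ beta = Num.sqrt (t `^ (2 * beta)).
  by rewrite [2 * beta]mulrC (powRrM t beta) powR_mulrn ?powR_ge0// sqrtr_sqr ger0_norm ?powR_ge0.
rewrite -sqrtrM; last by rewrite !mulr_ge0 ?powR_ge0// ltW.
apply: le_trans (v_in Q t t0 Q0 vQ) _.
have t_ge0 : 0 <= t by exact: ltW.
suff -> : Q = 3 * (lam * 2 `^ (2 * beta)) * t `^ (2 * beta) by [].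
by rewrite /Q powRM//; move: (2 `^ _) (t `^ _) => x z; ring.
Qed.
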